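(* Let $\mathcal{Z}$ and $\mathcal{Z}'$ be two affine toric varieties defined by maximal simplicial pairs, and denote by $0$ and $0'$ their closed (i.e. $0$-dimensional) orbits. Then the germs $(\mathcal{Z},0)$ and $(\mathcal{Z}',0')$ are isomorphic as germs of complex analytic varieties if and only if $\mathcal{Z}$ and $\mathcal{Z}'$ are isomorphic as toric varieties.
   Context: For a lattice $\mathcal{W}$ with dual lattice $\mathcal{M}$ and a strictly convex finite rational polyhedral cone $\sigma\subset\mathcal{W}_{\mathbf{R}}=\mathcal{W}\otimes\mathbf{R}$ with dual cone $\check{\sigma}$, the affine normal toric variety defined by the pair $(\mathcal{W},\sigma)$ is $\mathcal{Z}(\mathcal{W},\sigma):=\mathrm{Spec}\,\mathbf{C}[\check{\sigma}\cap\mathcal{M}]$. The pair is maximal if $\sigma$ and $\mathcal{W}_{\mathbf{R}}$ have the same dimension, and simplicial if $\sigma$ is a simplicial cone. For a maximal pair, $\mathcal{Z}(\mathcal{W},\sigma)$ has a unique closed orbit, which is a point. Isomorphism as toric varieties means equivariant isomorphism; for $\mathcal{Z}=\mathcal{Z}(\mathcal{W},\sigma)$ and $\mathcal{Z}'=\mathcal{Z}(\mathcal{W}',\sigma')$ this is the same as an isomorphism of pairs, i.e. a lattice isomorphism $\mathcal{W}\to\mathcal{W}'$ sending $\sigma$ onto $\sigma'$. *)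

(* Defs.v *)
(* MathComp + MathComp-Analysis; the real numbers are an arbitrary
   [R : realType] and the complex numbers are [R[i]]. *)
From HB Require Import structures.
From mathcomp Require Export all_boot all_order all_algebra finmap.
From mathcomp Require Export all_classical all_reals all_analysis.
From mathcomp Require Export complex summability.

Set Implicit Arguments.
Unset Strict Implicit.
Unset Printing Implicit Defensive.

Import Order.TTheory GRing.Theory Num.Theory numFieldNormedType.Exports.

Local Open Scope classical_set_scope.
Local Open Scope ring_scope.

(* The copy [R[i]^o] of [R[i]] is the one that carries the topology of the
   norm. *)
Notation Cplx R := (R[i]^o).

Section Cones.
Variables (R : realType) (V : vectType R).
Implicit Types (W sigma : set V).

(* A lattice is given together with its real span [V], which stands for
   W (x) R: it is the Z-span of an R-basis of [V]. *)
Definition is_lattice W : Prop :=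
  exists n (b : n.-tuple V), basis_of fullv b /\ W = [set w | inIntSpan b w].

Definition generated_cone (g : seq V) : set V :=
  [set v | exists2 a : 'I_(size g) -> R,
     (forall i, 0 <= a i) & v = \sum_i a i *: g`_i].

Definition rational_polyhedral W sigma : Prop :=
  exists2 g : seq V, (forall v, v \in g -> W v) & sigma = generated_cone g.

Definition strictly_convex sigma : Prop :=
  forall v, sigma v -> sigma (- v) -> v = 0.

(* The dimension of a cone is that of its linear span. *)
Definition cone_dim sigma (d : nat) : Prop :=
  exists U : {vspace V},
    [/\ forall v, sigma v -> v \in U,
        forall U' : {vspace V},
          (forall v, sigma v -> v \in U') -> (U <= U')%VS
      & \dim U = d].

Definition simplicial_cone sigma : Prop :=
  exists2 g : seq V, free g & sigma = generated_cone g.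

Definition toric_pair W sigma : Prop :=
  [/\ is_lattice W, rational_polyhedral W sigma & strictly_convex sigma].

Definition maximal_pair sigma : Prop := cone_dim sigma (\dim {:V}).

Definition maximal_simplicial_pair W sigma : Prop :=
  [/\ toric_pair W sigma, maximal_pair sigma & simplicial_cone sigma].

Definition dual_lattice W : set 'Hom(V, R^o) :=
  [set u | forall w, W w -> (u w : R) \is a Num.int].

Definition dual_cone sigma : set 'Hom(V, R^o) :=
  [set u | forall v, sigma v -> 0 <= (u v : R)].

Definition dual_monoid W sigma : set 'Hom(V, R^o) :=
  dual_cone sigma `&` dual_lattice W.

End Cones.

Section ToricVariety.
Variables (R : realType) (V : vectType R).

(* Functions on the dual space with the topology of pointwise convergence.  The
   points of toric varieties live here; the value of [x] at [u] is the value at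
   the point [x] of the monomial with exponent [u]. *)
Definition monomial_values := {ptws 'Hom(V, R^o) -> Cplx R}.

Implicit Types (W sigma : set V) (x t p : monomial_values).

(* The complex points of Spec C[S], S = dual_monoid W sigma, are the C-algebra
   morphisms C[S] -> C, i.e. the monoid morphisms from S to the multiplicative
   monoid C.  They are extended by 0 outside S, so that equality of points is
   equality of functions.  The topology induced by [monomial_values] is the classical one:
   it is induced by any embedding into C^N given by generators of S. *)
Definition toric_variety W sigma : set monomial_values :=
  [set x | [/\ x 0 = 1,
               forall u v, dual_monoid W sigma u -> dual_monoid W sigma v ->
                 x (u + v) = x u * x v
             & forall u, ~ dual_monoid W sigma u -> x u = 0]].

(* Here the monoid is the whole dual lattice M, so these are the group
   morphisms from M to C^*. *)
Definition torus W : set monomial_values := toric_variety W [set 0].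

(* Action of the torus; on the torus itself this is the group law. *)
Definition torus_act t x : monomial_values := fun u => t u * x u.

Definition torus_orbit W x : set monomial_values :=
  [set torus_act t x | t in torus W].

Definition closed_orbit W sigma (O : set monomial_values) : Prop :=
  (exists2 x, toric_variety W sigma x & O = torus_orbit W x) /\
  toric_variety W sigma `&` closure O `<=` O.

(* The restriction of [f] to the variety is an element of C[S]. *)
Definition regular_function W sigma (f : monomial_values -> Cplx R) : Prop :=
  exists n (c : 'I_n -> Cplx R) (m : 'I_n -> 'Hom(V, R^o)),
    (forall i, dual_monoid W sigma (m i)) /\
    (forall x, toric_variety W sigma x -> f x = \sum_i c i * x (m i)).

End ToricVariety.

Section Analytic.
Variable R : realType.

(* Sum of a convergent power series in a neighbourhood of [a]; the sum over all
   multi-indices is taken along the filter of finite subsets, i.e.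
   unconditionally. *)
Definition analytic_at N (F : 'rV[Cplx R]_N -> Cplx R) (a : 'rV[Cplx R]_N) :
    Prop :=
  exists c : {ffun 'I_N -> nat} -> Cplx R,
    \forall z \near a,
      partial_sum (fun k : {ffun 'I_N -> nat} =>
        c k * \prod_i ((z : 'rV[Cplx R]_N) ord0 i - a ord0 i) ^+ k i) @ totally --> F z.

Variable V : vectType R.

(* A function on the variety is holomorphic at [p] when it is, near [p], the
   restriction of an analytic function of the coordinates of an affine
   embedding.  As any finite set of monomials is part of a finite generating
   set of the monoid, one may allow arbitrary finite families of monomials. *)
Definition holomorphic_at (W sigma : set V)
    (f : monomial_values V -> Cplx R) (p : monomial_values V) : Prop :=
  exists N (m : 'I_N -> 'Hom(V, R^o)) (F : 'rV[Cplx R]_N -> Cplx R),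
    [/\ forall i, dual_monoid W sigma (m i),
        analytic_at F (\row_i p (m i))
      & \forall x \near p,
          toric_variety W sigma x -> f x = F (\row_i x (m i))].

End Analytic.

Section Morphisms.
Variables (R : realType) (V V' : vectType R).

Definition algebraic_map (W sigma : set V) (W' sigma' : set V')
    (phi : monomial_values V -> monomial_values V') : Prop :=
  (forall x, toric_variety W sigma x -> toric_variety W' sigma' (phi x)) /\
  (forall f, regular_function W' sigma' f ->
     regular_function W sigma (f \o phi)).

(* A map into the variety of (W', sigma') is holomorphic when its coordinates,
   which are monomials, are. *)
Definition holomorphic_map (W sigma : set V) (U : set (monomial_values V))
    (W' sigma' : set V') (U' : set (monomial_values V'))
    (phi : monomial_values V -> monomial_values V') : Prop :=
  forall x, (toric_variety W sigma `&` U) x ->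
    (toric_variety W' sigma' `&` U') (phi x) /\
    (forall u, dual_monoid W' sigma' u ->
       holomorphic_at W sigma (fun y => phi y u) x).

End Morphisms.

Section Isomorphisms.
Variables (R : realType) (V V' : vectType R).

Definition algebraic_iso (W sigma : set V) (W' sigma' : set V')
    (phi : monomial_values V -> monomial_values V') : Prop :=
  algebraic_map W sigma W' sigma' phi /\
  exists psi : monomial_values V' -> monomial_values V,
    [/\ algebraic_map W' sigma' W sigma psi,
        forall x, toric_variety W sigma x -> psi (phi x) = x
      & forall y, toric_variety W' sigma' y -> phi (psi y) = y].

(* Equivariant isomorphism, with respect to an isomorphism [alpha] between the
   tori (as algebraic groups). *)
Definition toric_isomorphic (W sigma : set V) (W' sigma' : set V') : Prop :=
  exists alpha phi : monomial_values V -> monomial_values V',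
    [/\ algebraic_iso W [set 0] W' [set 0] alpha,
        forall s t, torus W s -> torus W t ->
          alpha (torus_act s t) = torus_act (alpha s) (alpha t),
        algebraic_iso W sigma W' sigma' phi
      & forall t x, torus W t -> toric_variety W sigma x ->
          phi (torus_act t x) = torus_act (alpha t) (phi x)].

(* The germs at [p] and [p'] are isomorphic when some open neighbourhoods of
   [p] and [p'] in the two varieties are biholomorphic, with [p] sent to [p']. *)
Definition analytic_germs_isomorphic (W sigma : set V) (p : monomial_values V)
    (W' sigma' : set V') (p' : monomial_values V') : Prop :=
  exists (U : set (monomial_values V)) (U' : set (monomial_values V'))
         (phi : monomial_values V -> monomial_values V')
         (psi : monomial_values V' -> monomial_values V),
    (open_nbhs p U /\ open_nbhs p' U') /\
    [/\ holomorphic_map W sigma U W' sigma' U' phi,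
        holomorphic_map W' sigma' U' W sigma U psi,
        forall x, (toric_variety W sigma `&` U) x -> psi (phi x) = x,
        forall y, (toric_variety W' sigma' `&` U') y -> phi (psi y) = y
      & phi p = p'].

End Isomorphisms.

(* Main.v *)
(* In coordinates dual to suitable generators of the rays, the dual monoid of a
   maximal simplicial pair is [S], the intersection of [N^n] with a subgroup of
   finite index of [Z^n].  Expanding an isomorphism of germs in power series
   gives mutually inverse multiplicative maps [Phi] and [Psi] between
   [C[[S']]] and [C[[S]]].  Choose [lam : N^n' -> C] additive and injective and
   transport the derivation [x^u |-> lam u * x^u] of [C[[S']]] to [C[[S]]].
   The homogeneous components of a derivation of [C[[S]]] are supported at the
   Demazure roots, hence the transported one does not lower the degree and
   its part of degree 0 is a linear vector field.  The form of lowest degree of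
   [Phi u] is an eigenvector of this field with eigenvalue [lam u].  After a
   linear change of coordinates that triangularizes the field and respects the
   classes of the coordinates modulo the lattice, [u |-> the leading exponent of
   the lowest form of Phi u] is additive; it is injective since it determines
   [lam u], and surjective since [Phi] is.  This isomorphism of the monoids
   [S'] and [S] comes from an isomorphism of the pairs. *)

Require Import Defs.
From mathcomp Require Import perm sesquilinear spectral ring zify.
From mathcomp Require Import -(notations) mpoly.

Set Implicit Arguments.
Unset Strict Implicit.
Unset Printing Implicit Defensive.

Import Order.TTheory GRing.Theory Num.Theory numFieldNormedType.Exports.

Local Open Scope classical_set_scope.
Local Open Scope ring_scope.
Local Open Scope sesquilinear_scope.

Local Notation X_ := (mpolyX _).
Local Notation mU := mnm1.
Local Notation "a :+ b" := (mnm_add a b) (at level 50, left associativity).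

(** * Linear algebra and polynomials *)

(** The obstacle is that an isomorphism of germs comes without a lift to the coordinates of [C^n],
    and that the monoid has generators in several degrees, so there are no Jacobian matrices to
    compare. What survives transport is an eigenvalue: [lam] is additive, hence defines a
    derivation, and injective, hence gives every monomial its own eigenvalue. Powers of a
    transcendental number supply such a weight. The lowest form of [Phi u] need not be a monomial;
    the triangular shape of the field is what allows the eigenvalue to be read off a leading
    exponent.

    Analysis enters through bounds [|f z| <= M * t ^+ K] on polydiscs of radius [t]. Expansions are
    understood as asymptotic ones, their coefficients are unique, and composing them needs only
    finite sums. For want of a lift, a holomorphic function is approximated by finite sums of
    monomials of the variety itself, which can be evaluated along any family of points
    ([small_arc]), in particular along the image of the parametrization under the inverse germ. *)

Lemma unitmx_nonzero_perm (F : fieldType) n (A : 'M[F]_n) : A \in unitmx ->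
  exists s : 'I_n -> 'I_n, injective s /\ forall i, A i (s i) != 0.
Proof.
rewrite unitmxE unitfE => dA.
case: (pselect (exists s : {perm 'I_n}, \prod_i A i (s i) != 0)) => [[s hs]|h].
  by exists s; split; [exact: perm_inj|move=> i; move/prodf_neq0: hs; exact].
(* If all the permutation products vanish, so does the Leibniz expansion of the determinant. *)
case/eqP: dA; rewrite /determinant big1 // => s _.
have [->|/eqP hs] := pselect (\prod_i A i (s i) = 0); first by rewrite mulr0.
by case: h; exists s.
Qed.

(* The unitary conjugation triangularizing [A] and the real diagonal matrix [E]
   of the labels simultaneously keeps [E] Hermitian, hence makes it diagonal. *)
Lemma block_triangularization (C : numClosedFieldType) n (A : 'M[C]_n)
    (f : 'I_n -> nat) :
  (forall i j, A i j != 0 -> f i = f j) ->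
  exists (B Bi A' : 'M[C]_n) (s : 'I_n -> 'I_n),
    [/\ B *m Bi = 1%:M, Bi *m B = 1%:M & A *m B = B *m A'] /\
    [/\ injective s, forall i j : 'I_n, (j < i)%N -> A' i j = 0,
        forall i j, B i j != 0 -> f i = f (s j)
      & forall i j, Bi i j != 0 -> f (s i) = f j].
Proof.
move=> hA.
pose E : 'M[C]_n := diag_mx (\row_i (f i)%:R).
have EA : A^T *m E = E *m A^T.
  apply/matrixP => i j; rewrite mul_mx_diag mul_diag_mx !mxE mulrC.
  by have [->|/hA ->] := eqVneq (A j i) 0; rewrite ?mulr0.
have [P Pu /andP[tA tE]] := cotrigonalization2 EA.
have Pun : P \in unitmx by exact: unitarymx_unit.
rewrite /similar_to !conjymx // in tA tE.
have PPi : P *m P^t* = 1%:M by apply/unitarymxP.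
have PiP : P^t* *m P = 1%:M by exact: mulmx1C.
have tmxE (M : 'M[C]_n) i j : (M^t*) i j = (M j i)^* by rewrite !mxE.
have [D DE] : exists D, D = P *m E *m P^t* by eexists.
rewrite -DE in tE.
have Edg i j : i != j -> D i j = 0.
  have herm : D^t* = D.
    rewrite DE !trmx_mul !map_mxM /= mulmxA trmxCK; congr (_ *m _ *m _).
    apply/matrixP => k l; rewrite tmxE !mxE eq_sym.
    have [->|] := eqVneq; last by rewrite !mulr0n conjC0.
    by rewrite !mulr1n conjC_nat.
  rewrite neq_lt => /orP[ij|ji].
    by move/is_trig_mxP: tE; apply.
  rewrite -herm tmxE; move/is_trig_mxP: tE => ->//.
  by rewrite conjC0.
have PE i j : D i i * P i j = P i j * (f j)%:R.
  have : D *m P = P *m E by rewrite DE -mulmxA PiP mulmx1.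
  move/matrixP/(_ i j); rewrite mul_mx_diag [RHS]mxE mxE => DP.
  rewrite (bigD1 i) //= big1 ?addr0 in DP; last first.
    by move=> k ki; rewrite Edg ?mul0r// eq_sym.
  by rewrite DP mxE.
(* Row [i] of [P] is supported where [f] takes the value [D i i]; a permutation through nonzero
   entries realizes this value as [f (s i)]. *)
have [s [sinj hs]] := unitmx_nonzero_perm Pun.
have Pf i j : P i j != 0 -> f j = f (s i).
  move=> Pij; apply/eqP; rewrite -(eqr_nat C).
  have := PE i j; rewrite mulrC => /(mulfI Pij) <-.
  have := PE i (s i); rewrite mulrC => /(mulfI (hs i)) <-.
  by rewrite eqxx.
exists P^T, (P^t*)^T, (P *m A^T *m P^t*)^T, s; split; split => //.
- by rewrite -trmx_mul PiP trmx1.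
- by rewrite -trmx_mul PPi trmx1.
- rewrite -trmx_mul -[A in LHS]trmxK -trmx_mul; congr (_^T).
  by rewrite -!mulmxA PiP mulmx1.
- by move=> i j ji; rewrite mxE; move/is_trig_mxP: tA; apply.
- by move=> i j; rewrite mxE => /Pf.
- by move=> i j; rewrite mxE tmxE conjC_eq0 => /Pf.
Qed.

(** * Polynomials as truncated power series *)

Section PolynomialLemmas.
Variables (n : nat) (C : comNzRingType).
Implicit Types (p q : mpoly n C) (a b : multinom n).

Lemma mpoly_ring_ind (P : mpoly n C -> Prop) :
  (forall c, P (mpolyC n c)) -> (forall i, P (X_ (mU i))) ->
  (forall p q, P p -> P q -> P (p + q)) ->
  (forall p q, P p -> P q -> P (p * q)) -> forall p, P p.
Proof.
move=> PC PX PD PM.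
have PXm a : P (X_ a).
  rewrite mpolyXE_id; elim/big_ind: _ => //; first exact: PC.
  move=> i _; elim: (a i) => [|k IH]; first by rewrite expr0; exact: PC.
  by rewrite exprS; exact: PM.
elim/mpolyind => [|c a p _ _ Pp]; first exact: (PC 0).
by apply: PD => //; rewrite -mul_mpolyC; apply: PM.
Qed.

Lemma mcoeff_mulX p a b : mcoeff b (p * X_ a) =
  if [forall i, a i <= b i]%N then mcoeff (mnm_sub b a) p else 0.
Proof.
case: forallP => [h|h].
  have -> : b = a :+ mnm_sub b a.
    by apply/mnmP => i; rewrite mnmDE mnmBE subnKC.
  by rewrite mcoeffMX addmC addmK.
apply/eqP; rewrite mcoeff_eq0; apply/negP => /msuppM_le /allpairsP[[k l] /=].
rewrite msuppX inE => -[_ /eqP-> bE]; apply: h => i.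
by rewrite bE mnmDE leq_addl.
Qed.

Definition truncation K (f : multinom n -> C) : mpoly n C :=
  \sum_(a : bmultinom n K) f a *: X_ a.

Lemma mcoeff_truncation K f a :
  mcoeff a (truncation K f) = if (mdeg a < K)%N then f a else 0.
Proof.
case: ltnP => h; first exact: mcoeff_mpoly.
rewrite /truncation raddf_sum /= big1 // => b _.
rewrite mcoeffZ mcoeffX; case: eqP => [E|]; last by rewrite mulr0.
by move: (bmdeg b); rewrite E ltnNge h.
Qed.

Lemma big_bmultinom_widen (F : multinom n -> C) N0 N :
  (N0 <= N)%N -> (forall a, (N0 <= mdeg a)%N -> F a = 0) ->
  \sum_(a : bmultinom n N) F a = \sum_(a : bmultinom n N0) F a.
Proof.
move=> le0 F0.
(* A sum of coefficients is the value at the point with all coordinates 1, so it suffices to compare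
   the two polynomials. *)
have E M : \sum_(a : bmultinom n M) F a = meval (fun=> 1) (truncation M F).
  rewrite /truncation raddf_sum /=; apply: eq_bigr => a _.
  by rewrite mevalZ mevalX big1 ?mulr1 // => i _; rewrite expr1n.
rewrite !E; congr meval; apply/mpolyP => a; rewrite !mcoeff_truncation.
case: (ltnP (mdeg a) N0) => h; first by rewrite (leq_trans h le0).
by case: ifP => // _; rewrite F0.
Qed.

(** Cauchy product of power series; both factors have degree at most that of [a], so the bounded
    index type loses nothing. *)
Definition fmul (f g : multinom n -> C) a : C :=
  \sum_(k : bmultinom n (mdeg a).+1 * bmultinom n (mdeg a).+1
        | a == k.1 :+ k.2) f k.1 * g k.2.

Lemma fmulE K f g a : (mdeg a < K)%N ->
  fmul f g a = mcoeff a (truncation K f * truncation K g).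
Proof.
move=> h; rewrite mcoeffM; apply: eq_bigr => k /eqP kE.
rewrite !mcoeff_truncation.
have : (mdeg k.1 + mdeg k.2 < K)%N by rewrite -mdegD -kE.
by move=> h2; rewrite (leq_ltn_trans (leq_addr _ _) h2)
  (leq_ltn_trans (leq_addl _ _) h2).
Qed.

(** Congruence modulo terms of degree at least [K]. Power series are mere coefficient functions, and
    identities between them are proved on truncations. *)
Definition eqm K p q := forall a, (mdeg a < K)%N -> mcoeff a p = mcoeff a q.

Lemma eqm_trans K p q r : eqm K p q -> eqm K q r -> eqm K p r.
Proof. by move=> h1 h2 a ha; rewrite h1 ?h2. Qed.

Lemma eqm_sym K p q : eqm K p q -> eqm K q p.
Proof. by move=> h a ha; rewrite h. Qed.

Lemma eqmD K p q p' q' : eqm K p p' -> eqm K q q' -> eqm K (p + q) (p' + q').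
Proof. by move=> h1 h2 a ha; rewrite !mcoeffD h1 ?h2. Qed.

Lemma eqmM K p q p' q' : eqm K p p' -> eqm K q q' -> eqm K (p * q) (p' * q').
Proof.
move=> h1 h2 a ha; rewrite !mcoeffM; apply: eq_bigr => k /eqP kE.
have : (mdeg k.1 + mdeg k.2 < K)%N by rewrite -mdegD -kE.
by move=> h; rewrite h1 ?h2 // (leq_ltn_trans _ h) ?leq_addr ?leq_addl.
Qed.

Lemma eqm_sum K (I : Type) (r : seq I) (P : pred I) (F G : I -> mpoly n C) :
  (forall i, P i -> eqm K (F i) (G i)) ->
  eqm K (\sum_(i <- r | P i) F i) (\sum_(i <- r | P i) G i).
Proof.
by move=> h a ha; rewrite !raddf_sum; apply: eq_bigr => i Pi; exact: h.
Qed.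

Lemma eqmZ K c p q : eqm K p q -> eqm K (c *: p) (c *: q).
Proof. by move=> h a ha; rewrite !mcoeffZ h. Qed.

End PolynomialLemmas.

(** [Rel] is additive, so checking it on the images of the variables is enough. It will record that
    a linear change of coordinates respects the degree and the class of an exponent modulo the
    lattice. *)
Lemma comp_mpoly_supp n m (C : comNzRingType)
    (Rel : multinom n -> multinom m -> Prop) (lq : n.-tuple (mpoly m C)) :
  Rel mnm0 mnm0 ->
  (forall a b a' b', Rel a b -> Rel a' b' -> Rel (a :+ a') (b :+ b')) ->
  (forall i b, b \in msupp (tnth lq i) -> Rel (mU i) b) ->
  forall p b, b \in msupp (comp_mpoly lq p) ->
    exists2 a, a \in msupp p & Rel a b.
Proof.
move=> R0 RD RU p b.
pose good a (q : mpoly m C) := forall b, b \in msupp q -> Rel a b.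
have goodM a a' q q' : good a q -> good a' q' -> good (a :+ a') (q * q').
  move=> g g' c /msuppM_le /allpairsP[[k l] /= [hk hl ->]].
  by apply: RD; [exact: g|exact: g'].
have good1 : good mnm0 1 by move=> c; rewrite msupp1 inE => /eqP->.
have goodX a : good a (comp_mpoly lq (X_ a)).
  rewrite comp_mpolyX [a in good a _]multinomUE_id.
  apply: (big_rec2 (fun x y => good x y)) => // i q c _ gq; apply: (goodM) => //.
  elim: (a i) => [|k IH]; first by rewrite expr0.
  by rewrite exprS mulmS; apply: goodM => // d; exact: RU.
rewrite comp_mpolyEX => /msupp_sum_le /flattenP[s /mapP[a ap ->]].
by move=> /msuppZ_le /goodX Rab; exists a => //; move: ap; rewrite mem_filter.
Qed.

(** The largest of the leading exponents belongs to a single term, so nothing can cancel it. *)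
Lemma sum_distinct_mlead n (C : idomainType) (I : finType) (P : pred I)
    (c : I -> C) (F : I -> mpoly n C) :
  (exists i, P i) -> (forall i, P i -> c i != 0 /\ F i != 0) ->
  (forall i j, P i -> P j -> mlead (F i) = mlead (F j) -> i = j) ->
  exists2 i, P i & mcoeff (mlead (F i)) (\sum_(i | P i) c i *: F i) != 0.
Proof.
move=> [i0 Pi0] nz inj.
have [i Pi imax] := @Order.TotalTheory.arg_maxP _ _ I i0 P (fun i => mlead (F i)) Pi0.
exists i => //; rewrite raddf_sum (bigD1 i) //= big1 ?addr0.
  by rewrite mcoeffZ mulf_neq0 ?mleadc_eq0; have [] := nz _ Pi.
move=> j /andP[Pj ji]; rewrite mcoeffZ mcoeff_gt_mlead ?mulr0 // lt_neqAle.
have le : (mlead (F j) <= mlead (F i))%O := imax _ Pj.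
by rewrite le andbT; apply: contra ji => /eqP E; apply/eqP/inj.
Qed.

(** * Formal homomorphisms and derivations *)

Definition ev n (a : multinom n) : 'rV[int]_n := \row_i (a i)%:Z.

Lemma evD n (a b : multinom n) : ev (a :+ b) = ev a + ev b.
Proof. by apply/rowP => i; rewrite !mxE mnmDE PoszD. Qed.

Lemma ev0 n : ev (@mnm0 n) = 0.
Proof. by apply/rowP => i; rewrite !mxE mnm0E. Qed.

Lemma ev_inj n : injective (@ev n).
Proof.
move=> a b /rowP E; apply/mnmP => i; move: (E i); rewrite !mxE.
by case.
Qed.

Local Notation axis i d := (mnm_muln (mnm1 i) d).

Lemma axisE n (i j : 'I_n) d : axis i d j = ((i == j) * d)%N.
Proof. by rewrite mulmnE mnm1E. Qed.

(* A subgroup of [Z^n] of finite index whose coordinate functions are all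
   primitive. *)
Record index_lattice n (L : set 'rV[int]_n) (d : nat) : Prop := IndexLattice {
  il0 : L 0;
  ilB : forall x y, L x -> L y -> L (x - y);
  il_gt0 : (0 < d)%N;
  il_axis : forall i, L (ev (axis i d));
  il_prim : forall i, exists2 x, L x & x 0 i = 1 }.

Section IndexLattice.
Variables (n : nat) (L : set 'rV[int]_n) (d : nat).
Hypothesis hL : index_lattice L d.

Lemma ilN x : L x -> L (- x).
Proof. by move=> h; rewrite -[- x]add0r; apply: (ilB hL) h; exact: (il0 hL). Qed.

Lemma ilD x y : L x -> L y -> L (x + y).
Proof. by move=> h /ilN h'; rewrite -[y]opprK; exact: (ilB hL). Qed.

Lemma ilMn x k : L x -> L (x *+ k).
Proof.
move=> h; elim: k => [|k IH]; first by rewrite mulr0n; exact: (il0 hL).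
by rewrite mulrS; exact: ilD.
Qed.

Lemma evMn (a : multinom n) k : ev (mnm_muln a k) = ev a *+ k.
Proof.
apply/rowP => i; rewrite mulmxnE !mxE mulmnE.
by rewrite PoszM -[X in _ * X]natz mulr_natr.
Qed.

End IndexLattice.

Section FormalHom.
Variable C : numClosedFieldType.

(* [Phi u] is the sequence of coefficients of the image of the monomial [u]
   under a local homomorphism between algebras of formal power series with
   exponents in the positive orthants of [L'] and [L]. *)
Record formal_hom n' n (L' : set 'rV[int]_n') (L : set 'rV[int]_n)
    (Phi : multinom n' -> multinom n -> C) : Prop := FormalHom {
  fh_supp : forall u a, L' (ev u) -> Phi u a != 0 -> L (ev a);
  fh_one : forall a, Phi mnm0 a = (a == mnm0)%:R;
  fh_mul : forall u v, L' (ev u) -> L' (ev v) ->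
    forall a, Phi (u :+ v) a = fmul (Phi u) (Phi v) a;
  fh_aug : forall u, L' (ev u) -> u != mnm0 -> Phi u mnm0 = 0 }.

Definition formal_inverse n' n (L' : set 'rV[int]_n')
    (Phi : multinom n' -> multinom n -> C)
    (Psi : multinom n -> multinom n' -> C) :=
  forall u v, L' (ev u) -> exists N0, forall N, (N0 <= N)%N ->
    \sum_(s : bmultinom n N) Phi u s * Psi s v = (u == v)%:R.

(** Continuity for the adic topology. An exponent of degree above [n' * d'] has a coordinate at
    least [d'], so [axis i d'] splits off inside the lattice; its image has no constant term, and
    each such splitting gains one order. *)
Lemma fh_order n' n (L' : set 'rV[int]_n') d' (L : set 'rV[int]_n) Phi k :
  index_lattice L' d' -> formal_hom L' L Phi ->
  forall u a, L' (ev u) -> (n' * d' * k < mdeg u)%N -> (mdeg a < k)%N ->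
  Phi u a = 0.
Proof.
move=> hL' hPhi; elim: k => // k IH u a Lu du da.
have [i hi] : exists i, (d' <= u i)%N.
  apply/existsP; apply: contraLR du; rewrite negb_exists => /forallP h.
  rewrite -leqNgt mdegE (@leq_trans (\sum_(i < n') d'))%N //.
    by apply: leq_sum => i _; rewrite ltnW // ltnNge.
  by rewrite sum_nat_const card_ord mulnS leq_addr.
have n'0 : (0 < n')%N by exact: leq_ltn_trans (leq0n i) (ltn_ord i).
pose w := axis i d'; pose u' := mnm_sub u w.
have uE : u = w :+ u'.
  apply/mnmP => j; rewrite mnmDE mnmBE axisE subnKC //.
  by case: eqP => [<-|]; rewrite ?mul1n.
have Lw : L' (ev w) by exact: (il_axis hL').
have Lu' : L' (ev u').
  have -> : ev u' = ev u - ev w by rewrite uE evD addrC addKr.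
  exact: (ilB hL').
have du' : (n' * d' * k < mdeg u')%N.
  have : (n' * d' * k.+1 < mdeg w + mdeg u')%N by rewrite -mdegD -uE.
  rewrite mdegMn mdeg1 mul1n mulnS => h.
  rewrite -(ltn_add2l d'); apply: leq_ltn_trans h.
  by rewrite leq_add2r leq_pmull.
rewrite uE (fh_mul hPhi) // /fmul big1 // => -[b c] /= /eqP abc.
have [b0|b0] := eqVneq (b : multinom n) mnm0.
  rewrite b0 (fh_aug hPhi) ?mul0r //; apply/eqP => /(congr1 (fun m : multinom n' => m i)).
  by rewrite axisE eqxx mul1n mnm0E => d0; have := il_gt0 hL'; rewrite d0.
rewrite (IH u' c) ?mulr0 //.
apply: (@leq_trans (mdeg a)) => //.
have E : mdeg a = (mdeg b + mdeg c)%N by rewrite -mdegD -abc.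
by rewrite [X in (_ < X)%N]E -[X in (X < _)%N]add0n ltn_add2r lt0n mdeg_eq0.
Qed.

End FormalHom.

(** [fh_order] kills the terms of large degree, which replaces the unspecified threshold of
    [formal_inverse] by an explicit one. *)
Lemma inverse_sum (C : numClosedFieldType) n n' (L : set 'rV[int]_n)
    (L' : set 'rV[int]_n') d (Phi : multinom n' -> multinom n -> C) Psi :
  index_lattice L d -> formal_hom L' L Phi -> formal_hom L L' Psi ->
  formal_inverse L' Phi Psi ->
  forall u v N, L' (ev u) -> (n * d * (mdeg v).+1 < N)%N ->
  \sum_(s : bmultinom n N) Phi u s * Psi s v = (u == v)%:R.
Proof.
move=> hL hPhi hPsi inv u v N Lu hN; have [N0 hN0] := inv u v Lu.
rewrite -(hN0 (maxn N0 N)) ?leq_maxl //; apply/esym/(big_bmultinom_widen (F := fun s => Phi u s * Psi s v)).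
  exact: leq_maxr.
move=> a Na; have [->|/(fh_supp hPhi Lu) La] := eqVneq (Phi u a) 0.
  by rewrite mul0r.
by rewrite (fh_order hL hPsi La (leq_trans hN Na)) ?mulr0.
Qed.

(** * Transport of the derivation with weights [lam] *)

Section Derivation.
Variables (C : numClosedFieldType) (n n' : nat).
Variables (L : set 'rV[int]_n) (L' : set 'rV[int]_n') (d d' : nat).
Hypotheses (hL : index_lattice L d) (hL' : index_lattice L' d').
Variables (Phi : multinom n' -> multinom n -> C)
          (Psi : multinom n -> multinom n' -> C).
Hypotheses (hPhi : formal_hom L' L Phi) (hPsi : formal_hom L L' Psi).
Hypotheses (PhiPsi : formal_inverse L' Phi Psi)
           (PsiPhi : formal_inverse L Psi Phi).
Variable lam : multinom n' -> C.
Hypothesis lamD : forall u v, lam (u :+ v) = lam u + lam v.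

Local Notation bound' k := (n' * d' * k).+1.

Lemma PsiPhi_eq0 s v t k : L (ev s) -> (bound' k <= mdeg v)%N ->
  (mdeg t < k)%N -> Psi s v = 0 \/ Phi v t = 0.
Proof.
move=> Ls hv ht; have [->|/(fh_supp hPsi Ls) Lv] := eqVneq (Psi s v) 0.
  by left.
by right; exact: (fh_order hL' hPhi Lv hv ht).
Qed.

(** The diagonal derivation with eigenvalues [lam], conjugated by the two morphisms. By [fh_order],
    exponents [v] beyond the cutoff do not affect the coefficient of [t]. *)
Definition transported_der s t : C :=
  \sum_(v : bmultinom n' (bound' (mdeg t).+1)) Psi s v * lam v * Phi v t.
Local Notation D := transported_der.

Lemma transported_derE s t k : L (ev s) -> (mdeg t < k)%N ->
  D s t = \sum_(v : bmultinom n' (bound' k)) Psi s v * lam v * Phi v t.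
Proof.
move=> Ls tk.
apply/esym/(big_bmultinom_widen (F := fun v => Psi s v * lam v * Phi v t)).
  by rewrite ltnS leq_mul2l tk orbT.
move=> v hv; have [->|->] := PsiPhi_eq0 Ls hv (ltnSn _).
  by rewrite !mul0r.
by rewrite mulr0.
Qed.

Lemma transported_der_supp s t : L (ev s) -> D s t != 0 -> L (ev t).
Proof.
move=> Ls; apply: contra_neqP => Lt; apply: big1 => v _.
have [->|/(fh_supp hPsi Ls) Lv] := eqVneq (Psi s v) 0; first by rewrite !mul0r.
have [->|/(fh_supp hPhi Lv) //] := eqVneq (Phi v t) 0; first by rewrite mulr0.
Qed.

Lemma transported_der_aug s : L (ev s) -> s != mnm0 -> D s mnm0 = 0.
Proof.
move=> Ls s0; apply: big1 => v _.
have [->|v0] := eqVneq (v : multinom n') mnm0.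
  by rewrite (fh_aug hPsi) // !mul0r.
have [->|/(fh_supp hPsi Ls) Lv] := eqVneq (Psi s v) 0; first by rewrite !mul0r.
by rewrite (fh_aug hPhi) ?mulr0.
Qed.

(** Substitution of the series [Phi v] for the monomials, modulo degree [K]. It is multiplicative on
    polynomials supported in [L']; the cutoff comes from [fh_order]. *)
Let G K (p : mpoly n' C) : mpoly n C :=
  \sum_(v : bmultinom n' (bound' K)) mcoeff v p *: truncation K (Phi v).

Let G_sum K (I : Type) (r : seq I) (c : I -> C) (p : I -> mpoly n' C) :
  G K (\sum_(i <- r) c i *: p i) = \sum_(i <- r) c i *: G K (p i).
Proof.
under [RHS]eq_bigr do rewrite /G scaler_sumr.
rewrite exchange_big; apply: eq_bigr => v _.
by rewrite [mcoeff _ _]raddf_sum scaler_suml; apply: eq_bigr => i _ /=; rewrite mcoeffZ scalerA.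
Qed.

Let G_X K v : L' (ev v) -> G K (X_ v) = truncation K (Phi v).
Proof.
move=> Lv; rewrite /G; have [h|h] := ltnP (mdeg v) (bound' K).
  rewrite (bigD1 (BMultinom h)) //= mcoeffX eqxx scale1r big1 ?addr0 // => w.
  by rewrite -val_eqE /= eq_sym => /negPf wv; rewrite mcoeffX wv scale0r.
rewrite big1 => [|w _].
  apply/mpolyP => a; rewrite mcoeff_truncation mcoeff0; case: ifP => // ha.
  by rewrite (fh_order hL' hPhi Lv h ha).
rewrite mcoeffX; case: eqP => [E|]; last by rewrite scale0r.
by move: (bmdeg w); rewrite -E ltnNge h.
Qed.

Let GM K p q : (forall v, v \in msupp p -> L' (ev v)) ->
  (forall v, v \in msupp q -> L' (ev v)) -> eqm K (G K (p * q)) (G K p * G K q).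
Proof.
move=> hp hq; rewrite mpolyME G_sum.
have GE r : G K r = \sum_(m <- msupp r) mcoeff m r *: G K (X_ m).
  by rewrite -G_sum -mpolyE.
rewrite (GE p) (GE q) big_distrlr /= big_allpairs.
rewrite big_seq [in X in eqm _ _ X]big_seq.
apply: eqm_sum => v /hp Lv; rewrite big_seq [in X in eqm _ _ X]big_seq.
apply: eqm_sum => w /hq Lw; rewrite -scalerAl -scalerAr scalerA.
apply: eqmZ; rewrite !G_X ?evD //=; last exact: (ilD hL').
move=> a ha; rewrite mcoeff_truncation ha (fh_mul hPhi) //.
exact: fmulE.
Qed.

Let G_inv K s : L (ev s) -> eqm K (G K (truncation (bound' K) (Psi s))) (X_ s).
Proof.
move=> Ls t tK; rewrite mcoeffX.
rewrite -(inverse_sum hL' hPsi hPhi PsiPhi Ls (N := bound' K)); last first.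
  by rewrite ltnS leq_mul2l tK orbT.
rewrite raddf_sum /=; apply: eq_bigr => v _.
by rewrite mcoeffZ !mcoeff_truncation tK bmdeg.
Qed.

Let G_der K s : L (ev s) ->
  eqm K (G K (truncation (bound' K) (fun v => Psi s v * lam v)))
        (truncation K (D s)).
Proof.
move=> Ls t tK; rewrite mcoeff_truncation tK (transported_derE Ls tK).
rewrite raddf_sum /=; apply: eq_bigr => v _.
by rewrite mcoeffZ !mcoeff_truncation tK bmdeg.
Qed.

Let trunc_supp N s (c : multinom n' -> C) : L (ev s) -> forall v,
  v \in msupp (truncation N (fun v => Psi s v * c v)) -> L' (ev v).
Proof.
move=> Ls v; rewrite mcoeff_msupp mcoeff_truncation; case: ifP; last by rewrite eqxx.
move=> _ h; apply: (fh_supp hPsi Ls); apply: contraNneq h => ->.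
by rewrite mul0r.
Qed.

Let trunc_supp1 N s : L (ev s) -> forall v,
  v \in msupp (truncation N (Psi s)) -> L' (ev v).
Proof.
move=> Ls v; rewrite mcoeff_msupp mcoeff_truncation; case: ifP; last by rewrite eqxx.
by move=> _; exact: (fh_supp hPsi Ls).
Qed.

(** The diagonal operator obeys the Leibniz rule because [lam] is additive. [G] carries the rule
    over: it is multiplicative modulo degree [K] and sends the truncated series [Psi s] back to the
    monomial [s]. *)
Lemma transported_der_leibniz s s' K : L (ev s) -> L (ev s') ->
  eqm K (truncation K (D (s :+ s')))
    (truncation K (D s) * X_ s' + truncation K (D s') * X_ s).
Proof.
move=> Ls Ls'.
have Lss' : L (ev (s :+ s')) by rewrite evD; exact: (ilD hL).
apply: eqm_trans (eqm_sym (G_der Lss')) _.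
pose T s := truncation (bound' K) (Psi s).
pose T' s := truncation (bound' K) (fun v => Psi s v * lam v).
(* A big sum over a two-element list makes [G_sum] usable for additivity. *)
have -> : G K (truncation (bound' K) (fun v => Psi (s :+ s') v * lam v)) =
    \sum_(i <- [:: T' s * T s'; T' s' * T s]) 1 *: G K i.
  rewrite -G_sum !big_cons big_nil !scale1r addr0.
  apply: eq_bigr => v _; congr (_ *: _).
  rewrite mcoeff_truncation bmdeg (fh_mul hPsi) //.
  rewrite [T' s' * _]mulrC mcoeffD !mcoeffM -big_split mulr_suml /=.
  apply: eq_bigr => k /eqP kE; rewrite !mcoeff_truncation.
  have : (mdeg k.1 + mdeg k.2 < bound' K)%N by rewrite -mdegD -kE bmdeg.
  move=> h; rewrite (leq_ltn_trans (leq_addr _ _) h)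
    (leq_ltn_trans (leq_addl _ _) h).
  have -> : lam v = lam k.1 + lam k.2 by rewrite -lamD; exact: congr1 kE.
  ring.
rewrite !big_cons big_nil !scale1r addr0.
apply: eqmD; (apply: eqm_trans (GM _ _) _; [exact: trunc_supp|exact: trunc_supp1|]).
  by apply: eqmM; [exact: G_der|exact: G_inv].
by apply: eqmM; [exact: G_der|exact: G_inv].
Qed.

End Derivation.

(** * Homogeneous components of a derivation and Demazure roots *)

Section HomogeneousParts.
Variables (C : numClosedFieldType) (n : nat) (L : set 'rV[int]_n) (d : nat).
Hypothesis hL : index_lattice L d.
Variable D : multinom n -> multinom n -> C.
Hypothesis Dsupp : forall s t, L (ev s) -> D s t != 0 -> L (ev t).
Hypothesis Daug : forall s, L (ev s) -> s != mnm0 -> D s mnm0 = 0.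
Hypothesis Dleibniz : forall s s' K, L (ev s) -> L (ev s') ->
  eqm K (truncation K (D (s :+ s')))
    (truncation K (D s) * X_ s' + truncation K (D s') * X_ s).

Definition mz (x : 'rV[int]_n) : multinom n :=
  Multinom [tuple absz (x 0 i) | i < n].

Lemma mz_ev t : mz (ev t) = t.
Proof. by apply/mnmP => i; rewrite mnmE mxE. Qed.

Lemma ev_mz (x : 'rV[int]_n) : (forall i, 0 <= x 0 i) -> ev (mz x) = x.
Proof. by move=> x0; apply/rowP => i; rewrite mxE mnmE gez0_abs. Qed.

(** Extension of [D s] by zero to all of [Z^n]: for fixed [x], the numbers
    [shifted_der s (x + ev s)] describe the component of [D] of degree [x], even when [x + ev s]
    leaves the orthant. *)
Definition shifted_der s (x : 'rV[int]_n) : C :=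
  if [forall i, 0 <= x 0 i] then D s (mz x) else 0.
Local Notation Dz := shifted_der.

Lemma shifted_der_ev s t : Dz s (ev t) = D s t.
Proof.
rewrite /Dz mz_ev; case: forallP => // h; case: h => i.
by rewrite mxE.
Qed.

Lemma shifted_der_sub s t s' : Dz s (ev t - ev s') =
  if [forall i, s' i <= t i]%N then D s (mnm_sub t s') else 0.
Proof.
have -> : [forall i, s' i <= t i]%N = [forall i, 0 <= (ev t - ev s') 0 i].
  by apply: eq_forallb => i; rewrite !mxE subr_ge0.
rewrite /Dz; case: forallP => // h; congr (D s _).
apply/mnmP => i; rewrite mnmE mnmBE; move: (h i); rewrite !mxE subr_ge0 => le.
by rewrite subzn.
Qed.

Lemma shifted_der_lt0 s (x : 'rV[int]_n) i : x 0 i < 0 -> Dz s x = 0.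
Proof.
by move=> h; rewrite /Dz; case: forallP => // /(_ i); rewrite leNgt h.
Qed.

(** The Leibniz rule, read in the single degree [x], says that the coefficient is additive in the
    exponent [s]. *)
Lemma shifted_derD s s' x : L (ev s) -> L (ev s') ->
  Dz (s :+ s') (x + ev (s :+ s')) = Dz s (x + ev s) + Dz s' (x + ev s').
Proof.
move=> Ls Ls'; case: (pselect (forall i, 0 <= (x + ev (s :+ s')) 0 i)) => h.
  pose t := mz (x + ev (s :+ s')).
  have tE : ev t = x + ev (s :+ s') by exact: ev_mz.
  rewrite -tE shifted_der_ev.
  have -> : x + ev s = ev t - ev s' by rewrite tE evD addrA addrK.
  have -> : x + ev s' = ev t - ev s by rewrite tE evD addrA addrAC addrK.
  have := Dleibniz Ls Ls' (ltnSn (mdeg t)).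
  rewrite mcoeff_truncation ltnSn => ->.
  rewrite mcoeffD !mcoeff_mulX !shifted_der_sub !mcoeff_truncation.
  by rewrite !ltnS !mdegB.
(* Now [x + ev (s :+ s')] is negative at some [i], hence so are [x + ev s] and [x + ev s'], and all
   three terms are 0 by convention. *)
have [i hi] : exists i, (x + ev (s :+ s')) 0 i < 0.
  by move/existsNP: h => [i /negP]; rewrite -ltNge; exists i.
have lt (r : multinom n) y : ev (s :+ s') = y + ev r -> (x + y) 0 i < 0.
  move=> E; apply: le_lt_trans hi; rewrite E addrA [leRHS]mxE lerDl.
  by rewrite mxE.
rewrite !(@shifted_der_lt0 _ _ i) ?addr0 //.
  by apply: (lt s); rewrite evD addrC.
by apply: (lt s'); rewrite evD.
Qed.

Lemma shifted_derMn s x k : L (ev s) ->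
  Dz (mnm_muln s k) (x + ev (mnm_muln s k)) = k%:R * Dz s (x + ev s).
Proof.
move=> Ls; elim: k => [|k IH].
  rewrite mul0r mulm0n.
  have L0 : L (ev (@mnm0 n)) by rewrite ev0; exact: (il0 hL).
  have := shifted_derD x L0 L0; rewrite addm0.
  by move/(congr1 (fun z => z - Dz mnm0 (x + ev mnm0))); rewrite subrr addrK => <-.
rewrite mulmS shifted_derD //; last by rewrite evMn; exact: (ilMn hL).
by rewrite IH -nat1r mulrDl mul1r.
Qed.

(** The [i]-th coefficient of the linear form [s |-> shifted_der s (x + ev s)]. The unit vector need
    not belong to [L], so the form is evaluated at [d] times it and divided by [d]. *)
Definition root_weight (x : 'rV[int]_n) i : C :=
  Dz (axis i d) (x + ev (axis i d)) / d%:R.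
Local Notation theta := root_weight.

Lemma shifted_der_linear s x : L (ev s) ->
  Dz s (x + ev s) = \sum_i (s i)%:R * theta x i.
Proof.
move=> Ls.
have d0 : d%:R != 0 :> C by rewrite pnatr_eq0 -lt0n (il_gt0 hL).
apply: (mulfI d0); rewrite -shifted_derMn // mulr_sumr.
have -> : mnm_muln s d =
    \big[@mnm_add n/@mnm0 n]_(i < n) mnm_muln (axis i d) (s i).
  apply/mnmP => j; rewrite mnm_sumE mulmnE (bigD1 j) //= big1 ?addn0.
    by rewrite mulmnE axisE eqxx mul1n mulnC.
  by move=> i /negPf ij; rewrite mulmnE axisE ij.
suff [] : L (ev (\big[@mnm_add n/@mnm0 n]_(i < n) mnm_muln (axis i d) (s i))) /\
  Dz (\big[@mnm_add n/@mnm0 n]_(i < n) mnm_muln (axis i d) (s i))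
     (x + ev (\big[@mnm_add n/@mnm0 n]_(i < n) mnm_muln (axis i d) (s i)))
  = \sum_(i < n) d%:R * ((s i)%:R * theta x i) by [].
apply: (big_rec2 (fun m c => L (ev m) /\ Dz m (x + ev m) = c)).
  rewrite ev0; split; first exact: (il0 hL).
  by have := @shifted_derMn _ x 0 Ls; rewrite mulm0n ev0 mul0r.
move=> i m c _ [Lm Em].
have La : L (ev (mnm_muln (axis i d) (s i))).
  by rewrite evMn; apply/(ilMn hL)/(il_axis hL).
split; first by rewrite evD; exact: (ilD hL).
rewrite shifted_derD // Em; congr (_ + _).
rewrite shifted_derMn; last exact: (il_axis hL).
by rewrite /theta; field.
Qed.

Lemma root_weight_off (x : 'rV[int]_n) k j : x 0 k < 0 -> j != k -> theta x j = 0.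
Proof.
move=> xk jk; rewrite /theta (@shifted_der_lt0 _ _ k) ?mul0r //.
by rewrite mxE [in X in _ + X]mxE axisE (negPf jk) addr0.
Qed.

(** Adding multiples of [axis j d] makes the other coordinates of a vector from [il_prim]
    nonnegative without touching the [k]-th. *)
Lemma exists_coord_one k : exists2 s, L (ev s) & s k = 1%N.
Proof.
have [x Lx xk] := il_prim hL k.
pose y := x + \sum_(j | j != k) ev (axis j d) *+ absz (x 0 j).
have Ly : L y.
  apply: (ilD hL) => //; elim/big_ind: _; first exact: (il0 hL).
    by move=> *; exact: (ilD hL).
  by move=> j _; apply/(ilMn hL)/(il_axis hL).
have yE i : y 0 i = x 0 i + \sum_(j | j != k) ((j == i) * d)%N%:Z *+ absz (x 0 j).
  rewrite mxE summxE; congr (_ + _); apply: eq_bigr => j _.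
  by rewrite mulmxnE mxE axisE.
have yk : y 0 k = 1.
  rewrite yE big1 ?addr0 // => j /negPf->.
  by rewrite mul0n mul0rn.
exists (mz y); last by rewrite mnmE yk.
rewrite ev_mz // => i; have [->|ik] := eqVneq i k; first by rewrite yk.
rewrite yE (bigD1 i) //= eqxx mul1n big1 => [|j /andP[_ /negPf->]]; last first.
  by rewrite mul0n mul0rn.
rewrite addr0 -mulr_natl natz -PoszM.
have d1 := il_gt0 hL.
apply: (@le_trans _ _ (x 0 i + (absz (x 0 i))%:Z)).
  lia.
by rewrite lerD2l lez_nat leq_pmulr.
Qed.

(** For [s] with [s k = 1] the vector [x + ev s] is still negative at [k], so the linear form
    vanishes at [s]; its coefficients other than the [k]-th vanish by [root_weight_off]. Here the
    primitivity of the coordinates enters. *)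
Lemma root_weight_lt (x : 'rV[int]_n) k : x 0 k < -1 -> theta x k = 0.
Proof.
move=> xk; have [s Ls sk] := exists_coord_one k.
have := shifted_der_linear x Ls.
rewrite (@shifted_der_lt0 _ _ k); last first.
  by rewrite mxE [in X in _ + X]mxE sk -ltrBrDr.
rewrite (bigD1 k) //= sk mul1r big1 ?addr0 // => j jk.
rewrite (@root_weight_off x k) ?mulr0 //.
exact: lt_trans xk _.
Qed.

Lemma der_linear s t : L (ev s) ->
  D s t = \sum_i (s i)%:R * theta (ev t - ev s) i.
Proof. by move=> Ls; rewrite -shifted_der_linear // subrK shifted_der_ev. Qed.

(* The degrees in which a derivation can be nonzero are the Demazure roots. *)
Lemma der_root s t k : L (ev s) -> D s t != 0 -> (ev t - ev s) 0 k < 0 ->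
  [/\ (ev t - ev s) 0 k = -1, forall i, i != k -> 0 <= (ev t - ev s) 0 i
    & D s t = (s k)%:R * theta (ev t - ev s) k].
Proof.
move=> Ls; set x := ev t - ev s => D0 xk.
have DE : D s t = (s k)%:R * theta x k.
  rewrite der_linear // (bigD1 k) //= big1 ?addr0 // => j jk.
  by rewrite (@root_weight_off _ k) ?mulr0.
have tk : theta x k != 0 by apply: contraNneq D0; rewrite DE => ->; rewrite mulr0.
split=> //.
  apply: le_anti; rewrite -ltzD1 addrC subrr xk leNgt.
  by apply: contra tk => /root_weight_lt ->.
move=> i ik; rewrite leNgt; apply: contra tk => xi.
by rewrite (@root_weight_off _ i) // eq_sym.
Qed.

Lemma ev_mnm1B (l k i : 'I_n) :
  (ev (mU l) - ev (mU k)) 0 i = (l == i)%:Z - (k == i)%:Z.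
Proof. by rewrite !mxE !mnm1E. Qed.

Lemma sum_ev_sub (s t : multinom n) : \sum_i (ev t - ev s) 0 i = (mdeg t)%:Z - (mdeg s)%:Z.
Proof.
under eq_bigr do rewrite !mxE.
by rewrite sumrB !mdegE -2!natz !natr_sum; congr (_ - _); apply: eq_bigr => i _; rewrite natz.
Qed.

(** A root of negative total degree has one entry -1 and zeros elsewhere, so it belongs to a field
    [d/dx_k] with [x_k] in the algebra. Then [D] would send [x_k] to a nonzero constant, against
    [Daug]. *)
Lemma der_lower s t : L (ev s) -> (mdeg t < mdeg s)%N -> D s t = 0.
Proof.
move=> Ls ts; apply/eqP/negP => /negP D0.
have := sum_ev_sub s t; set x := ev t - ev s => xE.
have [k xk] : exists k, x 0 k < 0.
  apply/not_existsP => h; have : 0 <= \sum_i x 0 i.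
    by apply: sumr_ge0 => i _; rewrite leNgt; apply/negP/h.
  by rewrite xE subr_ge0 lez_nat leqNgt ts.
have [x1 xpos DE] := der_root Ls D0 xk.
have x0 i : i != k -> x 0 i = 0.
  move=> ik; apply: le_anti; rewrite xpos // andbT.
  have : \sum_i x 0 i < 0 by rewrite xE subr_lt0 ltz_nat.
  have key (a b : int) : 0 <= b -> -1 + (a + b) < 0 -> a <= 0 by lia.
  rewrite (bigD1 k) //= (bigD1 i) //= -/x x1; apply: key.
  by apply: sumr_ge0 => j /andP[/xpos].
have xU : x = - ev (mU k).
  apply/rowP => i; rewrite [RHS]mxE [X in - X]mxE mnm1E.
  by have [<-|ki] := eqVneq k i; rewrite ?x1 // x0 // eq_sym.
have LU : L (ev (mU k)).
  rewrite -[ev _]opprK -xU /x opprB; apply: (ilB hL) => //.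
  exact: Dsupp Ls D0.
have : D (mU k) mnm0 = theta x k.
  rewrite der_linear // ev0 sub0r -xU (bigD1 k) //= mnm1E eqxx mul1r.
  by rewrite big1 ?addr0 // => j /negPf kj; rewrite mnm1E eq_sym kj mul0r.
rewrite Daug ?mnm1_eq0 // => t0; move: D0; rewrite DE -t0 mulr0.
by rewrite eqxx.
Qed.

(** Entry [(i, j)] is the coefficient of the vector field [x_j d/dx_i], whose degree is the root
    [e_j - e_i]. *)
Definition linear_part : 'M[C]_n :=
  \matrix_(i, j) theta (ev (mU j) - ev (mU i)) i.

Lemma linear_part_supp i j : linear_part i j != 0 -> L (ev (mU j) - ev (mU i)).
Proof.
rewrite mxE /theta => h; have La := il_axis hL i.
have : Dz (axis i d) (ev (mU j) - ev (mU i) + ev (axis i d)) != 0.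
  by apply: contraNneq h => ->; rewrite mul0r.
rewrite /Dz; case: forallP => [pos|]; last by rewrite eqxx.
move/(Dsupp La); rewrite ev_mz // => h'.
by rewrite -[X in L X](addrK (ev (axis i d))); exact: (ilB hL).
Qed.

(** A root of total degree 0 is either 0 or some [e_l - e_k], and only the fields [x_j d/dx_i] of
    that degree contribute. The double sum has the shape that [mcoeff_linear_field] gives to the
    coefficients of a linear field. *)
Lemma der_homogeneous s t : L (ev s) -> mdeg t = mdeg s ->
  D s t = \sum_i \sum_j linear_part i j *
    ((s i)%:R * (t :+ mU i == s :+ mU j)%:R).
Proof.
move=> Ls dts; set x := ev t - ev s.
have rootE i j : (t :+ mU i == s :+ mU j) = (x == ev (mU j) - ev (mU i)).
  apply/eqP/eqP => [/(congr1 (@ev n))|E].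
    by rewrite !evD /x => E; apply/eqP; 
    rewrite subr_eq -addrA [- _ + _]addrC addrA [_ + ev s]addrC -E addrK.
  by apply: ev_inj; rewrite !evD -[ev t](subrK (ev s)) -/x E addrAC subrK addrC.
have [x0|x0] := eqVneq x 0.
  rewrite der_linear // -/x; apply: eq_bigr => i _.
  rewrite (bigD1 i) //= big1 ?addr0 => [|j /negPf ji].
    by rewrite rootE subrr x0 eqxx mulr1 mxE subrr mulrC.
  rewrite rootE x0 eq_sym subr_eq0 (inj_eq (@ev_inj n)) eq_mnm1 ji.
  by rewrite !mulr0.
have sx : \sum_i x 0 i = 0 by rewrite sum_ev_sub dts subrr.
(* A nonzero degree [x] that is not a difference of two unit vectors is not a root, and then both
   sides vanish. *)
have [[[k l] /= /eqP klE]|nkl] := pselect (exists p : 'I_n * 'I_n,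
    t :+ mU p.1 == s :+ mU p.2); last first.
  rewrite [RHS]big1 => [|i _]; last first.
    rewrite big1 // => j _; case: eqP => [E|]; last by rewrite !mulr0.
    by case: nkl; exists (i, j); apply/eqP.
  apply/eqP/negP => /negP D0; apply: nkl.
  have [k xk] : exists k, x 0 k < 0.
    apply/not_existsP => h; move/eqP: x0; apply; apply/rowP => i; rewrite [RHS]mxE.
    have pos j : true -> 0 <= x 0 j by rewrite leNgt => _; apply/negP/h.
    by have := psumr_eq0P pos sx; apply.
  have [x1 xpos _] := der_root Ls D0 xk.
  (* The entries other than the [k]-th are nonnegative integers with sum 1, so exactly one of them
     is 1. *)
  have s1 : \sum_(i | i != k) x 0 i = 1.
    by move: sx; rewrite (bigD1 k) //= -/x x1 addrC => /eqP; rewrite subr_eq0 => /eqP.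
  have [l /andP[lk xl]] : exists l, (l != k) && (0 < x 0 l).
    apply/existsP; apply: contraPT s1; rewrite negb_exists => /forallP h.
    rewrite big1 // => i ik; apply: le_anti; rewrite xpos // andbT leNgt.
    by move: (h i); rewrite ik.
  have rest : \sum_(i | (i != k) && (i != l)) x 0 i >= 0.
    by apply: sumr_ge0 => j /andP[/xpos].
  have [xl1 rest0] : x 0 l = 1 /\ \sum_(i | (i != k) && (i != l)) x 0 i = 0.
    have key (a b : int) : 0 <= b -> 0 < a -> a + b = 1 -> a = 1 /\ b = 0 by lia.
    by move: s1; rewrite (bigD1 l) //=; exact: key.
  exists (k, l); rewrite rootE; apply/eqP/rowP => i.
  rewrite ev_mnm1B.
  have [<-|ki] := eqVneq k i; first by rewrite x1 (negPf lk).
  have [<-|li] := eqVneq l i; first by rewrite xl1.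
  have pos j : (j != k) && (j != l) -> 0 <= x 0 j by move=> /andP[/xpos].
  by apply: (psumr_eq0P pos rest0); rewrite eq_sym ki eq_sym li.
have xkl : x = ev (mU l) - ev (mU k) by apply/eqP; rewrite -rootE; apply/eqP.
have kl : k != l by apply: contraNneq x0; rewrite xkl => ->; rewrite subrr.
have xk : x 0 k < 0 by rewrite xkl ev_mnm1B eqxx eq_sym (negPf kl).
have DE : D s t = (s k)%:R * theta x k.
  rewrite der_linear // (bigD1 k) //= big1 ?addr0 // => j jk.
  by rewrite (@root_weight_off _ k) ?mulr0.
rewrite DE (bigD1 k) //= (bigD1 l) //= klE eqxx mulr1 mxE -xkl mulrC.
rewrite big1 ?addr0 => [|j jl]; last first.
  case: eqP; last by rewrite !mulr0.
  by move=> /addmI /eqP; rewrite eq_mnm1 eq_sym (negPf jl).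
rewrite big1 ?addr0 // => i ik; rewrite big1 // => j _.
case: eqP; last by rewrite !mulr0.
move/eqP; rewrite rootE => /eqP xij; have [ij|ij] := eqVneq i j.
  by move/eqP: x0; rewrite xij ij subrr.
have := root_weight_off xk ik; rewrite mxE -xij => ->.
by rewrite mul0r.
Qed.

End HomogeneousParts.

(** * Linear vector fields and lowest forms *)

Section LinearChange.
Variables (C : numClosedFieldType) (n : nat).
Implicit Types (A B : 'M[C]_n) (p q : mpoly n C).

Definition linear_change B : mpoly n C -> mpoly n C :=
  comp_mpoly [tuple \sum_j B i j *: X_ (mU j) | i < n].

Lemma linear_changeM B p q :
  linear_change B (p * q) = linear_change B p * linear_change B q.
Proof. exact: rmorphM. Qed.

Lemma linear_changeZ B c p : linear_change B (c *: p) = c *: linear_change B p.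
Proof. exact: comp_mpolyZ. Qed.

Lemma linear_changeU B i :
  linear_change B (X_ (mU i)) = \sum_j B i j *: X_ (mU j).
Proof. by rewrite /linear_change comp_mpolyXU -tnth_nth tnth_mktuple. Qed.

Lemma linear_changeK B Bi : B *m Bi = 1%:M ->
  cancel (linear_change B) (linear_change Bi).
Proof.
move=> BBi p; elim/mpoly_ring_ind: p => [c|i|p q Ep Eq|p q Ep Eq].
- by rewrite /linear_change !comp_mpolyC.
- rewrite linear_changeU /linear_change raddf_sum /=.
  under eq_bigr do rewrite comp_mpolyZ -/(linear_change Bi _) linear_changeU scaler_sumr.
  rewrite exchange_big /= (bigD1 i) //= [X in _ + X]big1 ?addr0.
    under eq_bigr do rewrite scalerA.
    rewrite -scaler_suml; have /matrixP/(_ i i) := BBi.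
    by rewrite !mxE eqxx => ->; rewrite scale1r.
  move=> k ki; under eq_bigr do rewrite scalerA.
  rewrite -scaler_suml; have /matrixP/(_ i k) := BBi.
  by rewrite !mxE eq_sym (negPf ki) => ->; rewrite scale0r.
- by rewrite /linear_change !raddfD /= -/(linear_change _) Ep Eq.
- by rewrite /linear_change !rmorphM /= -/(linear_change _) Ep Eq.
Qed.

Definition linear_field A p : mpoly n C :=
  \sum_i \sum_j A i j *: (X_ (mU j) * mderiv i p).

Lemma linear_fieldD A p q :
  linear_field A (p + q) = linear_field A p + linear_field A q.
Proof.
rewrite /linear_field -big_split; apply: eq_bigr => i _.
rewrite -big_split; apply: eq_bigr => j _ /=.
by rewrite mderivD mulrDr scalerDr.
Qed.

Lemma linear_fieldC A c : linear_field A (mpolyC n c) = 0.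
Proof.
by apply: big1 => i _; apply: big1 => j _; rewrite mderivC mulr0 scaler0.
Qed.

Lemma linear_fieldM A p q :
  linear_field A (p * q) = linear_field A p * q + p * linear_field A q.
Proof.
rewrite /linear_field mulr_suml mulr_sumr -big_split; apply: eq_bigr => i _.
rewrite mulr_suml mulr_sumr -big_split; apply: eq_bigr => j _ /=.
rewrite mderivM -scalerAl -scalerAr -scalerDr; congr (_ *: _).
ring.
Qed.

Lemma linear_fieldZ A c p : linear_field A (c *: p) = c *: linear_field A p.
Proof.
by rewrite -!mul_mpolyC linear_fieldM linear_fieldC mul0r add0r.
Qed.

Lemma linear_field_sum A (I : Type) (r : seq I) (p : I -> mpoly n C) :
  linear_field A (\sum_(i <- r) p i) = \sum_(i <- r) linear_field A (p i).
Proof.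
elim/big_rec2: _ => [|i p1 p2 _ <-]; last by rewrite linear_fieldD.
by rewrite -mpolyC0 linear_fieldC.
Qed.

Lemma linear_fieldU A k : linear_field A (X_ (mU k)) = \sum_j A k j *: X_ (mU j).
Proof.
rewrite /linear_field (bigD1 k) //= [X in _ + X]big1 ?addr0 => [|i ik].
  apply: eq_bigr => j _; rewrite mderivX mnm1E eqxx scale1r.
  have -> : mnm_sub (mU k) (mU k) = mnm0.
    by apply/mnmP => i; rewrite mnmBE subnn mnm0E.
  by rewrite mpolyX0 mulr1.
by apply: big1 => j _; rewrite mderivX mnm1E eq_sym (negPf ik) scale0r mulr0 scaler0.
Qed.

(** Both sides obey the same Leibniz rule along [linear_change B], so only the variables matter, and
    there the identity is [A *m B = B *m A']. *)
Lemma linear_change_field A A' B p : A *m B = B *m A' ->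
  linear_change B (linear_field A p) = linear_field A' (linear_change B p).
Proof.
move=> AB; elim/mpoly_ring_ind: p => [c|i|p q Ep Eq|p q Ep Eq].
- by rewrite linear_fieldC /linear_change raddf0 comp_mpolyC linear_fieldC.
- rewrite linear_fieldU linear_changeU linear_field_sum /linear_change raddf_sum /=.
  under eq_bigr do rewrite /= comp_mpolyZ -/(linear_change B _) linear_changeU scaler_sumr.
  under [RHS]eq_bigr do rewrite linear_fieldZ linear_fieldU scaler_sumr.
  rewrite exchange_big [RHS]exchange_big; apply: eq_bigr => k _ /=.
  under eq_bigr do rewrite scalerA; rewrite -scaler_suml.
  under [RHS]eq_bigr do rewrite scalerA; rewrite -scaler_suml.
  by have /matrixP/(_ i k) := AB; rewrite !mxE => ->.
- by rewrite linear_fieldD /linear_change !raddfD /= -/(linear_change _)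
    Ep Eq linear_fieldD.
- by rewrite linear_fieldM /linear_change raddfD /= !rmorphM /=
    -/(linear_change _) Ep Eq linear_fieldM.
Qed.

Lemma mcoeff_linear_field A s t : mcoeff t (linear_field A (X_ s)) =
  \sum_i \sum_j A i j * ((s i)%:R * (t :+ mU i == s :+ mU j)%:R).
Proof.
rewrite /linear_field raddf_sum; apply: eq_bigr => i _ /=.
rewrite raddf_sum; apply: eq_bigr => j _ /=.
rewrite mcoeffZ mderivX -scalerAr -mpolyXD mcoeffZ mcoeffX.
(* If [s i = 0] the factor kills the term, so the truncated subtraction of exponents does no
   harm. *)
congr (_ * _); have [->|si] := eqVneq (s i) 0%N; first by rewrite !mul0r.
congr (_ * (nat_of_bool _)%:R).
have sE : s = mnm_sub s (mU i) :+ mU i by rewrite submK // lep1mP.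
rewrite [in RHS]sE -[in RHS]addmA [X in _ == _ :+ X]addmC addmA eqm_add2r.
by rewrite [in RHS]addmC eq_sym.
Qed.

(** The field only replaces a factor [x_i] by [x_j] with [i <= j], which never raises a monomial in
    the order. Hence the coefficient of the leading monomial in the image comes from that monomial
    alone, through the diagonal of [A]. *)
Lemma triangular_field_eigen A p c : (forall i j : 'I_n, (j < i)%N -> A i j = 0) ->
  linear_field A p = c *: p -> p != 0 ->
  c = \sum_i A i i * (mlead p i)%:R.
Proof.
move=> tA Ep p0; set a := mlead p.
have pa : mcoeff a p != 0 by rewrite mleadc_eq0.
apply: (mulIf pa).
have /(congr1 (mcoeff a)) := Ep; rewrite mcoeffZ => <-.
rewrite {1}[p]mpolyE linear_field_sum raddf_sum /=.
rewrite (bigD1_seq a) ?mlead_supp ?msupp_uniq //= big1_seq ?addr0; last first.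
  move=> s /andP[sa sp]; rewrite linear_fieldZ mcoeffZ mcoeff_linear_field.
  rewrite big1 ?mulr0 // => i _; rewrite big1 // => j _.
  have sl : (s < a)%O by rewrite lt_neqAle sa /a msupp_le_mlead.
  have [ji|ij] := ltnP j i; first by rewrite tA ?mul0r.
  case: eqP => [E|]; last by rewrite !mulr0.
  have : (s :+ mU j < a :+ mU i)%O.
    apply: ltmc_le_add => //; rewrite le_eqVlt.
    have [->|nij] := eqVneq i j; first by rewrite eqxx.
    apply/orP; right; apply/ltmcP; rewrite ?mdeg1 //; exists i.
      move=> k ki; rewrite !mnm1E -!val_eqE /= !gtn_eqF //.
      exact: leq_trans ki ij.
    by rewrite !mnm1E eqxx eq_sym (negPf nij).
  by rewrite E ltxx.
rewrite linear_fieldZ mcoeffZ mcoeff_linear_field mulrC; congr (_ * _).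
apply: eq_bigr => i _; rewrite (bigD1 i) //= eqxx mulr1 big1 ?addr0 //.
move=> j /negPf ji; case: eqP => [/addmI/eqP|]; last by rewrite !mulr0.
by rewrite eq_mnm1 eq_sym ji.
Qed.

End LinearChange.

(** * From a formal isomorphism to an isomorphism of monoids *)

Section MonoidIso.
Variables (C : numClosedFieldType) (n n' : nat).
Variables (L : set 'rV[int]_n) (L' : set 'rV[int]_n') (d d' : nat).
Hypotheses (hL : index_lattice L d) (hL' : index_lattice L' d').
Variables (Phi : multinom n' -> multinom n -> C)
          (Psi : multinom n -> multinom n' -> C).
Hypotheses (hPhi : formal_hom L' L Phi) (hPsi : formal_hom L L' Psi).
Hypotheses (PhiPsi : formal_inverse L' Phi Psi)
           (PsiPhi : formal_inverse L Psi Phi).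
Variable lam : multinom n' -> C.
Hypothesis lamD : forall u v, lam (u :+ v) = lam u + lam v.
Hypothesis lam_inj : injective lam.

Local Notation D := (transported_der d' Phi Psi lam).
Local Notation A := (linear_part d D).
Local Notation bound' k := (n' * d' * k).+1.

Let Dlower s t : L (ev s) -> (mdeg t < mdeg s)%N -> D s t = 0.
Proof.
apply: (der_lower hL).
- by move=> ? ?; exact: (transported_der_supp hPhi hPsi).
- by move=> ?; exact: (transported_der_aug _ hPhi hPsi).
- by move=> ? ? ? ?; exact: (transported_der_leibniz hL hL' hPhi hPsi PsiPhi lamD).
Qed.

Let Dhomog s t : L (ev s) -> mdeg t = mdeg s ->
  D s t = \sum_i \sum_j A i j * ((s i)%:R * (t :+ mU i == s :+ mU j)%:R).
Proof.
apply: (der_homogeneous hL).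
by move=> ? ? ? ?; exact: (transported_der_leibniz hL hL' hPhi hPsi PsiPhi lamD).
Qed.

Let A_supp i j : A i j != 0 -> L (ev (mU j) - ev (mU i)).
Proof.
apply: (linear_part_supp hL).
by move=> ? ?; exact: (transported_der_supp hPhi hPsi).
Qed.

(** A monomial is an eigenvector of the diagonal derivation, so its image is one of the transported
    derivation. Exponents [s] of degree above [mdeg t] are left out because [D] does not lower the
    degree. *)
Lemma transported_der_eigen u t : L' (ev u) ->
  \sum_(s : bmultinom n (mdeg t).+1) Phi u s * D s t = lam u * Phi u t.
Proof.
move=> Lu; pose N' := bound' (mdeg t).+1.
(* Large enough both for the sum over [s] to be complete and for [inverse_sum] to apply to every [v]
   below [N']. *)
pose N := maxn (mdeg t).+1 (n * d * N').+1.
rewrite -(big_bmultinom_widen (F := fun s => Phi u s * D s t) (leq_maxl _ (n * d * N').+1)); last first.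
  move=> s ts; have [->|/(fh_supp hPhi Lu) Ls] := eqVneq (Phi u s) 0.
    by rewrite mul0r.
  by rewrite Dlower ?mulr0.
rewrite -/N /D; under eq_bigr do rewrite mulr_sumr.
rewrite exchange_big /=.
have E (v : bmultinom n' N') :
    \sum_(s : bmultinom n N) Phi u s * (Psi s v * lam v * Phi v t)
    = (u == v)%:R * (lam v * Phi v t).
  rewrite -(inverse_sum hL hPhi hPsi PhiPsi Lu (N := N)); last first.
    rewrite leq_max; apply/orP; right.
    by rewrite ltnS leq_mul2l orbC bmdeg.
  by rewrite mulr_suml; apply: eq_bigr => s _; ring.
under eq_bigr do rewrite E.
have [uN|uN] := ltnP (mdeg u) N'.
  rewrite (bigD1 (BMultinom uN)) //= eqxx mul1r big1 ?addr0 // => v.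
  by rewrite -val_eqE /= eq_sym => /negPf ->; rewrite mul0r.
rewrite big1 ?(fh_order hL' hPhi Lu uN) ?mulr0 // => v _.
by case: eqP => [uv|]; [move: (bmdeg v); rewrite -uv ltnNge uN|rewrite mul0r].
Qed.

Definition has_order u k :=
  (forall a, (mdeg a < k)%N -> Phi u a = 0) /\
  exists2 a, mdeg a = k & Phi u a != 0.

Definition order u := xget 0%N [set k | has_order u k].

(** A vanishing series [Phi u] would contradict the inverse relation at [(u, u)]; so on [L'] the
    default value of [xget] never occurs. *)
Lemma orderP u : L' (ev u) -> has_order u (order u).
Proof.
move=> Lu; have [a Pa] : exists a, Phi u a != 0.
  apply/not_existsP => h.
  have := inverse_sum hL hPhi hPsi PhiPsi (v := u) Lu (ltnSn _).
  rewrite eqxx big1 => [/esym/eqP|s _]; first by rewrite oner_eq0.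
  by have /negP/negPn/eqP-> := h s; rewrite mul0r.
pose P k := `[< exists2 a, mdeg a = k & Phi u a != 0 >].
have exP : exists k, P k by exists (mdeg a); apply/asboolP; exists a.
have [k /asboolP Pk kmin] := ex_minnP exP.
have ok : has_order u k.
  split=> // b bk; apply/eqP/negPn/negP => Pb.
  have : P (mdeg b) by apply/asboolP; exists b.
  by move/kmin; rewrite leqNgt bk.
exact: (@xgetPex _ 0%N [set k | has_order u k] (ex_intro _ k ok)).
Qed.

Lemma order_unique u k l : has_order u k -> has_order u l -> k = l.
Proof.
move=> [k0 [a ak Pa]] [l0 [b bl Pb]]; apply/eqP; rewrite eqn_leq.
apply/andP; split; rewrite leqNgt; apply/negP => h.
  by move: Pb; rewrite k0 ?bl ?eqxx.
by move: Pa; rewrite l0 ?ak ?eqxx.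
Qed.

Definition lead_form u : mpoly n C := truncation (order u).+1 (Phi u).
Local Notation F := lead_form.

Lemma mcoeff_lead_form u a : L' (ev u) ->
  mcoeff a (F u) = if mdeg a == order u then Phi u a else 0.
Proof.
move=> Lu; rewrite mcoeff_truncation ltnS leq_eqVlt.
by case: eqVneq => //= _; case: ifP => // /(proj1 (orderP Lu)).
Qed.

Lemma lead_form_neq0 u : L' (ev u) -> F u != 0.
Proof.
move=> Lu; have [_ [a ak Pa]] := orderP Lu.
apply: contraNneq Pa => F0; have := mcoeff_lead_form a Lu.
by rewrite F0 mcoeff0 ak eqxx => E; apply/eqP/esym.
Qed.

Lemma lead_form_supp u a : L' (ev u) -> a \in msupp (F u) ->
  mdeg a = order u /\ L (ev a).
Proof.
move=> Lu; rewrite mcoeff_msupp mcoeff_lead_form //.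
have [E /(fh_supp hPhi Lu)//|_] := eqVneq (mdeg a) (order u).
by rewrite eqxx.
Qed.

(** Polynomials form a domain, so the product of the lowest forms is nonzero and is the lowest form
    of the product. *)
Lemma lead_formM u v : L' (ev u) -> L' (ev v) ->
  order (u :+ v) = (order u + order v)%N /\ F (u :+ v) = F u * F v.
Proof.
move=> Lu Lv; have Luv : L' (ev (u :+ v)) by rewrite evD; exact: (ilD hL').
have E a : (mdeg a <= order u + order v)%N ->
    Phi (u :+ v) a = mcoeff a (F u * F v).
  move=> ale; rewrite (fh_mul hPhi) // mcoeffM; apply: eq_bigr => -[[b ?] [c ?]] /= /eqP abc.
  have dE : mdeg a = (mdeg b + mdeg c)%N by rewrite -mdegD -abc.
  rewrite !mcoeff_lead_form //.
  case: (ltngtP (mdeg b) (order u)) => [/(proj1 (orderP Lu))->|bu|bu].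
  - by rewrite !mul0r.
  - rewrite mul0r [Phi v c](proj1 (orderP Lv)) ?mulr0 //.
    by move: ale; rewrite dE; lia.
  - case: (ltngtP (mdeg c) (order v)) => // [/(proj1 (orderP Lv))->//|cv].
    by move: ale; rewrite dE; lia.
have F0 : F u * F v != 0 by rewrite mulf_neq0 ?lead_form_neq0.
have deg a : a \in msupp (F u * F v) -> mdeg a = (order u + order v)%N.
  move=> /msuppM_le/allpairsP[[b c] /= [/(lead_form_supp Lu)[bu _]]].
  by move=> /(lead_form_supp Lv)[cv _] ->; rewrite mdegD bu cv.
have ouv : order (u :+ v) = (order u + order v)%N.
  apply: (order_unique (orderP Luv)); split.
    move=> a ha; rewrite E ?(ltnW ha) //; apply/eqP; rewrite mcoeff_eq0.
    by apply: contraTN ha => /deg->; rewrite ltnn.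
  exists (mlead (F u * F v)); first exact/deg/mlead_supp.
  by rewrite E ?mleadc_eq0 // deg ?mlead_supp.
split=> //; apply/mpolyP => a; rewrite mcoeff_lead_form // ouv.
have [aE|na] := eqVneq (mdeg a) (order u + order v)%N; first by rewrite E // aE.
by apply/esym/eqP; rewrite mcoeff_eq0; apply: contra na => /deg->.
Qed.

(** Since [D] does not lower degrees, the eigenvector equation in degree [order u] involves only the
    lowest form, and there [D] acts as the linear field of [A]. *)
Lemma lead_form_eigen u : L' (ev u) -> linear_field A (F u) = lam u *: F u.
Proof.
move=> Lu; apply/mpolyP => t.
rewrite mcoeffZ mcoeff_lead_form // {1}/F /truncation linear_field_sum raddf_sum /=.
have E (s : bmultinom n (order u).+1) :
    mcoeff t (linear_field A (Phi u s *: X_ s)) =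
    if mdeg t == order u then Phi u s * D s t else 0.
  rewrite linear_fieldZ mcoeffZ mcoeff_linear_field.
  have [->|Ps] := eqVneq (Phi u s) 0; first by rewrite !mul0r if_same.
  have Ls := fh_supp hPhi Lu Ps.
  have su : mdeg s = order u.
    apply/eqP; rewrite eqn_leq -ltnS bmdeg /= leqNgt.
    by apply: contra Ps => /(proj1 (orderP Lu))->.
  have [tu|tu] := eqVneq (mdeg t) (order u); first by rewrite Dhomog // su.
  rewrite big1 ?mulr0 // => i _; rewrite big1 // => j _.
  case: eqP => [/(congr1 (@mdeg n))|]; last by rewrite !mulr0.
  by rewrite !mdegD !mdeg1 !addn1 su => -[] /eqP; rewrite (negPf tu).
rewrite (eq_bigr _ (fun s _ => E s)).
have [tu|_] := eqVneq (mdeg t) (order u); last first.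
  by rewrite big1 ?mulr0.
by rewrite -transported_der_eigen // tu.
Qed.

Theorem formal_iso_monoid_iso : exists nu : multinom n' -> multinom n,
  [/\ forall u, L' (ev u) -> L (ev (nu u)),
      forall u v, L' (ev u) -> L' (ev v) -> nu (u :+ v) = nu u :+ nu v,
      forall u v, L' (ev u) -> L' (ev v) -> nu u = nu v -> u = v
    & forall s, L (ev s) -> exists2 u, L' (ev u) & nu u = s].
Proof.
(* Coordinates [i] and [j] are equivalent when [e_j - e_i] lies in [L]; the matrix [A] mixes only
   equivalent ones. *)
pose r i := [pred j | `[< L (ev (mU j) - ev (mU i)) >]].
have rE i j : L (ev (mU j) - ev (mU i)) -> r i =1 r j.
  move=> h k; apply/asbool_equiv_eq; split=> h'.
    have -> : ev (mU k) - ev (mU j) =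
        (ev (mU k) - ev (mU i)) - (ev (mU j) - ev (mU i)).
      by rewrite opprB addrA subrK.
    exact: (ilB hL).
  have -> : ev (mU k) - ev (mU i) =
      (ev (mU k) - ev (mU j)) + (ev (mU j) - ev (mU i)).
    by rewrite addrA subrK.
  exact: (ilD hL).
(* The position of the first equivalent index labels the class by a natural number, as
   [block_triangularization] requires. *)
pose f i := find (r i) (enum 'I_n).
have fE i j : f i = f j -> L (ev (mU j) - ev (mU i)).
  have hasr k : has (r k) (enum 'I_n).
    apply/hasP; exists k; rewrite ?mem_enum //=; apply/asboolP.
    by rewrite subrr; exact: (il0 hL).
  have := nth_find i (hasr i); have := nth_find i (hasr j).
  rewrite -/(f i) -/(f j) => /asboolP h1 /asboolP h2 fij; rewrite -fij in h1.
  by have := ilB hL h2 h1; rewrite opprB addrC addrA subrK.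
have [B [Bi [A' [s [[BBi BiB AB] [sinj tA Bs Bis]]]]]] :=
  @block_triangularization C n A f (fun i j h => eq_find (rE _ _ (A_supp h)) _).
have sbij : bijective s by exact: injF_bij.
have [s' ss' s's] := sbij.
(* [sigma] renames the new coordinates so that their classes modulo [L] are
   those of the old ones. *)
pose sigma (b : multinom n) := Multinom [tuple b (s' i) | i < n].
pose sigma' (b : multinom n) := Multinom [tuple b (s i) | i < n].
have sigmaK : cancel sigma sigma'.
  by move=> b; apply/mnmP => i; rewrite !mnmE ss'.
have sigmaK' : cancel sigma' sigma.
  by move=> b; apply/mnmP => i; rewrite !mnmE s's.
have sigmaD b c : sigma (b :+ c) = sigma b :+ sigma c.
  by apply/mnmP => i; rewrite mnmE !mnmDE !mnmE.
have sigmaU i : sigma (mU i) = mU (s i).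
  apply/mnmP => j; rewrite mnmE !mnm1E; congr nat_of_bool.
  by apply/eqP/eqP => [->|<-].
have sigma0 : sigma mnm0 = mnm0 by apply/mnmP => i; rewrite mnmE !mnm0E.
(* Relates an old exponent [a] to a new exponent [b] that may occur in its transform: same degree
   and, after renaming, same class modulo [L]. *)
pose Rel a b := mdeg a = mdeg b /\ L (ev (sigma b) - ev a).
have Rel0 : Rel mnm0 mnm0.
  by split=> //; rewrite sigma0 subrr; exact: (il0 hL).
have RelD a b a' b' : Rel a b -> Rel a' b' -> Rel (a :+ a') (b :+ b').
  move=> [e h] [e' h']; split; first by rewrite !mdegD e e'.
  by rewrite sigmaD !evD opprD addrACA; exact: (ilD hL).
have suppU (M : 'M[C]_n) i b :
    b \in msupp (tnth [tuple \sum_j M i j *: X_ (mU j) | i < n] i) ->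
    exists2 j, M i j != 0 & b = mU j.
  rewrite tnth_mktuple => /msupp_sum_le/flattenP[S /mapP[j _ ->]] h.
  have /msuppZ_le := h; rewrite msuppX inE => /eqP E; exists j => //.
  by apply: contraTneq h => ->; rewrite scale0r msupp0.
have relB p b : b \in msupp (linear_change B p) ->
    exists2 a, a \in msupp p & Rel a b.
  apply: comp_mpoly_supp => // i c /suppU[j Bij ->].
  by split; rewrite ?mdeg1 // sigmaU; exact/fE/Bs.
have relBi p b : b \in msupp (linear_change Bi p) ->
    exists2 a, a \in msupp p & Rel b a.
  apply: (comp_mpoly_supp (Rel := fun a b => Rel b a) Rel0) => [? ? ? ?|i c].
    exact: RelD.
  move=> /suppU[j Bij ->].
  by split; rewrite ?mdeg1 // sigmaU; exact/fE/esym/Bis.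
pose H u := linear_change B (F u).
have H0 u : L' (ev u) -> H u != 0.
  move=> Lu; apply: contra (lead_form_neq0 Lu) => /eqP E.
  by rewrite -[F u](linear_changeK BBi) -/(H u) E /linear_change raddf0.
pose nu0 u := mlead (H u).
have lamE u : L' (ev u) -> lam u = \sum_i A' i i * (nu0 u i)%:R.
  move=> Lu; apply: (triangular_field_eigen tA _ (H0 _ Lu)).
  rewrite -(linear_change_field _ AB) lead_form_eigen //.
  by rewrite linear_changeZ.
have nu0_inj u v : L' (ev u) -> L' (ev v) -> nu0 u = nu0 v -> u = v.
  by move=> Lu Lv E; apply: lam_inj; rewrite !lamE // E.
exists (fun u => sigma (nu0 u)); split.
- move=> u Lu; have [a aF [_ h]] := relB _ _ (mlead_supp (H0 _ Lu)).
  have [_ La] := lead_form_supp Lu aF.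
  by rewrite -[X in L X](subrK (ev a)); exact: (ilD hL).
- move=> u v Lu Lv; rewrite -sigmaD /nu0 /H (lead_formM Lu Lv).2.
  by rewrite linear_changeM mleadM //; exact: H0.
- by move=> u v Lu Lv /(can_inj sigmaK); exact: nu0_inj.
(* Surjectivity: the monomial to be reached is pulled back to the old coordinates, as a form [p]
   with exponents in [L]. *)
move=> t Lt; pose b := sigma' t; pose p := linear_change Bi (X_ b).
have pb : linear_change B p = X_ b by exact: linear_changeK.
have p0 : p != 0.
  apply: contra_eq_neq pb => ->; rewrite /linear_change raddf0 eq_sym.
  by rewrite -msupp_eq0 msuppX.
have psupp a : a \in msupp p -> mdeg a = mdeg b /\ L (ev a).
  move=> /relBi[c]; rewrite msuppX inE => /eqP-> [e h]; split=> //.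
  rewrite -[ev a](subKr (ev (sigma b))); apply: (ilB hL) => //.
  by rewrite sigmaK'.
pose k := mdeg b; pose N := bound' k.+1.
(* Coefficients of the preimage of [p] under [Phi]; only [v] below [N] can affect the degrees up to
   [k]. *)
pose g v := \sum_(a <- msupp p) mcoeff a p * Psi a v.
have gL v : g v != 0 -> L' (ev v).
  move=> g0; suff [a ap Pa] : exists2 a, a \in msupp p & Psi a v != 0.
    by apply: (fh_supp hPsi _ Pa); have [] := psupp _ ap.
  apply/not_exists2P => h; move/eqP: g0; apply; apply: big1_seq => a /= ap.
  by have [//|/negP/negPn/eqP->] := h a; rewrite mulr0.
have gE c : (mdeg c <= k)%N -> mcoeff c p = \sum_(v : bmultinom n' N) g v * Phi v c.
  move=> ck; under eq_bigr do rewrite /g mulr_suml.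
  rewrite exchange_big /= {1}[p]mpolyE raddf_sum /= !big_seq; apply: eq_bigr => a ap.
  have [_ La] := psupp _ ap.
  rewrite mcoeffZ mcoeffX -(inverse_sum hL' hPsi hPhi PsiPhi La (N := N)); last first.
    by rewrite ltnS leq_mul2l ltnS ck orbT.
  by rewrite mulr_sumr; apply: eq_bigr => v _; rewrite mulrA.
pose P (v : bmultinom n' N) j := (g v != 0) && (order v == j).
have [v0 gv0 ov0] : exists2 v : bmultinom n' N, g v != 0 & (order v <= k)%N.
  have := mlead_supp p0; set a := mlead p => ap; have [ak _] := psupp _ ap.
  have : mcoeff a p != 0 by rewrite -mcoeff_msupp.
  rewrite gE ?ak // => S0; apply/not_exists2P => h; move/eqP: S0; apply.
  apply: big1 => v _; have [->|gv] := eqVneq (g v) 0; first by rewrite mul0r.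
  have [//|/negP] := h v; rewrite -ltnNge => kv.
  by rewrite [Phi v a](proj1 (orderP (gL _ gv))) ?mulr0 // ak.
have exQ : exists j, [exists v, P v j].
  by exists (order v0); apply/existsP; exists v0; rewrite /P gv0 eqxx.
(* The least order [j] among the images that enter [p] might a priori be smaller than [k], the
   lowest forms cancelling. *)
have [j /existsP Pj jmin] := ex_minnP exQ.
have jk : (j <= k)%N.
  by apply: leq_trans ov0; apply: jmin; apply/existsP; exists v0; rewrite /P gv0 eqxx.
pose Q := \sum_(v | P v j) g v *: F v.
have QE c : mdeg c = j -> mcoeff c Q = mcoeff c p.
  move=> cj; rewrite gE ?cj // /Q raddf_sum /= [RHS](bigID (P^~ j)) /=.
  rewrite [X in _ = _ + X]big1 ?addr0.
    apply: eq_bigr => v /andP[gv /eqP vj].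
    rewrite mcoeffZ mcoeff_lead_form; last exact: gL.
    by rewrite vj cj eqxx.
  move=> v; rewrite /P negb_and negbK => /orP[/eqP->|vj]; first by rewrite mul0r.
  have [->|gv] := eqVneq (g v) 0; first by rewrite mul0r.
  rewrite [Phi v c](proj1 (orderP (gL _ gv))) ?mulr0 //.
  rewrite cj ltn_neqAle eq_sym vj /=; apply: jmin; apply/existsP; exists v.
  by rewrite /P gv eqxx.
(* They do not cancel: after the change of coordinates their leading exponents are distinct by
   [nu0_inj]. *)
have [v Pv Hv] : exists2 v, P v j & mcoeff (nu0 v) (linear_change B Q) != 0.
  have -> : linear_change B Q = \sum_(v | P v j) g v *: H v.
    by rewrite /linear_change raddf_sum; apply: eq_bigr => v _; exact: linear_changeZ.
  apply: sum_distinct_mlead => //.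
    by move=> v /andP[gv _]; split=> //; apply/H0/gL.
  move=> v w /andP[gv _] /andP[gw _] E; apply/val_inj.
  by apply: nu0_inj E; exact: gL.
have Q0 : Q != 0.
  by apply: contraNneq Hv => ->; rewrite /linear_change raddf0 mcoeff0.
have Qdeg c : c \in msupp Q -> mdeg c = j.
  move=> /msupp_sum_le/flattenP[S /mapP[w]].
  rewrite mem_filter => /andP[/andP[gw /eqP wj] _] -> /msuppZ_le.
  by move=> /(lead_form_supp (gL _ gw))[]; rewrite wj.
(* [Q] is nonzero and agrees with [p] in degree [j], while [p] is homogeneous of degree [k]. *)
have jE : j = k.
  have QL := mlead_supp Q0; have cj := Qdeg _ QL.
  move: QL; rewrite mcoeff_msupp QE // -mcoeff_msupp => /psupp[].
  by rewrite cj.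
have QP : Q = p.
  apply/mpolyP => c; have [cj|cj] := eqVneq (mdeg c) j; first exact: QE.
  apply/eqP; rewrite [X in X == _](_ : _ = 0).
    rewrite eq_sym mcoeff_eq0; apply: contra cj => /psupp[-> _].
    by rewrite jE.
  by apply/eqP; rewrite mcoeff_eq0; apply: contra cj => /Qdeg->.
case/andP: Pv => gv _; exists v; first exact: gL.
(* In the new coordinates [Q] is the single monomial [b], so the surviving leading exponent is
   [b]. *)
move: Hv; rewrite QP pb mcoeffX.
have [<- _|_] := eqVneq b (nu0 v); last by rewrite eqxx.
exact: sigmaK'.
Qed.

End MonoidIso.

(** * Order of vanishing and power series expansions *)

(** The algebraic numbers are a countable union of finite sets, hence a null set, while the line has
    infinite measure. *)
Lemma exists_transcendental (R : realType) : exists x : R,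
  forall p : {poly int}, root (map_poly intr p : {poly R}) x -> p = 0.
Proof.
apply/not_existsP => h.
pose S (p : {poly int}) : set R :=
  [set x | p <> 0 /\ root (map_poly intr p : {poly R}) x].
have cS p : countable (S p).
  have [p0|p0] := eqVneq p 0.
    by rewrite (_ : S p = set0) // -subset0 => x [].
  (* The polynomial splits over [R[i]], and a real root is the real part of one of its finitely many
     roots there. *)
  have [s sE] := closed_field_poly_normal
    (map_poly (real_complex R) (map_poly intr p : {poly R})).
  apply/finite_set_countable/(@sub_finite_set _ _ [set` map (@complex.Re R) s]).
    move=> x [_ rx] /=; apply/mapP; exists (x%:C)%C => //.
    rewrite -root_prod_XsubC; move: rx; rewrite -(fmorph_root (real_complex R)).
    rewrite sE rootZ // lead_coef_eq0 map_poly_eq0.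
    by rewrite -size_poly_eq0 size_map_inj_poly ?size_poly_eq0 //; exact: intr_inj.
  exact: finite_seq.
have ST : \bigcup_p S p = setT.
  apply/seteqP; split=> // x _; have /existsNP[p /not_implyP[rp p0]] := h x.
  by exists p.
have : lebesgue_measure (setT : set R) = 0%E.
  rewrite -ST; apply/countable_lebesgue_measure0/bigcup_countable => [|p _].
    exact: countableP.
  exact: cS.
rewrite (_ : setT = `]-oo, +oo[%classic); last first.
  by apply/seteqP; split=> // x _; rewrite /= in_itv.
by rewrite lebesgue_measure_itv.
Qed.

(** [lam u] is the value at a transcendental number of the polynomial with coefficients [u], so it
    determines [u]. *)
Lemma exists_injective_weight (R : realType) n : exists lam : multinom n -> R[i],
  (forall u v, lam (u :+ v) = lam u + lam v) /\ injective lam.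
Proof.
have [x hx] := exists_transcendental R.
exists (fun u => (\sum_(i < n) (u i)%:R * x ^+ i)%:C%C); split.
  move=> u v; rewrite -rmorphD /= -big_split; congr (_%:C)%C.
  by apply: eq_bigr => i _; rewrite mnmDE natrD mulrDl.
move=> u v [E].
pose p : {poly int} := \sum_(i < n) ((u i)%:Z - (v i)%:Z)%:P * 'X^i.
have p0 : p = 0.
  apply: hx; rewrite /root rmorph_sum horner_sum.
  rewrite (eq_bigr (fun i : 'I_n => (u i)%:R * x ^+ i - (v i)%:R * x ^+ i)).
    by rewrite sumrB E subrr.
  move=> i _; rewrite rmorphM /= map_polyC map_polyXn hornerCM hornerXn /=.
  by rewrite rmorphB /= mulrBl -!pmulrn.
apply/mnmP => i; have := congr1 (fun q : {poly int} => q`_i) p0.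
rewrite coef_sum coef0 (bigD1 i) //= big1 => [|j ji].
  rewrite coefCM coefXn eqxx mulr1 addr0 => /eqP.
  by rewrite subr_eq0 => /eqP[].
by rewrite coefCM coefXn eq_sym (inj_eq val_inj) (negPf ji) mulr0.
Qed.

Section OrderOfVanishing.
Variables (C : numFieldType) (n : nat).
Implicit Types (f g : ('I_n -> C) -> C) (p q : mpoly n C).

Definition near0 (P : ('I_n -> C) -> Prop) :=
  exists2 r : C, 0 < r & forall z t, 0 < t -> t < r ->
    (forall i, `|z i| <= t) -> P z.

(** Order of vanishing at least [K] at the origin, as a growth bound on polydiscs that asks for no
    regularity of [f]. Remainders of expansions are measured by it. *)
Definition vanishes K f := exists M r : C, 0 < r /\
  forall z t, 0 < t -> t < r -> (forall i, `|z i| <= t) -> `|f z| <= M * t ^+ K.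

Lemma near0_and (P Q : ('I_n -> C) -> Prop) :
  near0 P -> near0 Q -> near0 (fun z => P z /\ Q z).
Proof.
move=> [r r0 hP] [s s0 hQ]; have rs : (r >=< s) by apply: real_comparable; exact: gtr0_real.
have mr : Order.min r s <= r by rewrite comparable_ge_min // lexx.
have ms : Order.min r s <= s by rewrite comparable_ge_min // lexx orbT.
exists (Order.min r s); first by rewrite comparable_lt_min // r0.
move=> z t t0 tr zt; split; first exact: hP t0 (lt_le_trans tr mr) zt.
exact: hQ t0 (lt_le_trans tr ms) zt.
Qed.

Lemma vanishesP K f : vanishes K f <-> exists M r : C,
  [/\ 0 <= M, 0 < r, r <= 1 & forall z t, 0 < t -> t < r ->
  (forall i, `|z i| <= t) -> `|f z| <= M * t ^+ K].
Proof.
split=> [[M [r [r0 h]]]|[M [r [M0 r0 _ h]]]]; last by exists M, r.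
pose s := Order.min r 1.
have rs : (r >=< 1) by apply: real_comparable; [exact: gtr0_real|exact: real1].
have s0 : 0 < s by rewrite comparable_lt_min // r0 ltr01.
have sr : s <= r by rewrite comparable_ge_min // lexx.
have s1 : s <= 1 by rewrite comparable_ge_min // lexx orbT.
exists M, s; split=> //; last first.
  by move=> z t t0 ts; apply: h => //; exact: lt_le_trans sr.
have s20 : 0 < s / 2 by rewrite divr_gt0.
have s2r : s / 2 < r.
  by apply: lt_le_trans sr; rewrite ltr_pdivrMr // ltr_pMr // ltr1n.
(* The bound at the origin shows that [M] is nonnegative. *)
have := h (fun=> 0) (s / 2) s20 s2r.
rewrite normr0 => /(_ (fun _ => ltW s20)) /(le_trans (normr_ge0 _)).
by rewrite pmulr_lge0 // exprn_gt0.
Qed.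

Lemma vanishes_eq K f g : near0 (fun z => f z = g z) -> vanishes K f -> vanishes K g.
Proof.
move=> [r r0 h] /vanishesP[M [s [M0 s0 s1 hf]]].
have rs : (r >=< s) by apply: real_comparable; exact: gtr0_real.
exists M, (Order.min r s); split; first by rewrite comparable_lt_min // r0.
move=> z t t0; rewrite comparable_lt_min // => /andP[tr ts] zt.
by rewrite -(h z t) //; exact: hf.
Qed.

Lemma vanishesD K f g : vanishes K f -> vanishes K g ->
  vanishes K (fun z => f z + g z).
Proof.
move=> [M [r [r0 h]]] [M' [s [s0 h']]].
have rs : (r >=< s) by apply: real_comparable; exact: gtr0_real.
exists (M + M'), (Order.min r s); split; first by rewrite comparable_lt_min // r0.
move=> z t t0; rewrite comparable_lt_min // => /andP[tr ts] zt.
by rewrite mulrDl (le_trans (ler_normD _ _)) // lerD ?h ?h'.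
Qed.

Lemma vanishesM K J f g : vanishes K f -> vanishes J g ->
  vanishes (K + J) (fun z => f z * g z).
Proof.
move=> /vanishesP[M [r [M0 r0 _ h]]] /vanishesP[M' [s [M'0 s0 _ h']]].
have rs : (r >=< s) by apply: real_comparable; exact: gtr0_real.
exists (M * M'), (Order.min r s); split; first by rewrite comparable_lt_min // r0.
move=> z t t0; rewrite comparable_lt_min // => /andP[tr ts] zt.
by rewrite normrM exprD mulrACA ler_pM ?h ?h'.
Qed.

Lemma vanishes_cst c : vanishes 0 (fun=> c).
Proof. by exists `|c|, 1; split=> // *; rewrite expr0 mulr1. Qed.

Lemma vanishesZ K c f : vanishes K f -> vanishes K (fun z => c * f z).
Proof. exact: (vanishesM (vanishes_cst c)). Qed.

Lemma vanishesB K f g : vanishes K f -> vanishes K g ->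
  vanishes K (fun z => f z - g z).
Proof.
move=> hf hg; apply: (vanishes_eq _ (vanishesD hf (vanishesZ (-1) hg))).
by exists 1 => // z t *; rewrite mulN1r.
Qed.

Lemma vanishesW K J f : (K <= J)%N -> vanishes J f -> vanishes K f.
Proof.
move=> KJ /vanishesP[M [r [M0 r0 r1 h]]]; exists M, r; split=> // z t t0 tr zt.
apply: le_trans (h _ _ t0 tr zt) _; apply: ler_wpM2l => //.
by apply: ler_wiXn2l => //; [exact: ltW|exact: ltW (lt_le_trans tr r1)].
Qed.

Lemma vanishes0 K : vanishes K (fun=> 0).
Proof. by exists 0, 1; split=> // *; rewrite normr0 mul0r. Qed.

Lemma vanishes_sum K (I : Type) (r : seq I) (P : pred I) (f : I -> ('I_n -> C) -> C) :
  (forall i, P i -> vanishes K (f i)) ->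
  vanishes K (fun z => \sum_(i <- r | P i) f i z).
Proof.
move=> h; elim: r => [|i r IH].
  apply: (vanishes_eq _ (vanishes0 K)).
  by exists 1 => // z t *; rewrite big_nil.
case Pi: (P i).
  apply: (vanishes_eq _ (vanishesD (h i Pi) IH)).
  by exists 1 => // z t *; rewrite big_cons Pi.
by apply: (vanishes_eq _ IH); exists 1 => // z t *; rewrite big_cons Pi.
Qed.

Lemma vanishes_big (I : Type) (r : seq I) (K : I -> nat) (f : I -> ('I_n -> C) -> C) :
  (forall i, vanishes (K i) (f i)) ->
  vanishes (\sum_(i <- r) K i) (fun z => \prod_(i <- r) f i z).
Proof.
move=> h; elim: r => [|i r IH].
  rewrite big_nil; apply: (vanishes_eq _ (vanishes_cst 1)).
  by exists 1 => // z t *; rewrite big_nil.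
rewrite big_cons; apply: (vanishes_eq _ (vanishesM (h i) IH)).
by exists 1 => // z t *; rewrite big_cons.
Qed.

Lemma vanishesX K f k : vanishes K f -> vanishes (K * k) (fun z => f z ^+ k).
Proof.
move=> hf; elim: k => [|k IH].
  by rewrite muln0; apply: (vanishes_eq _ (vanishes_cst 1)); exists 1.
rewrite mulnS; apply: (vanishes_eq _ (vanishesM hf IH)).
by exists 1 => // z t *; rewrite exprS.
Qed.

Lemma vanishes_mpolyX a : vanishes (mdeg a) (fun z => meval z (mpolyX C a)).
Proof.
have hz i : vanishes 1 (fun z : 'I_n -> C => z i).
  by exists 1, 1; split=> // z t t0 _ zt; rewrite mul1r expr1.
have h := vanishes_big (index_enum _) (fun i => vanishesX (a i) (hz i)).
rewrite mdegE (eq_bigr (fun i => 1 * a i)%N) => [|i _]; last by rewrite mul1n.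
by apply: (vanishes_eq _ h); exists 1 => // z t *; rewrite mevalX.
Qed.

Lemma vanishes_mpoly K p : (forall a, a \in msupp p -> (K <= mdeg a)%N) ->
  vanishes K (fun z => meval z p).
Proof.
move=> h; pose f a z := if a \in msupp p then mcoeff a p * meval z (mpolyX C a) else 0.
have hf a : vanishes K (f a).
  rewrite /f; case ap: (a \in msupp p); last exact: vanishes0.
  exact: vanishesW (h _ ap) (vanishesZ _ (vanishes_mpolyX a)).
apply: (vanishes_eq _ (vanishes_sum (msupp p) (P := xpredT) (fun a _ => hf a))).
exists 1 => // z t _ _ _; rewrite [X in _ = meval z X]mpolyE raddf_sum /=.
rewrite big_seq [RHS]big_seq.
by apply: eq_bigr => a ap; rewrite /f ap mevalZ.
Qed.

End OrderOfVanishing.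

(** Induction on [m]: the bound forces [P.[0] = 0], and division by ['X] lowers the size and the
    order together. *)
Lemma small_poly_eq0 (C : numFieldType) m (P : {poly C}) (M r : C) :
  (size P <= m)%N -> 0 < r -> r <= 1 ->
  (forall t, 0 < t -> t < r -> `|P.[t]| <= M * t ^+ m) -> P = 0.
Proof.
move=> + r0 r1; elim: m P => [|m IH] P sP h.
  by apply/eqP; rewrite -size_poly_leq0.
have M0 : 0 <= M.
  have s20 : 0 < r / 2 by rewrite divr_gt0.
  have s2r : r / 2 < r by rewrite ltr_pdivrMr // ltr_pMr // ltr1n.
  have := le_trans (normr_ge0 _) (h _ s20 s2r).
  by rewrite pmulr_lge0 // exprn_gt0.
have [Q QE] : exists Q, P - P.[0]%:P = Q * ('X - 0%:P).
  by apply/factor_theorem; rewrite /root hornerD hornerN hornerC subrr.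
rewrite subr0 in QE.
have [ub hub] := poly_disk_bound Q 1.
have P0 : P.[0] = 0.
  apply/eqP/negPn/negP => P0; have c0 : 0 < `|P.[0]| by rewrite normr_gt0.
  have ub0 : 0 <= ub by apply: le_trans (normr_ge0 _) (hub 0 _); rewrite normr0.
  set c := `|P.[0]| in c0; pose M' := M + ub + 1.
  have M'0 : 0 < M' by rewrite ltr_wpDl // addr_ge0.
  have D0 : 0 < r * M' + c by rewrite addr_gt0 // mulr_gt0.
  (* This [t] is below both [r] and [c / M']; the latter contradicts the bound on [c] that the
     hypothesis gives at [t]. *)
  pose t := r * c / (r * M' + c).
  have t0 : 0 < t by rewrite divr_gt0 // mulr_gt0.
  have tr : t < r.
    by rewrite ltr_pdivrMr // ltr_pM2l // ltrDr mulr_gt0.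
  have tM : t * M' < c.
    rewrite mulrAC ltr_pdivrMr // [c * _]mulrC [r * c * M']mulrAC.
    by rewrite ltr_pM2r // ltrDl.
  have : c <= t * M'.
    have t1 : t <= 1 by exact: ltW (lt_le_trans tr r1).
    have E : P.[0] = P.[t] - Q.[t] * t.
      have := congr1 (fun p : {poly C} => p.[t]) QE.
      by rewrite hornerMX hornerD hornerN hornerC => <-; rewrite subKr.
    rewrite {1}/c E (le_trans (ler_normB _ _)) // /M' mulrDr mulrDr.
    apply: ler_wpDr; first by rewrite mulr1 ltW.
    apply: lerD.
      apply: le_trans (h t t0 tr) _; rewrite mulrC ler_wpM2r //.
      by rewrite exprS ler_piMr ?(ltW t0) ?exprn_ile1 ?(ltW t0).
    rewrite normrM mulrC (gtr0_norm t0) ler_wpM2l ?(ltW t0) //.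
    by apply: hub; rewrite gtr0_norm.
  by move=> /(lt_le_trans tM); rewrite ltxx.
have PE : P = Q * 'X by rewrite -QE P0 subr0.
suff Q0 : Q = 0 by rewrite PE Q0 mul0r.
have [->//|Q0] := eqVneq Q 0.
apply: IH => [|t t0 tr].
  by move: sP; rewrite PE size_mulX // ltnS.
have := h t t0 tr; rewrite PE hornerMX normrM exprSr mulrA (gtr0_norm t0).
by rewrite ler_pM2r.
Qed.

Lemma digits_lt K n (a : 'I_n -> nat) : (forall i, (a i < K)%N) ->
  (\sum_i a i * K ^ i < K ^ n)%N.
Proof.
elim: n a => [|n IH] a aK; first by rewrite big_ord0.
rewrite big_ord_recr /= expnS -addnS.
have := IH (fun i => a (widen_ord (leqnSn n) i)) (fun i => aK _) => /= h.
have := aK ord_max => hm.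
apply: (@leq_trans (K ^ n + a ord_max * K ^ n)); first by rewrite -addSnnS leq_add2r.
by rewrite -mulSn leq_mul2r hm orbT.
Qed.

Lemma digits_inj K n (a b : 'I_n -> nat) :
  (forall i, (a i < K)%N) -> (forall i, (b i < K)%N) ->
  (\sum_i a i * K ^ i = \sum_i b i * K ^ i)%N -> a =1 b.
Proof.
elim: n a b => [|n IH] a b aK bK; first by move=> _ [].
rewrite !big_ord_recr /=.
pose a' i := a (widen_ord (leqnSn n) i); pose b' i := b (widen_ord (leqnSn n) i).
have ha : (\sum_(i < n) a' i * K ^ i < K ^ n)%N by apply: digits_lt => i; exact: aK.
have hb : (\sum_(i < n) b' i * K ^ i < K ^ n)%N by apply: digits_lt => i; exact: bK.
rewrite -/(\sum_(i < n) a' i * K ^ i)%N -/(\sum_(i < n) b' i * K ^ i)%N => E.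
have Kn : (0 < K ^ n)%N by exact: leq_ltn_trans ha.
have Em : a ord_max = b ord_max.
  have := congr1 (fun x => x %/ K ^ n)%N E.
  by rewrite ![(_ + _ * _)%N]addnC !divnMDl // !divn_small // !addn0.
move: E; rewrite Em => /addIn E.
have ab := IH a' b' (fun i => aK _) (fun i => bK _) E.
move=> i; have [j ->|->//] := unliftP ord_max i.
have := ab j; rewrite /a' /b'.
by have -> : widen_ord (leqnSn n) j = lift ord_max j by apply/val_inj; rewrite /= /bump leqNgt ltn_ord.
Qed.

(* Kronecker substitution: on monomials of degree < K, distinct exponents have
   distinct weights for the weight [K ^ n + K ^ i] of the i-th variable. *)
Lemma vanishes_mcoeff (C : numFieldType) n K (p : mpoly n C) :
  vanishes K (fun z => meval z p) ->
  forall a, (mdeg a < K)%N -> mcoeff a p = 0.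
Proof.
move=> hp; pose q := truncation K (fun a => mcoeff a p).
have qE a : mcoeff a q = if (mdeg a < K)%N then mcoeff a p else 0.
  exact: mcoeff_truncation.
have hq : vanishes K (fun z => meval z q).
  have h : vanishes K (fun z => meval z (p - q)).
    apply: vanishes_mpoly => a; rewrite mcoeff_msupp mcoeffB qE.
    by case: ltnP => // _; rewrite subrr eqxx.
  apply: (vanishes_eq _ (vanishesB hp h)); exists 1 => // z t *.
  by rewrite mevalB subKr.
suff q0 : q = 0 by move=> a aK; have := qE a; rewrite aK q0 mcoeff0.
case: (posnP K) => [K0|K0].
  by apply/mpolyP => a; rewrite qE K0 mcoeff0.
(* The common part [Q] of the weights gives [|z i| <= t ^+ Q], while every [e a] stays below
   [Q * K]; so [P] has degree less than its order of vanishing. *)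
pose Q := (K ^ n)%N; pose e (a : multinom n) := (Q * mdeg a + \sum_i a i * K ^ i)%N.
have Q0 : (0 < Q)%N by rewrite expn_gt0 K0.
have aK (a : multinom n) : (mdeg a < K)%N -> forall i, (a i < K)%N.
  by move=> h i; apply: leq_ltn_trans h; rewrite mdegE (bigD1 i) //= leq_addr.
have e_inj (a b : multinom n) : (mdeg a < K)%N -> (mdeg b < K)%N -> e a = e b -> a = b.
  move=> /aK ha /aK hb E; apply/mnmP; apply: (digits_inj ha hb).
  have := congr1 (fun x => x %% Q)%N E.
  by rewrite /e ![(Q * _)%N]mulnC !modnMDl !modn_small // digits_lt.
have e_lt (a : multinom n) : (mdeg a < K)%N -> (e a < Q * K)%N.
  move=> h; apply: (@leq_trans (Q * (mdeg a).+1)); last by rewrite leq_mul2l h orbT.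
  by rewrite mulnS addnC /e ltn_add2l; apply: digits_lt; exact: aK.
pose P : {poly C} := \sum_(a : bmultinom n K) (mcoeff a p)%:P * 'X^(e a).
have PE (a : bmultinom n K) : P`_(e a) = mcoeff a p.
  rewrite /P coef_sum (bigD1 a) //= coefCM coefXn eqxx mulr1 big1 ?addr0 //.
  move=> b ba; rewrite coefCM coefXn; case: eqP; last by rewrite mulr0.
  move=> /esym/(e_inj _ _ (bmdeg _) (bmdeg _)) E; case/eqP: ba; exact: val_inj.
suff P0 : P = 0.
  apply/mpolyP => a; rewrite qE mcoeff0; case: ifP => // h.
  by have := PE (BMultinom h); rewrite P0 coef0.
have [M [r [M0 r0 r1 h]]] := (vanishesP K (fun z => meval z q)).1 hq.
apply: (@small_poly_eq0 _ (Q * K) P M r) => // [|t t0 tr].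
  apply: (leq_trans (size_sum _ _ _)); apply/bigmax_leqP => a _.
  rewrite mul_polyC (leq_trans (size_scale_leq _ _)) // size_polyXn.
  exact/e_lt/bmdeg.
have t1 : t <= 1 by exact: ltW (lt_le_trans tr r1).
have tQ0 : 0 < t ^+ Q by rewrite exprn_gt0.
have tQr : t ^+ Q < r.
  by apply: le_lt_trans tr; rewrite -[leRHS]expr1 ler_wiXn2l // ltW.
pose z (i : 'I_n) := t ^+ (Q + K ^ i).
have zt i : `|z i| <= t ^+ Q.
  by rewrite /z ger0_norm ?exprn_ge0 ?(ltW t0) // ler_wiXn2l ?leq_addr ?(ltW t0).
have := h z _ tQ0 tQr zt; rewrite -exprM; congr (`|_| <= _).
rewrite /q /truncation raddf_sum /P horner_sum; apply: eq_bigr => a _ /=.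
rewrite mevalZ mevalX hornerCM hornerXn; congr (_ * _).
rewrite /e mdegE big_distrr -big_split /= expr_sum; apply: eq_bigr => i _.
by rewrite /z -exprM mulnDl [(K ^ i * _)%N]mulnC.
Qed.

(** * Power series with a bound on the remainder *)

Section AnalyticExpansion.
Variables (R : realType) (N : nat).
Local Notation C := (R[i]).

Definition mnm_of_fun (k : {ffun 'I_N -> nat}) : multinom N :=
  Multinom [tuple k i | i < N].

(** Cubes of multi-indices are a cofinal family of finite sets on which sums of products factor. *)
Definition box (m : nat) (g : {ffun 'I_N -> 'I_m}) : {ffun 'I_N -> nat} :=
  [ffun i => nat_of_ord (g i)].

Lemma box_inj m : injective (@box m).
Proof.
move=> g h /ffunP E; apply/ffunP => i; apply/val_inj.
by have := E i; rewrite !ffunE.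
Qed.

Lemma box_cofinal (A : {fset {ffun 'I_N -> nat}}) m0 : exists2 m, (m0 <= m)%N &
  (A `<=` [fset box g | g in {: {ffun 'I_N -> 'I_m.+1}}])%fset.
Proof.
pose m := maxn m0 (\max_(k <- A) \max_i k i).
exists m; first exact: leq_maxl.
apply/fsubsetP => k kA; apply/imfsetP => /=.
have km i : (k i < m.+1)%N.
  rewrite ltnS leq_max; apply/orP; right.
  apply: (@leq_trans (\max_j k j)); first exact: leq_bigmax.
  exact: leq_bigmax_seq.
exists [ffun i => Ordinal (km i)] => //.
by apply/ffunP => i; rewrite !ffunE.
Qed.

Lemma truncation_box (c : multinom N -> C) K m : (K <= m)%N ->
  truncation K c = \sum_(g : {ffun 'I_N -> 'I_m.+1} |
     (mdeg (mnm_of_fun (box g)) < K)%N)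
     c (mnm_of_fun (box g)) *: mpolyX C (mnm_of_fun (box g)).
Proof.
move=> Km; apply/mpolyP => a; rewrite mcoeff_truncation raddf_sum /=.
case: ifP => aK; last first.
  rewrite big1 // => g gK; rewrite mcoeffZ mcoeffX.
  by case: eqP => [E|]; rewrite ?mulr0 //; rewrite E aK in gK.
have am i : (a i < m.+1)%N.
  apply: ltnW; rewrite ltnS; apply: leq_trans Km; apply: leq_ltn_trans aK.
  by rewrite mdegE (bigD1 i) //= leq_addr.
pose g0 : {ffun 'I_N -> 'I_m.+1} := [ffun i => Ordinal (am i)].
have g0E : mnm_of_fun (box g0) = a by apply/mnmP => i; rewrite mnmE !ffunE.
rewrite (bigD1 g0) ?g0E //= mcoeffZ mcoeffX eqxx mulr1 big1 ?addr0 //.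
move=> g /andP[_ gg0]; rewrite mcoeffZ mcoeffX; case: eqP; last by rewrite mulr0.
rewrite -g0E => E; case/eqP: gg0; apply/(@box_inj m.+1)/ffunP => i.
by have := congr1 (fun b : multinom N => b i) E; rewrite !mnmE.
Qed.

(** The sum is a product of [N] geometric sums, each at most 2. *)
Lemma geometric_box_le m :
  \sum_(g : {ffun 'I_N -> 'I_m}) (2^-1 : C) ^+ mdeg (mnm_of_fun (box g)) <= 2 ^+ N.
Proof.
have E (g : {ffun 'I_N -> 'I_m}) :
    (2^-1 : C) ^+ mdeg (mnm_of_fun (box g)) = \prod_i (2^-1 : C) ^+ g i.
  by rewrite mdegE expr_sum; apply: eq_bigr => i _; rewrite mnmE ffunE.
rewrite (eq_bigr _ (fun g _ => E g)) -(bigA_distr_bigA (fun i (j : 'I_m) => (2^-1 : C) ^+ j)).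
rewrite prodr_const card_ord lerXn2r ?nnegrE ?ler0n //.
  by apply: sumr_ge0 => j _; rewrite exprn_ge0 // invr_ge0 ler0n.
suff -> : \sum_(j < m) (2^-1 : C) ^+ j = 2 - 2 * 2^-1 ^+ m.
  by rewrite lerBlDr lerDl mulr_ge0 // exprn_ge0 // invr_ge0 ler0n.
elim: m {E} => [|m IH]; first by rewrite big_ord0 expr0 mulr1 subrr.
rewrite big_ord_recr /= IH exprS [X in _ = _ - X]mulrA divff ?pnatr_eq0 // mul1r.
by ring.
Qed.

(** Cauchy's argument: convergence at the point with all increments [rho] bounds the coefficients,
    and on smaller polydiscs the tail from degree [K] on is dominated by a geometric series. *)
Lemma analytic_expansion (F : 'rV[Cplx R]_N -> Cplx R) (a : 'rV[Cplx R]_N) :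
  analytic_at F a -> exists c : multinom N -> C, forall K,
  vanishes K (fun y : 'I_N -> C =>
    (F (\row_i (a ord0 i + y i)) : C) - meval y (truncation K c)).
Proof.
move=> [c /nbhs_ballP[e /= e0 hc]].
pose c' (k : multinom N) : C := c [ffun i => k i].
have c'E k : c' (mnm_of_fun k) = c k.
  by congr c; apply/ffunP => i; rewrite ffunE mnmE.
exists c' => K.
pose term (y : 'I_N -> C) (k : {ffun 'I_N -> nat}) : C := c k * \prod_i y i ^+ k i.
have conv (y : 'I_N -> C) (eps : C) : (forall i, `|y i| < e) -> 0 < eps ->
    exists A0 : {fset {ffun 'I_N -> nat}}, forall A, (A0 `<=` A)%fset ->
    `|(F (\row_i (a ord0 i + y i)) : C) - \sum_(k <- A) term y k| < eps.
  move=> ye eps0.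
  have /hc h : ball a e (\row_i (a ord0 i + y i)).
    split=> // i j; rewrite !ord1 mxE -ball_normE /= opprD addrA subrr add0r normrN.
    exact: ye.
  have [A0 _ hA] := h _ (nbhsx_ballx _ _ eps0).
  exists A0 => A /hA; rewrite /partial_sum /= -ball_normE /= => hlt.
  apply: le_lt_trans hlt; rewrite le_eqVlt; apply/orP; left; apply/eqP.
  congr (`|_ - _|); rewrite big_seq_fsetE /=; apply: eq_bigr => k _.
  congr (_ * _); apply: eq_bigr => i _; congr (_ ^+ _).
  by rewrite mxE [X in X - _]addrC addrK.
pose rho : C := e / 2.
have rho0 : 0 < rho by rewrite divr_gt0.
have rhoe : rho < e by rewrite ltr_pdivrMr // ltr_pMr // ltr1n.
have [B [B0 hB]] : exists B : C, 0 <= B /\ forall k, `|c k| * rho ^+ mdeg (mnm_of_fun k) <= B.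
  have rn (i : 'I_N) : `|(fun _ : 'I_N => rho) i| < e by rewrite gtr0_norm.
  have [A0 hA0] := conv (fun=> rho) 1 rn ltr01.
  have tE k : `|term (fun=> rho) k| = `|c k| * rho ^+ mdeg (mnm_of_fun k).
    rewrite normrM; congr (_ * _); rewrite normr_prod mdegE expr_sum.
    by apply: eq_bigr => i _; rewrite mnmE normrX gtr0_norm.
  (* A term outside [A0] is the difference of two partial sums, each within 1 of the limit; a term
     inside is bounded by the finite sum. *)
  exists (2 + \sum_(k <- A0) `|term (fun=> rho) k|); split.
    by rewrite addr_ge0 // sumr_ge0.
  move=> k; rewrite -tE; have [kA|kA] := boolP (k \in A0).
    rewrite (big_rem k) //= addrCA ler_wpDr // addr_ge0 // sumr_ge0 //.
  have h1 := hA0 _ (fsubset_refl A0).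
  have h2 := hA0 _ (fsubsetU1 k A0).
  rewrite big_fsetU1 //= in h2.
  apply: ler_wpDr; first exact: sumr_ge0.
  have -> : term (fun=> rho) k =
      ((F (\row_i (a ord0 i + rho)) : C) - \sum_(k <- A0) term (fun=> rho) k)
    - ((F (\row_i (a ord0 i + rho)) : C) -
       (term (fun=> rho) k + \sum_(k <- A0) term (fun=> rho) k)).
    by ring.
  by rewrite (le_trans (ler_normB _ _)) // -[2]/(1 + 1) lerD // ltW.
(* For [w >= K] and [t < rho / 2], [(t / rho) ^+ w] is at most [(2 * t / rho) ^+ K * 2^-1 ^+ w], and
   the powers of [2^-1] sum to at most [2 ^+ N]. *)
exists (B * (2 / rho) ^+ K * 2 ^+ N), (rho / 2); split; first by rewrite divr_gt0.
move=> y t t0 tr yt; apply/ler_addgt0Pr => eps eps0.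
have trho : t < rho.
  by apply: lt_trans tr _; rewrite ltr_pdivrMr // ltr_pMr // ltr1n.
have ye i : `|y i| < e by apply: le_lt_trans (yt i) (lt_trans trho rhoe).
have [A0 hA0] := conv y eps ye eps0.
have [m Km Am] := box_cofinal A0 K.
have := hA0 _ Am; rewrite big_imfset /=; last by move=> g h _ _; exact: box_inj.
rewrite big_enum /= => hS.
set S := \sum_(g in _) _ in hS.
have TE : meval y (truncation K c') = \sum_(g : {ffun 'I_N -> 'I_m.+1} |
    (mdeg (mnm_of_fun (box g)) < K)%N) term y (box g).
  rewrite (truncation_box c' Km) raddf_sum /=; apply: eq_bigr => g _.
  rewrite mevalZ mevalX c'E; congr (_ * _); apply: eq_bigr => i _.
  by rewrite mnmE.
have SB : `|S - meval y (truncation K c')| <= B * (2 / rho) ^+ K * 2 ^+ N * t ^+ K.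
  rewrite TE /S (bigID (fun g => (mdeg (mnm_of_fun (box g)) < K)%N)) /=.
  rewrite [X in `|X - _|]addrC addrK.
  apply: le_trans (ler_norm_sum _ _ _) _.
  have tK0 : 0 <= t ^+ K by rewrite exprn_ge0 // ltW.
  have rK0 : 0 <= (2 / rho) ^+ K by rewrite exprn_ge0 // divr_ge0 // ltW.
  have D0 : 0 <= B * (2 / rho) ^+ K * t ^+ K by rewrite !mulr_ge0.
  apply: (@le_trans _ _ (\sum_(g : {ffun 'I_N -> 'I_m.+1})
      B * (2 / rho) ^+ K * t ^+ K * (2^-1) ^+ mdeg (mnm_of_fun (box g)))).
    rewrite [leRHS](bigID (fun g => ~~ (mdeg (mnm_of_fun (box g)) < K)%N)) /=.
    apply: ler_wpDr.
      apply: sumr_ge0 => g _; rewrite mulr_ge0 // exprn_ge0 // invr_ge0 ler0n.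
    apply: ler_sum => g; rewrite -leqNgt => gK.
    set k := box g; set w := mdeg _ in gK *.
    have wE : (w = K + (w - K))%N by rewrite subnKC.
    rewrite /term normrM normr_prod.
    have prod_le : \prod_i `|y i ^+ k i| <= t ^+ w.
      rewrite /w mdegE expr_sum; apply: ler_prod => i _.
      by rewrite normr_ge0 mnmE normrX lerXn2r ?nnegrE ?normr_ge0 // ltW.
    apply: le_trans (ler_wpM2l (normr_ge0 _) prod_le) _.
    have rw0 : 0 < rho ^+ w by rewrite exprn_gt0.
    rewrite -(ler_pM2r rw0) mulrAC.
    have tw0 : 0 <= t ^+ w by rewrite exprn_ge0 // ltW.
    apply: le_trans (ler_wpM2r tw0 (hB k)) _.
    rewrite -!mulrA; apply: ler_wpM2l => //.
    have -> : (2 / rho) ^+ K * (t ^+ K * (2^-1 ^+ w * rho ^+ w))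
       = t ^+ K * (2^-1 * rho) ^+ (w - K).
      rewrite -exprMn [in LHS]wE [X in _ * (_ * X)]exprD mulrCA mulrA.
      rewrite -!mulrA; congr (_ * _); rewrite mulrA -exprMn.
      have -> : 2 / rho * (2^-1 * rho) = 1 by field; exact: lt0r_neq0.
      by rewrite expr1n mul1r.
    rewrite [in leLHS]wE exprD.
    apply: ler_wpM2l => //.
    rewrite lerXn2r ?nnegrE ?(ltW t0) // mulrC ?(ltW tr) // ltW //.
    by rewrite divr_gt0.
  rewrite -mulr_sumr.
  apply: le_trans (ler_wpM2l D0 (geometric_box_le m.+1)) _.
  by rewrite mulrAC.
rewrite -(subrKA S) addrC.
apply: le_trans (ler_normD _ _) _.
by apply: lerD => //; exact: ltW.
Qed.

End AnalyticExpansion.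

(** * Toric coordinates *)

Section Coordinates.
Variables (R : realType) (V : vectType R).
Implicit Types (W sigma : set V) (u v : 'Hom(V, R^o)).
Local Notation M W := (dual_lattice W).

Lemma dual_lattice0 W : M W 0.
Proof. by move=> w _; rewrite lfunE /= rpred0. Qed.

Lemma dual_latticeD W u v : M W u -> M W v -> M W (u + v).
Proof. by move=> hu hv w Ww; rewrite lfunE /= rpredD ?hu ?hv. Qed.

Lemma dual_latticeN W u : M W u -> M W (- u).
Proof. by move=> hu w Ww; rewrite lfunE /= rpredN hu. Qed.

Lemma dual_latticeB W u v : M W u -> M W v -> M W (u - v).
Proof. by move=> hu /dual_latticeN; exact: dual_latticeD. Qed.

Lemma dual_latticeZ W u (k : int) : M W u -> M W (k%:~R *: u).
Proof. by move=> hu w Ww; rewrite lfunE /= rpredM ?hu ?intr_int. Qed.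

Definition coordf n (w : n.-tuple V) i : 'Hom(V, R^o) :=
  linfun (coord w i : V -> R^o).

Lemma coordfE n (w : n.-tuple V) i x : coordf w i x = coord w i x.
Proof. by rewrite lfunE. Qed.

Lemma dual_basisE n (w : n.-tuple V) u : basis_of fullv w ->
  u = \sum_(i < n) (u w`_i : R) *: coordf w i.
Proof.
move=> hw; apply/lfunP => x; rewrite sum_lfunE.
rewrite {1}(coord_basis hw (memvf x)) linear_sum /=; apply: eq_bigr => i _.
by rewrite linearZ lfunE /= coordfE [LHS]mulrC.
Qed.

(** [w] spans the rays, rescaled so that pairing with each of its vectors maps the dual lattice onto
    the integers ([tc_int], [tc_prim]); [d] is a common denominator of the dual basis. *)
Record toric_coordinates W sigma n d (w : n.-tuple V) : Prop := ToricCoordinates {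
  tc_basis : basis_of fullv w;
  tc_int : forall u (i : 'I_n), M W u -> (u w`_i : R) \is a Num.int;
  tc_monoid : forall u,
    dual_monoid W sigma u <-> M W u /\ forall i : 'I_n, 0 <= (u w`_i : R);
  tc_prim : forall i : 'I_n, exists2 u, M W u & u w`_i = 1;
  tc_gt0 : (0 < d)%N;
  tc_axis : forall i, M W (d%:R *: coordf w i) }.

Lemma coordf_dual_lattice n (b : n.-tuple V) W k : basis_of fullv b ->
  W = [set w | inIntSpan b w] -> M W (coordf b k).
Proof.
move=> hb -> _ [a ->]; rewrite coordfE.
under eq_bigr do rewrite -scaler_int.
by rewrite coord_sum_free ?(basis_free hb) // intr_int.
Qed.

(** The values at [v] form a nonzero subgroup of the integers; [g] is its least positive element,
    and division with remainder shows that it generates. *)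
Lemma primitive_functional W (v : V) n (b : n.-tuple V) : basis_of fullv b ->
  W = [set w | inIntSpan b w] -> W v -> v != 0 ->
  exists2 g : nat, (0 < g)%N &
    (exists2 u, M W u & u v = g%:R) /\
    forall u, M W u -> exists z : int, u v = z%:~R * g%:R.
Proof.
move=> hb WE Wv v0.
pose P k := `[< (0 < k)%N /\ exists2 u, M W u & u v = k%:R :> R >].
have exP : exists k, P k.
  have [k kv] : exists k, coord b k v != 0.
    apply/existsP; apply: contraNT v0; rewrite negb_exists => /forallP h.
    rewrite (coord_basis hb (memvf v)) big1 // => k _.
    by have := h k; rewrite negbK => /eqP->; rewrite scale0r.
  have hk := coordf_dual_lattice k hb WE.
  have /intrP[z zE] := hk _ Wv; rewrite coordfE in zE.
  have z0 : z != 0 by apply: contraNneq kv => z0; rewrite zE z0.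
  exists (absz z); apply/asboolP; split; first by rewrite absz_gt0.
  exists ((sgz z)%:~R *: coordf b k); first exact: dual_latticeZ.
  rewrite lfunE /= coordfE zE; have : (sgz z)%:~R * z%:~R = (absz z)%:R :> R by rewrite [RHS]pmulrn abszEsg intrM.
  exact.
have [g /asboolP[g0 [u0 hu0 u0v]] gmin] := ex_minnP exP.
exists g => //; split; first by exists u0.
move=> u hu; have /intrP[z zE] := hu _ Wv; exists (z %/ g%:Z)%Z.
suff r0 : (z %% g%:Z)%Z = 0.
  by rewrite zE {1}(divz_eq z g%:Z) r0 addr0 intrM.
have g0' : g%:Z != 0 by rewrite eqz_nat -lt0n.
apply/eqP/negPn/negP => r0; pose r := absz (z %% g%:Z)%Z.
have rE : r%:Z = (z %% g%:Z)%Z by rewrite gez0_abs // modz_ge0.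
have : P r.
  apply/asboolP; split; first by rewrite absz_gt0.
  exists (u - (z %/ g%:Z)%Z%:~R *: u0).
    by apply: dual_latticeB => //; exact: dual_latticeZ.
  rewrite add_lfunE opp_lfunE scale_lfunE zE u0v [RHS]pmulrn rE /modz.
  by rewrite rmorphB /= intrM.
move=> /gmin; rewrite leqNgt -ltz_nat rE.
by rewrite ltz_pmod // ltz_nat.
Qed.

(** The free generators need not lie in the lattice. When one of them is written as a nonnegative
    combination of lattice generators, no coordinates off its ray can cancel, so a term with
    positive [i]-th coordinate lies on the ray. *)
Lemma simplicial_rays W sigma (g : seq V) : rational_polyhedral W sigma ->
  free g -> sigma = generated_cone g ->
  forall i : 'I_(size g), exists2 c : R, 0 < c & W (c *: g`_i).
Proof.
move=> [h hW sh] fg sg i; pose tg := in_tuple g.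
have ftg : free tg by [].
have gen (v : V) : sigma v -> (forall k, 0 <= coord tg k v) /\
    v = \sum_k coord tg k v *: g`_k.
  rewrite sg => -[a a0 ->]; split.
    by move=> k; rewrite (coord_sum_free (X := tg)).
  by apply: eq_bigr => k _; rewrite (coord_sum_free (X := tg)).
have gi : sigma g`_i.
  rewrite sg; exists (fun k => (k == i)%:R) => [k|]; first by rewrite ler0n.
  rewrite (bigD1 i) //= eqxx scale1r big1 ?addr0 // => k /negPf->.
  by rewrite scale0r.
move: (gi); rewrite {1}sh => -[a a0 giE].
have hs (j : 'I_(size h)) : sigma h`_j.
  rewrite sh; exists (fun k => (k == j)%:R) => [k|]; first by rewrite ler0n.
  rewrite (bigD1 j) //= eqxx scale1r big1 ?addr0 // => k /negPf->.
  by rewrite scale0r.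
have cE k : (i == k)%:R = \sum_j a j * coord tg k h`_j.
  rewrite -(coord_free i k ftg) {1}giE linear_sum; apply: eq_bigr => j _.
  by rewrite linearZ.
have [j aj] : exists j, 0 < a j * coord tg i h`_j.
  apply/not_existsP => nj; have := cE i; rewrite eqxx big1 => [/eqP|j _].
    by rewrite oner_eq0.
  apply: le_anti; rewrite mulr_ge0 ?a0 ?(gen _ (hs j)).1 // andbT leNgt.
  exact/negP/nj.
have aj0 : 0 < a j by rewrite lt_neqAle a0 andbT; apply: contraTneq aj => <-; rewrite mul0r ltxx.
have ck k : k != i -> coord tg k h`_j = 0.
  move=> ki; apply: (mulfI (lt0r_neq0 aj0)); rewrite mulr0.
  have pos l : true -> 0 <= a l * coord tg k h`_l.
    by move=> _; rewrite mulr_ge0 ?a0 ?(gen _ (hs l)).1.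
  by apply: (psumr_eq0P pos); rewrite // -cE eq_sym (negPf ki).
exists (coord tg i h`_j); first by rewrite -(pmulr_rgt0 _ aj0).
have <- : h`_j = coord tg i h`_j *: g`_i.
  rewrite {1}(gen _ (hs j)).2 (bigD1 i) //= big1 ?addr0 // => k ki.
  by rewrite ck ?scale0r.
by apply: hW; exact: mem_nth.
Qed.

Lemma exists_toric_coordinates W sigma : maximal_simplicial_pair W sigma ->
  exists n d (w : n.-tuple V), toric_coordinates W sigma d w.
Proof.
move=> [[[nb [b [hb WE]]] hrat _] [U [Usub Umin Udim]] [g fg sg]].
have gfull : <<g>>%VS = fullv.
  have UE : U = fullv.
    by apply/eqP; rewrite -dimv_leqif_eq ?subvf // Udim.
  apply/eqP; rewrite eqEsubv subvf -UE; apply: Umin => v.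
  rewrite sg => -[a _ ->]; apply: memv_suml => i _; apply/memvZ/memv_span.
  exact: mem_nth.
have bg : basis_of fullv g by rewrite basisEdim gfull subvv /= -gfull (eqP fg).
have /choice[c hc] : forall i : 'I_(size g), exists c : R,
    0 < c /\ W (c *: g`_i).
  by move=> i; have [c c0 Wc] := simplicial_rays hrat fg sg i; exists c.
have g0 (i : 'I_(size g)) : g`_i != 0 by exact: (free_not0 fg (mem_nth 0 _)).
have /choice[e he] : forall i : 'I_(size g), exists e : nat, (0 < e)%N /\
    (exists2 u, M W u & u (c i *: g`_i) = e%:R) /\
    forall u, M W u -> exists z : int, u (c i *: g`_i) = z%:~R * e%:R.
  move=> i; have [c0 Wc] := hc i.
  have v0 : c i *: g`_i != 0 by rewrite scaler_eq0 negb_or lt0r_neq0 ?g0.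
  by have [e e0 h] := primitive_functional hb WE Wc v0; exists e.
(* Dividing the lattice vector on the ray by the generator [e i] of its values makes these values
   all the integers. *)
pose r i := (e i)%:R^-1 * c i.
have e0 i : (e i)%:R != 0 :> R by rewrite pnatr_eq0 -lt0n (he i).1.
have r0 i : 0 < r i by rewrite mulr_gt0 ?(hc i).1 // invr_gt0 ltr0n (he i).1.
pose w := [tuple r i *: g`_i | i < size g].
have wE (i : 'I_(size g)) : w`_i = r i *: g`_i by rewrite -tnth_nth tnth_mktuple.
have hw : basis_of fullv w.
  rewrite basisEdim size_tuple -gfull (eqP fg) leqnn andbT.
  apply/span_subvP => v vg; have := vg; rewrite -index_mem => ig.
  have -> : v = (r (Ordinal ig))^-1 *: w`_(Ordinal ig).
    by rewrite wE scalerA mulVf ?lt0r_neq0 // scale1r /= nth_index.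
  by apply/memvZ/memv_span/mem_nth; rewrite size_tuple.
have pairE (u : 'Hom(V, R^o)) (i : 'I_(size g)) : u w`_i = (e i)%:R^-1 * (u (c i *: g`_i) : R) :> R.
  by rewrite wE -scalerA linearZ.
have nbE : nb = size g 
  by rewrite -(size_tuple b) -(eqP (basis_free hb)) (span_basis hb) -(eqP fg) gfull.
move: b hb WE; rewrite {}nbE => b hb WE.
have uint (u : 'Hom(V, R^o)) (i : 'I_(size g)) : M W u -> (u w`_i : R) \is a Num.int.
  move=> hu; have [z zE] := (he i).2.2 u hu.
  by rewrite pairE zE mulrC mulfK // intr_int.
(* [Q] expresses [w] in the lattice basis and is integral; by the adjugate formula its inverse [E]
   has denominator [\det Q0], whence the choice of [d]. *)
pose Q : 'M[R]_(size g) := \matrix_(k, i) coord b k w`_i.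
pose E : 'M[R]_(size g) := \matrix_(i, k) coord w i b`_k.
pose Q0 : 'M[int]_(size g) := \matrix_(k, i) Num.floor (coord b k w`_i).
have QE : Q = map_mx intr Q0.
  apply/matrixP => k i; rewrite !mxE floorK // -coordfE.
  by apply: uint; exact: (coordf_dual_lattice _ hb WE).
have EQ : E *m Q = 1%:M.
  apply/matrixP => i j; rewrite !mxE.
  rewrite [in RHS]eq_sym -(coord_free j i (basis_free hw)) [in RHS](coord_basis hb (memvf w`_j)).
  by rewrite linear_sum; apply: eq_bigr => k _; rewrite linearZ !mxE mulrC.
have dQ : \det Q = (\det Q0)%:~R by rewrite QE det_map_mx.
have D0 : \det Q0 != 0.
  apply: contra_eq_neq EQ => D0; apply/eqP => /(congr1 determinant).
  by rewrite det_mulmx dQ D0 mulr0 det1 => /esym/eqP; rewrite oner_eq0.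
have adjE : (\det Q0)%:~R *: E = map_mx intr (\adj Q0).
  by rewrite map_mx_adj -QE -[RHS]mul1mx -EQ -mulmxA mul_mx_adj dQ mul_mx_scalar.
exists (size g), (absz (\det Q0)), w; split => //.
- move=> u; split=> [[hc' hu]|[hu pos]].
    split=> // i; apply: hc'; rewrite wE sg.
    exists (fun k => (k == i)%:R * r i) => [k|].
      by rewrite mulr_ge0 ?ler0n // ltW.
    rewrite (bigD1 i) //= eqxx mul1r big1 ?addr0 // => k /negPf->.
    by rewrite mul0r scale0r.
  split=> // v; rewrite sg => -[a a0 ->]; rewrite linear_sum sumr_ge0 // => i _.
  have -> : g`_i = (r i)^-1 *: w`_i by rewrite wE scalerA mulVf ?lt0r_neq0 // scale1r.
  rewrite !linearZ /= mulr_ge0 ?a0 // mulr_ge0 ?pos // invr_ge0 ltW //.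
- move=> i; have [[u hu uE] _] := (he i).2; exists u => //.
  by apply/eqP; rewrite pairE uE mulVf.
- by rewrite absz_gt0.
move=> i.
have h : M W ((\det Q0)%:~R *: coordf w i).
  rewrite {1}WE => _ [a ->]; rewrite linear_sum /=; apply: rpred_sum => k _.
  have -> : ((\det Q0)%:~R *: coordf w i) (b`_k *~ a k) =
      (a k)%:~R * ((\det Q0)%:~R * coord w i b`_k).
    by rewrite -[b`_k *~ _]scaler_int linearZ /= scale_lfunE coordfE.
  rewrite rpredM ?intr_int //; have /matrixP/(_ i k) := adjE.
  by rewrite !mxE => ->; exact: intr_int.
have -> : (absz (\det Q0))%:R = (sgz (\det Q0))%:~R * (\det Q0)%:~R :> R.
  by rewrite [LHS]pmulrn abszEsg intrM.
by rewrite -scalerA; exact: dual_latticeZ.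
Qed.

End Coordinates.

(** * Asymptotic expansions at the origin *)

Section Expansions.
Variables (C : numFieldType) (m : nat).
Implicit Types (f g : ('I_m -> C) -> C) (phi gam : multinom m -> C).

Definition has_expansion f phi :=
  forall K, vanishes K (fun z => f z - meval z (truncation K phi)).

Lemma expansion_coef f phi K (p : mpoly m C) : has_expansion f phi ->
  vanishes K (fun z => f z - meval z p) ->
  forall a, (mdeg a < K)%N -> mcoeff a p = phi a.
Proof.
move=> hf hp a aK; have h : vanishes K (fun z => meval z (p - truncation K phi)).
  apply: (vanishes_eq _ (vanishesB (hf K) hp)); exists 1 => // z t _ _ _.
  by rewrite mevalB; ring.
have /eqP := vanishes_mcoeff h aK.
by rewrite mcoeffB mcoeff_truncation aK subr_eq0 => /eqP.
Qed.

Lemma expansion_unique f g phi gam : near0 (fun z => f z = g z) ->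
  has_expansion f phi -> has_expansion g gam -> phi =1 gam.
Proof.
move=> fg hf hg a; have := expansion_coef (K := (mdeg a).+1) hf _ (ltnSn _).
rewrite -(expansion_coef hg (hg (mdeg a).+1) (ltnSn _)) => -> //.
apply: (vanishes_eq _ (hg (mdeg a).+1)); case: fg => r r0 h.
by exists r => // z t t0 tr zt; rewrite (h z t).
Qed.

Lemma expansionM f g phi gam : has_expansion f phi -> has_expansion g gam ->
  has_expansion (fun z => f z * g z) (fmul phi gam).
Proof.
move=> hf hg K; set p := truncation K phi; set q := truncation K gam.
have vq : vanishes 0 (fun z => meval z q) by exact: vanishes_mpoly.
have vf : vanishes 0 f.
  apply: (vanishes_eq _ (vanishesD (vanishesW (leq0n K) (hf K))
    (vanishes_mpoly (p := p) (K := 0) _))) => //.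
  by exists 1 => // z t *; rewrite subrK.
have h1 := vanishesM vf (hg K); have h2 := vanishesM (hf K) vq.
rewrite add0n in h1; rewrite addn0 in h2.
have h3 : vanishes K (fun z => meval z (p * q - truncation K (fmul phi gam))).
  apply: vanishes_mpoly => a; rewrite mcoeff_msupp mcoeffB mcoeff_truncation.
  by case: ltnP => // aK; rewrite -fmulE // subrr eqxx.
apply: (vanishes_eq _ (vanishesD (vanishesD h1 h2) h3)); exists 1 => // z t *.
by rewrite mevalB mevalM -/p -/q; ring.
Qed.

Lemma expansion_mpolyX a :
  has_expansion (fun z => meval z (mpolyX C a)) (fun b => (a == b)%:R).
Proof.
move=> K; have h : vanishes K (fun z => meval z
    (mpolyX C a - truncation K (fun b => (a == b)%:R))).
  apply: vanishes_mpoly => b; rewrite mcoeff_msupp mcoeffB mcoeff_truncation.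
  by case: ltnP => // bK; rewrite mcoeffX subrr eqxx.
by apply: (vanishes_eq _ h); exists 1 => // z t *; rewrite mevalB.
Qed.

(** Two approximations agree below the smaller of their orders, so the coefficient of [a] can be
    read off the one of order [(mdeg a).+1], the first that determines it. *)
Lemma exists_expansion f (P : nat -> mpoly m C) :
  (forall K, vanishes K (fun z => f z - meval z (P K))) ->
  has_expansion f (fun a => mcoeff a (P (mdeg a).+1)).
Proof.
move=> hP K; pose phi a := mcoeff a (P (mdeg a).+1).
have h : vanishes K (fun z => meval z (P K - truncation K phi)).
  apply: vanishes_mpoly => a; rewrite mcoeff_msupp mcoeffB mcoeff_truncation.
  case: ltnP => // aK; rewrite /phi.
  have h : vanishes (mdeg a).+1 (fun z => meval z (P (mdeg a).+1 - P K)).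
    apply: (vanishes_eq _ (vanishesB (vanishesW aK (hP K)) (hP _))).
    by exists 1 => // z t *; rewrite mevalB; ring.
  have /eqP := vanishes_mcoeff h (ltnSn _).
  by rewrite mcoeffB subr_eq0 => /eqP->; rewrite subrr eqxx.
apply: (vanishes_eq _ (vanishesD (hP K) h)); exists 1 => // z t *.
by rewrite mevalB; ring.
Qed.

Lemma expansion_at0 f phi : has_expansion f phi -> phi mnm0 = f (fun=> 0).
Proof.
move=> /(_ 1%N)/vanishesP[M [r [M0 r0 r1 h]]].
set D := f (fun=> 0) - phi mnm0.
suff /eqP : D = 0 by rewrite subr_eq0 => /eqP.
have DE : D%:P = 0.
  apply: (@small_poly_eq0 _ 1 D%:P M r) => // [|t t0 tr].
    by rewrite size_polyC; case: eqP.
  have := h (fun=> 0) t t0 tr; rewrite normr0 => /(_ (fun _ => ltW t0)).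
  rewrite hornerC /D; congr (`|_ - _| <= _).
  have m0 : (mdeg (@mnm0 m) < 1)%N by rewrite mdeg0.
  rewrite /truncation raddf_sum /= (bigD1 (BMultinom m0)) //= big1 ?addr0 => [|b bb].
    rewrite mevalZ mevalX big1 ?mulr1 // => i _.
    by rewrite mnm0E expr0.
  have := bmdeg b; rewrite ltnS leqn0 mdeg_eq0 => /eqP b0.
  by case/eqP: bb; apply/val_inj.
by have := congr1 (fun p : {poly C} => p`_0) DE; rewrite coefC coef0.
Qed.

Lemma vanishes_comp k K (g : ('I_k -> C) -> C) (y : 'I_k -> ('I_m -> C) -> C) :
  vanishes K g -> (forall i, vanishes 1 (y i)) ->
  vanishes K (fun z => g (fun i => y i z)).
Proof.
move=> /vanishesP[M [r [M0 r0 r1 h]]] hy.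
have /choice[B hB] : forall i, exists Br : C * C, [/\ 0 <= Br.1, 0 < Br.2 &
    forall z t, 0 < t -> t < Br.2 -> (forall j, `|z j| <= t) -> `|y i z| <= Br.1 * t].
  by move=> i; have /vanishesP[N [s [N0 s0 _ hs]]] := hy i; exists (N, s).
pose N := 1 + \sum_i (B i).1.
have N0 : 0 < N by rewrite ltr_pwDl // sumr_ge0 // => i _; case: (hB i).
have [s s0 hs] : exists2 s : C, 0 < s & forall i, s <= (B i).2.
  pose D := \sum_i (B i).2^-1.
  have D0 i : 0 <= (B i).2^-1 by rewrite invr_ge0 ltW //; case: (hB i).
  (* This lies below all the radii at once; summing inverses avoids the minimum of a family. *)
  exists (1 + D)^-1; first by rewrite invr_gt0 ltr_pwDl // sumr_ge0.
  move=> i; have Bi : 0 < (B i).2 by case: (hB i).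
  rewrite -[leRHS]invrK lef_pV2 ?posrE ?invr_gt0 //; last first.
    by rewrite ltr_pwDl // sumr_ge0.
  by rewrite /D (bigD1 i) //= addrCA lerDl addr_ge0 // sumr_ge0.
pose s' := s * (r / N) / (s + r / N).
have rN : 0 < r / N by rewrite divr_gt0.
exists (M * N ^+ K), s'; split.
  by apply: divr_gt0; [exact: mulr_gt0|exact: addr_gt0].
have s's : s' <= s.
  by rewrite ler_pdivrMr ?addr_gt0 // ler_pM2l // lerDr ltW.
have s'r : s' <= r / N.
  by rewrite ler_pdivrMr ?addr_gt0 // mulrC ler_pM2l // lerDl ltW.
move=> z t t0 ts' zt.
have tNr : t * N < r by rewrite -ltr_pdivlMr //; exact: lt_le_trans s'r.
have tN0 : 0 < t * N by rewrite mulr_gt0.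
have yle i : `|y i z| <= t * N.
  have [B0 _ hi] := hB i.
  apply: le_trans (hi z t t0 (lt_le_trans ts' (le_trans s's (hs i))) zt) _.
  rewrite mulrC ler_pM2l // /N (bigD1 i) //= addrCA lerDl addr_ge0 //.
  by rewrite sumr_ge0 // => j _; case: (hB j).
by have := h _ _ tN0 tNr yle; rewrite exprMn mulrA mulrAC.
Qed.

End Expansions.

(** * Monomial parametrization and the torus-fixed point *)

Section Chart.
Variables (R : realType) (V : vectType R) (W sigma : set V) (n d : nat).
Variable w : n.-tuple V.
Hypothesis tc : toric_coordinates W sigma d w.
Local Notation C := (R[i]).
Local Notation S := (dual_monoid W sigma).

Definition chi (x : 'rV[int]_n) : 'Hom(V, R^o) :=
  \sum_(i < n) (x 0 i)%:~R *: coordf w i.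

Lemma chiE x (i : 'I_n) : chi x w`_i = (x 0 i)%:~R :> R.
Proof.
rewrite /chi sum_lfunE (bigD1 i) //= big1 ?addr0 => [|j /negPf ji].
  rewrite scale_lfunE coordfE coord_free ?(basis_free (tc_basis tc)) //.
  by rewrite eqxx; exact: mulr1.
rewrite scale_lfunE coordfE coord_free ?(basis_free (tc_basis tc)) //.
by rewrite eq_sym ji; exact: mulr0.
Qed.

Lemma chi_ext (u v : 'Hom(V, R^o)) :
  (forall i : 'I_n, u w`_i = v w`_i :> R) -> u = v.
Proof.
move=> h; rewrite (dual_basisE u (tc_basis tc)) (dual_basisE v (tc_basis tc)).
by apply: eq_bigr => i _; rewrite h.
Qed.

Lemma chiD x y : chi (x + y) = chi x + chi y.
Proof. by apply: chi_ext => i; rewrite add_lfunE !chiE mxE intrD. Qed.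

Lemma chi0 : chi 0 = 0.
Proof. by apply: chi_ext => i; rewrite chiE mxE lfunE. Qed.

Lemma chiB x y : chi (x - y) = chi x - chi y.
Proof.
by apply: chi_ext => i; rewrite add_lfunE opp_lfunE !chiE !mxE rmorphB.
Qed.

Definition exponent_lattice : set 'rV[int]_n := [set x | dual_lattice W (chi x)].
Local Notation Lam := exponent_lattice.

(** The floor is exact on the dual lattice, and on the monoid the absolute value inside [mz] is
    harmless too; elsewhere the result carries no meaning. *)
Definition exponent (u : 'Hom(V, R^o)) : multinom n :=
  mz (\row_i Num.floor (u w`_i : R)).

Lemma chi_floor u : dual_lattice W u ->
  chi (\row_i Num.floor (u w`_i : R)) = u.
Proof.
by move=> hu; apply: chi_ext => i; rewrite chiE mxE floorK // (tc_int tc).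
Qed.

Lemma chi_exponent u : S u -> chi (ev (exponent u)) = u.
Proof.
move=> /(tc_monoid tc)[hu pos]; rewrite /exponent ev_mz ?chi_floor // => i.
by rewrite mxE floor_ge0.
Qed.

Lemma exponent_chi a : exponent (chi (ev a)) = a.
Proof.
rewrite -[RHS]mz_ev; congr mz; apply/rowP => i.
by rewrite !mxE chiE mxE intrKfloor.
Qed.

Lemma monoid_chi a : S (chi (ev a)) <-> Lam (ev a).
Proof.
split=> [/(tc_monoid tc)[]//|h]; apply/(tc_monoid tc); split=> // i.
by rewrite chiE mxE ler0z.
Qed.

Lemma exponent_lattice_monoid u : S u -> Lam (ev (exponent u)).
Proof. by move=> Su; apply/monoid_chi; rewrite chi_exponent. Qed.

Lemma monoidD u v : S u -> S v -> S (u + v).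
Proof.
move=> /(tc_monoid tc)[hu pu] /(tc_monoid tc)[hv pv]; apply/(tc_monoid tc).
split=> [|i]; first exact: dual_latticeD.
by rewrite add_lfunE addr_ge0 ?pu ?pv.
Qed.

Lemma monoid0 : S 0.
Proof.
apply/(tc_monoid tc); split=> [|i]; first exact: dual_lattice0.
by rewrite lfunE.
Qed.

Lemma exponent0 : exponent 0 = mnm0.
Proof. by rewrite -(exponent_chi mnm0) ev0 chi0. Qed.

Lemma exponentD u v : S u -> S v -> exponent (u + v) = exponent u :+ exponent v.
Proof.
move=> Su Sv; rewrite -[RHS]exponent_chi evD chiD !chi_exponent //.
Qed.

Lemma index_lattice_exponent : index_lattice Lam d.
Proof.
split.
- by rewrite /exponent_lattice /= chi0; exact: dual_lattice0.
- by move=> x y hx hy; rewrite /exponent_lattice /= chiB; exact: dual_latticeB.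
- exact: (tc_gt0 tc).
- move=> i; rewrite /exponent_lattice /=.
  have -> : chi (ev (mnm_muln (mnm1 i) d)) = d%:R *: coordf w i.
    apply: chi_ext => j; rewrite chiE mxE scale_lfunE coordfE.
    rewrite coord_free ?(basis_free (tc_basis tc)) // mulmnE mnm1E.
    by rewrite mulnC eq_sym -pmulrn natrM.
  exact: (tc_axis tc).
- move=> i; have [u hu ui] := tc_prim tc i.
  exists (\row_j Num.floor (u w`_j : R)); first by rewrite /exponent_lattice /= chi_floor.
  by rewrite mxE ui floor1.
Qed.

(** The map from [C^n] to the variety induced by the inclusion of the monoid in [N^n];
    geometrically, the quotient map by a finite group. *)
Definition toric_point (z : 'I_n -> C) : monomial_values V :=
  fun u => if `[< S u >] then meval z (mpolyX C (exponent u)) else 0.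

Lemma toric_pointE z a : Lam (ev a) ->
  toric_point z (chi (ev a)) = meval z (mpolyX C a).
Proof.
by move=> /monoid_chi Sa; rewrite /toric_point asboolT // exponent_chi.
Qed.

Lemma toric_point_toric z : toric_variety W sigma (toric_point z).
Proof.
split.
- rewrite /toric_point asboolT; last exact: monoid0.
  by rewrite exponent0 mpolyX0 meval1.
- move=> u v Su Sv; rewrite /toric_point !asboolT //; last exact: monoidD.
  by rewrite exponentD // mpolyXD mevalM.
- by move=> u Su; rewrite /toric_point asboolF.
Qed.

Definition fixed_point : monomial_values V := fun u => (u == 0)%:R.

Lemma fixed_point_toric : fixed_point = toric_point (fun=> 0).
Proof.
apply/funext => u; rewrite /fixed_point /toric_point.
have [->|u0] := eqVneq u 0.
  rewrite asboolT; last exact: monoid0.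
  by rewrite exponent0 mpolyX0 meval1.
case: asboolP => // Su; rewrite mevalX.
have [i ui] : exists i, exponent u i != 0%N.
  apply/existsP; apply: contraNT u0; rewrite negb_exists => /forallP h.
  rewrite -(chi_exponent Su) (_ : exponent u = mnm0) ?ev0 ?chi0 //.
  by apply/mnmP => i; rewrite mnm0E; apply/eqP; have := h i; rewrite negbK.
by rewrite (bigD1 i) //= expr0n (negPf ui) mul0r.
Qed.

Lemma torus_monoid u : dual_monoid W [set 0] u <-> dual_lattice W u.
Proof.
split=> [[]//|h]; split=> // v ->; rewrite linear0 //.
Qed.

(** The torus element with values [2 ^ deg u] multiplies the coordinate [u] by a factor greater than
    1 when [u] is a nonzero element of the monoid; at a fixed point that coordinate is therefore
    0. *)
Lemma torus_fixed x : toric_variety W sigma x ->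
  (forall t, torus W t -> torus_act t x = x) -> x = fixed_point.
Proof.
move=> [x0 xM xS] hx.
pose deg (u : 'Hom(V, R^o)) : int := \sum_(i < n) Num.floor (u w`_i : R).
pose t : monomial_values V := fun u => if `[< dual_lattice W u >] then exprz (2 : C) (deg u) else 0.
have degD u v : dual_lattice W u -> dual_lattice W v -> deg (u + v) = deg u + deg v.
  move=> hu hv; rewrite /deg -big_split; apply: eq_bigr => i _.
  by rewrite add_lfunE floorDrz // (tc_int tc).
have tT : torus W t.
  split.
  - rewrite /t asboolT; last exact: dual_lattice0.
    by rewrite /deg big1 ?expr0z // => i _; rewrite lfunE floor0.
  - move=> u v /torus_monoid hu /torus_monoid hv; rewrite /t !asboolT //.
      by rewrite degD // expfzDr // pnatr_eq0.
    exact: dual_latticeD.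
  - by move=> u hu; rewrite /t asboolF // => hu'; apply: hu; apply/torus_monoid.
apply/funext => u; rewrite /fixed_point; have [->//|u0] := eqVneq u 0.
case: (pselect (S u)) => [Su|/xS //].
have := congr1 (fun y : monomial_values V => y u) (hx t tT).
have [hu pu] := (tc_monoid tc u).1 Su.
rewrite /torus_act /t asboolT // => /eqP; rewrite -subr_eq0 -[X in _ - X]mul1r -mulrBl.
rewrite mulf_eq0 => /orP[|/eqP//]; rewrite subr_eq0 => /eqP t1.
suff : 1 < exprz (2 : C) (deg u) by rewrite t1 ltxx.
have fl0 (i : 'I_n) : 0 <= Num.floor (u w`_i : R) by rewrite floor_ge0.
have [i ui] : exists i : 'I_n, 0 < Num.floor (u w`_i : R).
  apply/existsP; apply: contraNT u0; rewrite negb_exists => /forallP h.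
  apply/eqP/chi_ext => i; rewrite lfunE /= -(floorK (tc_int tc i hu)).
  rewrite (_ : Num.floor _ = 0) //; apply: le_anti; rewrite fl0 andbT leNgt.
  exact: h.
have d0 : 0 < deg u by rewrite /deg (bigD1 i) //= ltr_wpDr // sumr_ge0.
case: (deg u) d0 => // -[//|k] _.
by rewrite -exprnP exprn_egt1 // ltr1n.
Qed.

(** The neutral element of the torus shows that the orbit is that of [o] itself, so [o] is fixed by
    the whole torus. *)
Lemma closed_orbit_fixed o : closed_orbit W sigma [set o] -> o = fixed_point.
Proof.
move=> [[x xT xO] _].
have one : torus W (fun u => if `[< dual_lattice W u >] then 1 else 0).
  split.
  - by rewrite asboolT //; exact: dual_lattice0.
  - move=> u v /torus_monoid hu /torus_monoid hv; rewrite !asboolT ?mulr1 //.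
    exact: dual_latticeD.
  - by move=> u hu; rewrite asboolF // => hu'; apply: hu; apply/torus_monoid.
have act t : torus W t -> torus_act t x = o.
  by move=> tT; suff : [set o] (torus_act t x) by []; rewrite xO; exists t.
have xo : x = o.
  rewrite -(act _ one); apply/funext => u; rewrite /torus_act.
  case: asboolP => [_|hu]; first by rewrite mul1r.
  by rewrite mul0r; have [_ _ ->] := xT; rewrite // => -[].
rewrite -xo; apply: torus_fixed => // t /act.
by rewrite xo.
Qed.

End Chart.

(** * Formal expansion of germs *)

Section HolomorphicExpansion.
Variables (R : realType) (V : vectType R) (W sigma : set V) (n d : nat).
Variable w : n.-tuple V.
Hypothesis tc : toric_coordinates W sigma d w.
Local Notation C := (R[i]).
Local Notation S := (dual_monoid W sigma).
Local Notation Lam := (exponent_lattice W w).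
Local Notation o := (@fixed_point R V).

(** A family of points with [m] parameters, tending to the fixed point to first order in every
    monomial. Three kinds are used: the parametrization, its image under a germ, and a constant
    family. *)
Definition small_arc m (q : ('I_m -> C) -> monomial_values V) :=
  near0 (fun z => toric_variety W sigma (q z)) /\
  forall u, vanishes 1 (fun z => (q z u : C) - (o u : C)).

Lemma near0_filter m : Filter (@near0 C m : set_system ('I_m -> C)).
Proof.
split; first by exists 1.
  by move=> P Q hP hQ; exact: near0_and.
by move=> P Q PQ [r r0 h]; exists r => // z t t0 tr zt; apply: PQ; exact: h zt.
Qed.

(** The topology is that of pointwise convergence, so it suffices to make each monomial small
    separately. *)
Lemma near0_arc m (q : ('I_m -> C) -> monomial_values V)
    (P : set (monomial_values V)) : small_arc q -> nbhs o P ->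
  near0 (fun z => P (q z)).
Proof.
move=> [_ hq] oP; pose FF := near0_filter m.
have cv : {ptws, q @ (@near0 C m : set_system ('I_m -> C)) --> o}.
  apply/cvg_sup => u A; rewrite (@nbhsE (Topological.Pack _)) => -[B [[G oG GB] Bo] BA].
  have Gu : nbhs (o u) G.
    by apply: open_nbhs_nbhs; split=> //; move: Bo; rewrite -GB.
  have /nbhs_ballP[e /= e0 eG] := Gu.
  have /vanishesP[M [r [M0 r0 r1 h]]] := hq u.
  have M1 : 0 < M + 1 by rewrite ltr_wpDl.
  have eM : 0 < e / (M + 1) by rewrite divr_gt0.
  pose s := r * (e / (M + 1)) / (r + e / (M + 1)).
  have D0 : 0 < r + e / (M + 1) by rewrite addr_gt0.
  exists s; first by rewrite divr_gt0 // mulr_gt0.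
  have sr : s <= r by rewrite ler_pdivrMr // ler_pM2l // lerDr ltW.
  have se : s <= e / (M + 1) by rewrite ler_pdivrMr // mulrC ler_pM2l // lerDl ltW.
  move=> z t t0 ts zt; apply: BA; rewrite -GB; apply: eG.
  rewrite -ball_normE /= distrC.
  apply: le_lt_trans (h z t t0 (lt_le_trans ts sr) zt) _.
  rewrite expr1; apply: (@le_lt_trans _ _ (t * (M + 1))).
    by rewrite mulrC ler_pM2l // lerDl ler01.
  by rewrite -ltr_pdivlMr //; exact: lt_le_trans se.
exact: cv P oP.
Qed.

Lemma toric_monomial_exp x (k : nat) u : toric_variety W sigma x -> S u ->
  S (u *+ k) /\ x (u *+ k) = x u ^+ k.
Proof.
move=> [x0 xM _] Su; elim: k => [|k [IHS IH]].
  by rewrite mulr0n expr0; split; [exact: (monoid0 tc)|].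
by rewrite mulrS exprS xM // IH; split=> //; exact: (monoidD tc).
Qed.

Lemma toric_monomial_prod x N (mm : 'I_N -> 'Hom(V, R^o)) (k : 'I_N -> nat) :
  toric_variety W sigma x -> (forall i, S (mm i)) ->
  S (\sum_i mm i *+ k i) /\
  x (\sum_i mm i *+ k i) = \prod_i x (mm i) ^+ k i.
Proof.
move=> hx hS; apply: (big_rec2 (fun u c => S u /\ x u = c)).
  by have [x0 _ _] := hx; split; [exact: (monoid0 tc)|].
move=> i u c _ [Su <-]; have [Sk <-] := toric_monomial_exp (k i) hx (hS i).
have [_ xM _] := hx; split; first exact: (monoidD tc).
exact: xM.
Qed.

(** Products of the monomials of the embedding are again monomials of the variety, which turns
    truncations of the power series of [F] into finite sums over the monoid. These sums depend on
    [f] only, not on the family [q]. *)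
Lemma holomorphic_expansion (f : monomial_values V -> Cplx R) :
  holomorphic_at W sigma f o ->
  exists Q : nat -> seq (C * multinom n),
    (forall K ca, ca \in Q K -> Lam (ev ca.2)) /\
    forall m (q : ('I_m -> C) -> monomial_values V), small_arc q ->
    forall K, vanishes K (fun z => (f (q z) : C) -
      \sum_(ca <- Q K) ca.1 * (q z (chi w (ev ca.2)) : C)).
Proof.
move=> [N [mm [F [hS /analytic_expansion[c hc] hF]]]].
(* A coordinate with [mm i = 0] is constantly 1, so its increment is 0 and the terms that use it are
   dropped; the other coordinates vanish at the fixed point and equal their increments. *)
pose ok (k : multinom N) := `[< forall i, mm i = 0 -> k i = 0%N >].
pose cc (k : multinom N) := if ok k then c k else 0.
pose u (k : multinom N) := \sum_i mm i *+ k i.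
have uS k : S (u k).
  have [] := toric_monomial_prod k (toric_point_toric tc (fun=> 0)) hS.
  by [].
pose Q K := [seq (cc k, exponent w (u k)) | k : bmultinom N K].
exists Q; split=> [K ca /mapP[k _ ->]|m q hq K].
  exact: (exponent_lattice_monoid tc (uS k)).
pose y i (z : 'I_m -> C) : C := (q z (mm i) : C) - (o (mm i) : C).
have hy i : vanishes 1 (y i) by exact: hq.2.
have h1 := vanishes_comp (hc K) hy.
apply: (vanishes_eq _ h1).
have [r r0 h2] := near0_and hq.1 (near0_arc hq hF).
exists r => // z t t0 tr zt; have [qT h3] := h2 z t t0 tr zt.
rewrite (h3 qT); congr (_ - _).
  by congr F; apply/rowP => i; rewrite !mxE /y addrC subrK.
rewrite /truncation raddf_sum /= /Q big_map big_enum /=; apply: eq_bigr => k _.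
rewrite mevalZ mevalX (chi_exponent tc (uS k)).
have [_ ->] := toric_monomial_prod k qT hS.
rewrite /cc /ok; case: asboolP => [kok|/existsNP[i /not_implyP[mi /eqP ki]]].
  congr (_ * _); apply: eq_bigr => i _; rewrite /y /fixed_point.
  have [mi|mi] := eqVneq (mm i) 0; last by rewrite subr0.
  by rewrite (kok i mi) !expr0.
rewrite mul0r (bigD1 i) //= /y /fixed_point mi eqxx.
have [-> _ _] := qT; rewrite subrr expr0n (negPf ki) mul0r mulr0 //.
Qed.

Lemma toric_point_arc : small_arc (@toric_point R V W sigma n w).
Proof.
split; first by exists 1 => // z *; exact: (toric_point_toric tc).
move=> u; have [->|u0] := eqVneq u 0.
  apply: (vanishes_eq _ (vanishes0 C n 1)); exists 1 => // z *.
  have [-> _ _] := toric_point_toric tc z.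
  by rewrite /fixed_point eqxx subrr.
rewrite /fixed_point (negPf u0) /toric_point.
case: asboolP => Su; last first.
  by apply: (vanishes_eq _ (vanishes0 C n 1)); exists 1 => // z *; rewrite subr0.
have := vanishes_mpolyX C (exponent w u) => h.
apply: (vanishes_eq _ (vanishesW _ h)); first by exists 1 => // z *; rewrite subr0.
rewrite lt0n mdeg_eq0; apply: contra u0 => /eqP e0.
by rewrite -(chi_exponent tc Su) e0 ev0 (chi0 tc).
Qed.

End HolomorphicExpansion.

Lemma vanishes_const (C : numFieldType) m (c : C) :
  vanishes 1 (fun _ : 'I_m -> C => c) -> c = 0.
Proof.
move=> h; have h' : vanishes 1 (fun z => meval z (mpolyC m c)).
  by apply: (vanishes_eq _ h); exists 1 => // z *; rewrite mevalC.
have := vanishes_mcoeff h' (a := mnm0); rewrite mdeg0 mcoeffC eqxx mulr1.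
exact.
Qed.

Section Germ.
Variables (R : realType) (V V' : vectType R).
Local Notation C := (R[i]).
Variables (W sigma : set V) (n d : nat) (w : n.-tuple V).
Hypothesis tc : toric_coordinates W sigma d w.
Variables (W' sigma' : set V') (n' d' : nat) (w' : n'.-tuple V').
Hypothesis tc' : toric_coordinates W' sigma' d' w'.
Local Notation Lam := (exponent_lattice W w).
Local Notation Lam' := (exponent_lattice W' w').
Local Notation o := (@fixed_point R V).
Local Notation o' := (@fixed_point R V').
Local Notation pt := (@toric_point R V W sigma n w).
Variables (U : set (monomial_values V)) (U' : set (monomial_values V')).
Variable phi : monomial_values V -> monomial_values V'.
Hypotheses (hU : open_nbhs o U)
  (hphi : holomorphic_map W sigma U W' sigma' U' phi) (phio : phi o = o').

Let oT : (toric_variety W sigma `&` U) o.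
Proof.
split; last by case: hU.
by rewrite (fixed_point_toric tc); exact: (toric_point_toric tc).
Qed.

(** To first order each coordinate of [phi] along [q] is a finite sum of monomials, hence tends to a
    constant [c]; the point is to identify [c]. *)
Lemma germ_arc m (q : ('I_m -> C) -> monomial_values V) :
  small_arc W sigma q -> small_arc W' sigma' (fun z => phi (q z)).
Proof.
move=> hq; have T' : near0 (fun z => toric_variety W' sigma' (phi (q z))).
  have [r r0 h] := near0_and hq.1 (near0_arc hq (open_nbhs_nbhs hU)).
  by exists r => // z t t0 tr zt; have [[]] := hphi (h z t t0 tr zt).
split=> // u; case: (pselect (dual_monoid W' sigma' u)) => [Su|Su]; last first.
  apply: (vanishes_eq _ (vanishes0 C m 1)); have [r r0 h] := T'.
  exists r => // z t t0 tr zt; have [_ _ ->] := h z t t0 tr zt; rewrite //.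
  rewrite /fixed_point; case: eqP => [u0|]; last by rewrite subr0.
  by case: Su; rewrite u0; exact: (monoid0 tc').
have [Q [QL hQ]] := holomorphic_expansion tc ((hphi oT).2 u Su).
pose c := \sum_(ca <- Q 1%N) ca.1 * (o (chi w (ev ca.2)) : C).
have h1 : vanishes 1 (fun z => (phi (q z) u : C) - c).
  have h2 : vanishes 1 (fun z => \sum_(ca <- Q 1%N)
      ca.1 * ((q z (chi w (ev ca.2)) : C) - (o (chi w (ev ca.2)) : C))).
    by apply: vanishes_sum => ca _; apply: vanishesZ; exact: hq.2.
  apply: (vanishes_eq _ (vanishesD (hQ _ _ hq 1%N) h2)); exists 1 => // z t *.
  have -> : \sum_(ca <- Q 1%N) ca.1 * ((q z (chi w (ev ca.2)) : C) -
      (o (chi w (ev ca.2)) : C)) =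
      \sum_(ca <- Q 1%N) ca.1 * (q z (chi w (ev ca.2)) : C) - c.
    by rewrite -sumrB; apply: eq_bigr => ca _; rewrite mulrBr.
  by rewrite addrA subrK.
suff -> : (o' u : C) = c by [].
(* On the constant family without parameters the difference of the two constants is bounded by a
   multiple of [t], hence zero. *)
have oarc : small_arc W sigma (fun _ : 'I_0 -> C => o).
  split; first by exists 1 => // *; exact: oT.1.
  move=> v; apply: (vanishes_eq _ (vanishes0 C 0 1)).
  by exists 1 => // *; rewrite subrr.
have := hQ _ _ oarc 1%N; rewrite phio -/c => h3.
by apply/eqP; rewrite -subr_eq0; apply/eqP/(vanishes_const h3).
Qed.

Let f u (z : 'I_n -> C) : C := phi (pt z) (chi w' (ev u)).

(** [Phi] gives the coefficients along the parametrization only. The finite sums [Q] of monomials of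
    the variety are kept as well, because they can be evaluated along the family produced by the
    inverse germ. *)
Lemma germ_expansion : exists (Phi : multinom n' -> multinom n -> C)
    (Q : multinom n' -> nat -> seq (C * multinom n)), forall u, Lam' (ev u) ->
  [/\ has_expansion (f u) (Phi u),
      forall K ca, ca \in Q u K -> Lam (ev ca.2),
      forall K a, (mdeg a < K)%N -> \sum_(ca <- Q u K | ca.2 == a) ca.1 = Phi u a
    & forall m (q : ('I_m -> C) -> monomial_values V), small_arc W sigma q ->
      forall K, vanishes K (fun z => (phi (q z) (chi w' (ev u)) : C) -
        \sum_(ca <- Q u K) ca.1 * (q z (chi w (ev ca.2)) : C))].
Proof.
have /choice[Q hQ] : forall u, exists Q : nat -> seq (C * multinom n),
    Lam' (ev u) -> (forall K ca, ca \in Q K -> Lam (ev ca.2)) /\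
    forall m (q : ('I_m -> C) -> monomial_values V), small_arc W sigma q ->
    forall K, vanishes K (fun z => (phi (q z) (chi w' (ev u)) : C) -
      \sum_(ca <- Q K) ca.1 * (q z (chi w (ev ca.2)) : C)).
  move=> u; case: (pselect (Lam' (ev u))) => [Lu|]; last by exists (fun=> [::]).
  have Su : dual_monoid W' sigma' (chi w' (ev u)) by exact/(monoid_chi tc').
  by have [Q hQ] := holomorphic_expansion tc ((hphi oT).2 _ Su); exists Q.
pose P u K : mpoly n C := \sum_(ca <- Q u K) ca.1 *: mpolyX C ca.2.
exists (fun u a => mcoeff a (P u (mdeg a).+1)), Q => u Lu.
have [QL hq] := hQ u Lu.
have hP K : vanishes K (fun z => f u z - meval z (P u K)).
  apply: (vanishes_eq _ (hq _ _ (toric_point_arc tc) K)); exists 1 => // z *.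
  have -> : meval z (P u K) = \sum_(ca <- Q u K) ca.1 * (pt z (chi w (ev ca.2)) : C).
    rewrite /P raddf_sum /= big_seq [RHS]big_seq.
    apply: eq_bigr => ca /QL Lca; rewrite mevalZ; congr (_ * _).
    exact/esym/(toric_pointE tc).
  by [].
have hE := exists_expansion hP.
split=> // K a aK; rewrite -(expansion_coef hE (hP K) aK) /P raddf_sum /=.
rewrite big_mkcond /=; apply: eq_bigr => ca _; rewrite mcoeffZ mcoeffX.
by case: eqP; rewrite ?mulr1 ?mulr0.
Qed.

(** The points [phi (pt z)] are monoid morphisms; uniqueness of expansions passes this on to the
    coefficients. *)
Lemma germ_formal_hom (Phi : multinom n' -> multinom n -> C)
    (Q : multinom n' -> nat -> seq (C * multinom n)) :
  (forall u, Lam' (ev u) -> [/\ has_expansion (f u) (Phi u),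
     forall K ca, ca \in Q u K -> Lam (ev ca.2)
   & forall K a, (mdeg a < K)%N ->
     \sum_(ca <- Q u K | ca.2 == a) ca.1 = Phi u a]) ->
  formal_hom Lam' Lam Phi.
Proof.
move=> h; have hL' := index_lattice_exponent tc'.
have pT : near0 (fun z => toric_variety W' sigma' (phi (pt z))).
  exact: (germ_arc (toric_point_arc tc)).1.
have Suv u : Lam' (ev u) -> dual_monoid W' sigma' (chi w' (ev u)).
  by move=> Lu; exact/(monoid_chi tc').
split.
- move=> u a Lu Pa; have [_ QL hQ] := h u Lu.
  have [ca] : exists2 ca, ca \in Q u (mdeg a).+1 & ca.2 = a.
    apply/not_exists2P => nca; move/eqP: Pa; apply; rewrite -(hQ _ _ (ltnSn _)).
    rewrite big_seq_cond big1 // => ca /andP[caQ /eqP caE].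
    by have [] := nca ca.
  by move=> /QL Lca <-.
- move=> a; rewrite eq_sym.
  have L0 : Lam' (ev mnm0) by rewrite ev0; exact: (il0 hL').
  have [h0 _ _] := h mnm0 L0.
  apply: (expansion_unique _ h0 (expansion_mpolyX C mnm0)).
  have [r r0 hr] := pT; exists r => // z t t0 tr zt.
  have [e1 _ _] := hr z t t0 tr zt.
  by rewrite /f ev0 (chi0 tc') e1 mpolyX0 meval1.
- move=> u v Lu Lv; have Luv : Lam' (ev (u :+ v)) by rewrite evD; exact: (ilD hL').
  have [hu _ _] := h u Lu; have [hv _ _] := h v Lv; have [huv _ _] := h _ Luv.
  apply: (expansion_unique _ huv (expansionM hu hv)).
  have [r r0 hr] := pT; exists r => // z t t0 tr zt.
  have [_ hM _] := hr z t t0 tr zt.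
  by rewrite /f evD (chiD tc') hM //; exact: Suv.
move=> u Lu u0; have [hu _ _] := h u Lu.
rewrite (expansion_at0 hu) /f -(fixed_point_toric tc) phio /fixed_point.
case: eqP => // E; case/eqP: u0.
by rewrite -(exponent_chi tc' u) E (exponent0 tc').
Qed.

End Germ.

(** Along [psi] of the parametrization the sums [Q] approximate the monomial [u], as [phi] undoes
    [psi]; comparing the coefficients of [v] gives the matrix identity. *)
Lemma germ_formal_inverse (R : realType) (V V' : vectType R)
    (W sigma : set V) (n d : nat) (w : n.-tuple V)
    (W' sigma' : set V') (n' d' : nat) (w' : n'.-tuple V')
    (U : set (monomial_values V)) (U' : set (monomial_values V')) phi psi
    (Phi : multinom n' -> multinom n -> R[i])
    (Psi : multinom n -> multinom n' -> R[i]) Q :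
  toric_coordinates W sigma d w -> toric_coordinates W' sigma' d' w' ->
  open_nbhs (@fixed_point R V') U' ->
  holomorphic_map W' sigma' U' W sigma U psi ->
  psi (@fixed_point R V') = @fixed_point R V ->
  (forall y, (toric_variety W' sigma' `&` U') y -> phi (psi y) = y) ->
  formal_hom (exponent_lattice W w) (exponent_lattice W' w') Psi ->
  (forall u, exponent_lattice W' w' (ev u) ->
  [/\ forall K ca, ca \in Q u K -> exponent_lattice W w (ev ca.2),
      forall K a, (mdeg a < K)%N -> \sum_(ca <- Q u K | ca.2 == a) ca.1 = Phi u a
    & forall m (q : ('I_m -> R[i]) -> monomial_values V), small_arc W sigma q ->
      forall K, vanishes K (fun z => (phi (q z) (chi w' (ev u)) : R[i]) -
        \sum_(ca <- Q u K) ca.1 * (q z (chi w (ev ca.2)) : R[i]))]) ->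
  (forall a, exponent_lattice W w (ev a) ->
     has_expansion (fun z => psi (@toric_point R V' W' sigma' n' w' z)
       (chi w (ev a)) : R[i]) (Psi a)) ->
  formal_inverse (exponent_lattice W' w') Phi Psi.
Proof.
move=> tc tc' hU' hpsi psio phipsi hPsi hPhi hexp u v Lu.
have [QL hQ hq] := hPhi u Lu.
pose q z := psi (@toric_point R V' W' sigma' n' w' z).
have arc' := toric_point_arc tc'.
have arc : small_arc W sigma q by exact: (germ_arc tc' tc hU' hpsi psio arc').
have key K : (mdeg v < K)%N ->
    (u == v)%:R = \sum_(ca <- Q u K) ca.1 * Psi ca.2 v.
  move=> vK.
  have h1 : vanishes K (fun z => meval z (mpolyX R[i] u -
      \sum_(ca <- Q u K) ca.1 *: truncation K (Psi ca.2))).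
    have h2 : vanishes K (fun z => \sum_(ca <- Q u K | ca \in Q u K) ca.1 *
        ((q z (chi w (ev ca.2)) : R[i]) - meval z (truncation K (Psi ca.2)))).
      by apply: vanishes_sum => ca /QL Lca; apply: vanishesZ; exact: hexp.
    apply: (vanishes_eq _ (vanishesD (hq _ _ arc K) h2)).
    have [r r0 h] := near0_and arc'.1 (near0_arc arc' (open_nbhs_nbhs hU')).
    exists r => // z t t0 tr zt; have zT := h z t t0 tr zt.
    rewrite phipsi // (toric_pointE tc' z Lu) mevalB -big_seq.
    rewrite [meval z (\sum_(_ <- _) _)]raddf_sum /=.
    rewrite [X in _ + X = _](eq_bigr (fun ca => ca.1 * (q z (chi w (ev ca.2)) : R[i]) -
      ca.1 * meval z (truncation K (Psi ca.2)))); last by move=> ca _; exact: mulrBr.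
    rewrite sumrB addrA subrK; congr (_ - _); apply: eq_bigr => ca _.
    by rewrite mevalZ.
  have := vanishes_mcoeff h1 vK; rewrite mcoeffB mcoeffX raddf_sum /=.
  move/eqP; rewrite subr_eq0 => /eqP->; apply: eq_bigr => ca _.
  by rewrite mcoeffZ mcoeff_truncation vK.
(* The first bound makes [key] applicable, the second makes [Psi s v] vanish for [s] in the lattice
   of degree at least [N]. *)
pose N0 := maxn (mdeg v).+1 (n * d * (mdeg v).+1).+1.
exists N0 => N; rewrite geq_max => /andP[vN hN].
rewrite (key N vN).
rewrite (eq_bigr (fun s : bmultinom n N =>
  \sum_(ca <- Q u N | ca.2 == s) ca.1 * Psi ca.2 v)); last first.
  move=> s _; rewrite -(hQ N s (bmdeg s)) mulr_suml.
  by apply: eq_bigr => ca /eqP->.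
rewrite (exchange_big_dep xpredT) //= big_seq [RHS]big_seq.
apply: eq_bigr => ca /QL Lca; have [caN|caN] := ltnP (mdeg ca.2) N.
  rewrite (bigD1 (BMultinom caN)) //= big1 ?addr0 // => s /andP[/eqP E].
  by case/eqP; apply/val_inj.
rewrite (fh_order (index_lattice_exponent tc) hPsi Lca (leq_trans hN caN)) //.
by rewrite mulr0 big1.
Qed.

(** * Toric isomorphisms *)

Section Pullback.
Variables (R : realType) (V V' : vectType R).
Implicit Types (L : 'Hom(V', R^o) -> 'Hom(V, R^o)).

Definition pullback (W' sigma' : set V') L (x : monomial_values V) :
    monomial_values V' :=
  fun u => if `[< dual_monoid W' sigma' u >] then x (L u) else 0.

Lemma pullback_algebraic (W sigma : set V) (W' sigma' : set V') L :
  L 0 = 0 -> (forall u v, L (u + v) = L u + L v) ->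
  dual_monoid W' sigma' 0 ->
  (forall u v, dual_monoid W' sigma' u -> dual_monoid W' sigma' v ->
     dual_monoid W' sigma' (u + v)) ->
  (forall u, dual_monoid W' sigma' u -> dual_monoid W sigma (L u)) ->
  algebraic_map W sigma W' sigma' (pullback W' sigma' L).
Proof.
move=> L0 LD S0 SD SL; split=> [x [x0 xM xS]|f [k [c [m [hm hf]]]]].
  split; first by rewrite /pullback asboolT // L0.
    by move=> u v Su Sv; rewrite /pullback !asboolT ?LD ?xM //; auto.
  by move=> u Su; rewrite /pullback asboolF.
exists k, c, (fun i => L (m i)); split=> [i|x xT]; first exact: SL.
rewrite /= hf; last first.
  have [x0 xM xS] := xT; split; first by rewrite /pullback asboolT // L0.
    by move=> u v Su Sv; rewrite /pullback !asboolT ?LD ?xM //; auto.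
  by move=> u Su; rewrite /pullback asboolF.
by apply: eq_bigr => i _; rewrite /pullback asboolT.
Qed.

End Pullback.

Lemma pullback_iso (R : realType) (V V' : vectType R)
    (W sigma : set V) (W' sigma' : set V')
    (L : 'Hom(V', R^o) -> 'Hom(V, R^o)) (L' : 'Hom(V, R^o) -> 'Hom(V', R^o)) :
  (forall u v, L (u + v) = L u + L v) -> (forall u v, L' (u + v) = L' u + L' v) ->
  cancel L L' -> cancel L' L ->
  dual_monoid W sigma 0 -> dual_monoid W' sigma' 0 ->
  (forall u v, dual_monoid W sigma u -> dual_monoid W sigma v ->
     dual_monoid W sigma (u + v)) ->
  (forall u v, dual_monoid W' sigma' u -> dual_monoid W' sigma' v ->
     dual_monoid W' sigma' (u + v)) ->
  (forall u, dual_monoid W' sigma' u -> dual_monoid W sigma (L u)) ->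
  (forall u, dual_monoid W sigma u -> dual_monoid W' sigma' (L' u)) ->
  algebraic_iso W sigma W' sigma' (pullback W' sigma' L).
Proof.
move=> LD L'D LK L'K S0 S'0 SD S'D SL SL'.
have L0 : L 0 = 0 by apply: (addIr (L 0)); rewrite -LD !add0r.
have L'0 : L' 0 = 0 by apply: (addIr (L' 0)); rewrite -L'D !add0r.
split; first exact: pullback_algebraic.
exists (pullback W sigma L'); split; first exact: pullback_algebraic.
  move=> x [_ _ xS]; apply/funext => u; rewrite /pullback.
  case: asboolP => [Su|/xS->//]; rewrite asboolT ?L'K //; exact: SL'.
move=> x [_ _ xS]; apply/funext => u; rewrite /pullback.
by case: asboolP => [Su|/xS->//]; rewrite asboolT ?LK //; exact: SL.
Qed.

Section LinearExtension.
Variables (R : realType) (V V' : vectType R).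
Variables (W sigma : set V) (n d : nat) (w : n.-tuple V).
Hypothesis tc : toric_coordinates W sigma d w.
Variables (W' sigma' : set V') (n' d' : nat) (w' : n'.-tuple V').
Hypothesis tc' : toric_coordinates W' sigma' d' w'.
Local Notation Lam := (exponent_lattice W w).
Local Notation Lam' := (exponent_lattice W' w').
Variable nu : multinom n' -> multinom n.
Hypothesis nuL : forall u, Lam' (ev u) -> Lam (ev (nu u)).
Hypothesis nuD : forall u v, Lam' (ev u) -> Lam' (ev v) ->
  nu (u :+ v) = nu u :+ nu v.

(** The real-linear map that agrees with [nu] on the monoid. Unit vectors need not be in the
    lattice, so [nu] is evaluated at [d'] times them and the result divided by [d']. *)
Definition linear_extension (u : 'Hom(V', R^o)) : 'Hom(V, R^o) :=
  \sum_(i < n') (u w'`_i : R) *: (d'%:R^-1 *: chi w (ev (nu (axis i d')))).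
Local Notation E := linear_extension.

Lemma linear_extensionD u v : E (u + v) = E u + E v.
Proof.
rewrite /E -big_split; apply: eq_bigr => i _.
by rewrite add_lfunE scalerDl.
Qed.

Lemma linear_extensionZ c u : E (c *: u) = c *: E u.
Proof.
rewrite /E scaler_sumr; apply: eq_bigr => i _.
by rewrite scale_lfunE [RHS]scalerA.
Qed.

Let hL' := index_lattice_exponent tc'.

Let nu0 : nu mnm0 = mnm0.
Proof.
have L0 : Lam' (ev mnm0) by rewrite ev0; exact: (il0 hL').
have := nuD L0 L0; rewrite addm0 -[X in X = _]addm0.
by move/addmI/esym.
Qed.

Let nuMn u k : Lam' (ev u) -> nu (mnm_muln u k) = mnm_muln (nu u) k.
Proof.
move=> Lu; elim: k => [|k IH]; first by rewrite !mulm0n nu0.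
by rewrite !mulmS nuD ?IH // evMn; exact: (ilMn hL').
Qed.

Lemma linear_extension_chi a : Lam' (ev a) ->
  E (chi w' (ev a)) = chi w (ev (nu a)).
Proof.
move=> La; have d0 : d'%:R != 0 :> R by rewrite pnatr_eq0 -lt0n (il_gt0 hL').
have chiMn b k : chi w (ev (mnm_muln b k)) = k%:R *: chi w (ev b).
  elim: k => [|k IH]; first by rewrite mulm0n ev0 (chi0 tc) scale0r.
  by rewrite mulmS evD (chiD tc) IH -nat1r scalerDl scale1r.
apply: (scalerI d0); rewrite -chiMn -nuMn //.
have -> : mnm_muln a d' =
    \big[@mnm_add n'/@mnm0 n']_(i < n') mnm_muln (axis i d') (a i).
  apply/mnmP => j; rewrite mnm_sumE mulmnE (bigD1 j) //= big1 ?addn0.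
    by rewrite mulmnE axisE eqxx mul1n mulnC.
  by move=> i /negPf ij; rewrite mulmnE axisE ij.
suff [_ <-] : Lam' (ev (\big[@mnm_add n'/@mnm0 n']_(i < n') mnm_muln (axis i d') (a i))) /\
    \sum_(i < n') (a i)%:R *: chi w (ev (nu (axis i d'))) =
    chi w (ev (nu (\big[@mnm_add n'/@mnm0 n']_(i < n') mnm_muln (axis i d') (a i)))).
  rewrite /E scaler_sumr; apply: eq_bigr => i _.
  by rewrite (chiE tc') mxE !scalerA mulrAC divff // mul1r.
apply: (big_rec2 (fun m c => Lam' (ev m) /\ c = chi w (ev (nu m)))).
  by rewrite nu0 !ev0 (chi0 tc); split=> //; exact: (il0 hL').
move=> i m c _ [Lm ->].
have Li : Lam' (ev (mnm_muln (axis i d') (a i))).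
  by rewrite evMn; apply/(ilMn hL')/(il_axis hL').
split; first by rewrite evD; exact: (ilD hL').
rewrite nuD // evD (chiD tc); congr (_ + _).
by rewrite (nuMn (a i) (il_axis hL' i)) chiMn.
Qed.

Lemma linear_extension_monoid u :
  dual_monoid W' sigma' u -> dual_monoid W sigma (E u).
Proof.
move=> Su; rewrite -(chi_exponent tc' Su) linear_extension_chi.
  by apply/(monoid_chi tc)/nuL/(exponent_lattice_monoid tc').
exact: (exponent_lattice_monoid tc').
Qed.

(** Adding a suitable sum [b] of vectors [d' e_i] makes the exponents of [u] nonnegative, so [u] is
    a difference of two elements of the monoid, where [nu] controls the map. *)
Lemma linear_extension_lattice u : dual_lattice W' u -> dual_lattice W (E u).
Proof.
move=> hu; pose x : 'rV[int]_n' := \row_i Num.floor (u w'`_i : R).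
pose b := Multinom [tuple (absz (x ord0 i) * d')%N | i < n'].
have evE (a : multinom n') j : ev a 0 j = (a j)%:Z by rewrite mxE.
have Lb : Lam' (ev b).
  have -> : ev b = \sum_i ev (axis i d') *+ absz (x ord0 i).
    apply/rowP => j; rewrite evE summxE mnmE (bigD1 j) //= big1 ?addr0.
      by rewrite mulmxnE evE axisE eqxx mul1n -mulr_natr natz mulrC PoszM.
    by move=> i /negPf ij; rewrite mulmxnE evE axisE ij mul0rn.
  elim/big_ind: _; first exact: (il0 hL').
    by move=> *; exact: (ilD hL').
  by move=> i _; apply/(ilMn hL')/(il_axis hL').
have xb (i : 'I_n') : 0 <= (x + ev b) 0 i.
  have -> : (x + ev b) 0 i = x ord0 i + ev b 0 i by rewrite mxE.
  rewrite evE mnmE.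
  have := leq_pmulr (absz (x ord0 i)) (il_gt0 hL'); lia.
have Lx : Lam' x by rewrite /exponent_lattice /= (chi_floor tc').
have La : Lam' (ev (mz (x + ev b))) by rewrite ev_mz //; exact: (ilD hL').
have -> : u = chi w' (ev (mz (x + ev b))) + (-1) *: chi w' (ev b).
  by rewrite ev_mz // (chiD tc') (chi_floor tc') // scaleN1r addrK.
rewrite linear_extensionD linear_extensionZ !linear_extension_chi //.
by rewrite scaleN1r; apply: dual_latticeB; exact: nuL.
Qed.

End LinearExtension.

Lemma linear_extensionK (R : realType) (V V' : vectType R)
    (W sigma : set V) (n d : nat) (w : n.-tuple V)
    (W' sigma' : set V') (n' d' : nat) (w' : n'.-tuple V') nu nu' :
  toric_coordinates W sigma d w -> toric_coordinates W' sigma' d' w' ->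
  (forall u, exponent_lattice W' w' (ev u) -> exponent_lattice W w (ev (nu u))) ->
  (forall u v, exponent_lattice W' w' (ev u) -> exponent_lattice W' w' (ev v) ->
     nu (u :+ v) = nu u :+ nu v) ->
  (forall u v, exponent_lattice W w (ev u) -> exponent_lattice W w (ev v) ->
     nu' (u :+ v) = nu' u :+ nu' v) ->
  (forall u, exponent_lattice W' w' (ev u) -> nu' (nu u) = u) ->
  cancel (linear_extension w d' w' nu) (linear_extension w' d w nu').
Proof.
move=> tc tc' nuL nuD nu'D nuK u; have hL' := index_lattice_exponent tc'.
have d0 : d'%:R != 0 :> R by rewrite pnatr_eq0 -lt0n (il_gt0 hL').
pose T u := linear_extension w' d w nu' (linear_extension w d' w' nu u).
have TD x y : T (x + y) = T x + T y by rewrite /T !linear_extensionD.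
have TZ c x : T (c *: x) = c *: T x by rewrite /T !linear_extensionZ.
rewrite -/(T u) [in RHS](dual_basisE u (tc_basis tc')).
rewrite {1}(dual_basisE u (tc_basis tc')).
apply: (big_rec2 (fun x y => T x = y)) => [|i x y _ <-].
  by rewrite -(scale0r 0) TZ !scale0r.
rewrite TD TZ; congr (_ *: _ + _).
apply: (scalerI d0); rewrite -TZ.
have -> : d'%:R *: coordf w' i = chi w' (ev (axis i d')).
  apply: (chi_ext tc') => j; rewrite (chiE tc') mxE scale_lfunE coordfE axisE.
  rewrite coord_free ?(basis_free (tc_basis tc')) //.
  by rewrite mulnC eq_sym -pmulrn natrM.
have La := il_axis hL' i.
rewrite /T (linear_extension_chi tc tc' nuD La).
by rewrite (linear_extension_chi tc' tc nu'D (nuL _ La)) nuK.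
Qed.

(** One linear map serves twice: on the monoids it gives the map of varieties, on the full dual
    lattices that of tori, which are the case of the zero cone. Both are composition with it, so
    equivariance holds coordinatewise. *)
Lemma monoid_iso_toric (R : realType) (V V' : vectType R)
    (W sigma : set V) (n d : nat) (w : n.-tuple V)
    (W' sigma' : set V') (n' d' : nat) (w' : n'.-tuple V') nu :
  toric_coordinates W sigma d w -> toric_coordinates W' sigma' d' w' ->
  (forall u, exponent_lattice W' w' (ev u) -> exponent_lattice W w (ev (nu u))) ->
  (forall u v, exponent_lattice W' w' (ev u) -> exponent_lattice W' w' (ev v) ->
     nu (u :+ v) = nu u :+ nu v) ->
  (forall u v, exponent_lattice W' w' (ev u) -> exponent_lattice W' w' (ev v) ->
     nu u = nu v -> u = v) ->
  (forall s, exponent_lattice W w (ev s) ->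
     exists2 u, exponent_lattice W' w' (ev u) & nu u = s) ->
  toric_isomorphic W sigma W' sigma'.
Proof.
move=> tc tc' nuL nuD nu_inj nu_surj.
have /choice[nu' hnu'] : forall s, exists u, exponent_lattice W w (ev s) ->
    exponent_lattice W' w' (ev u) /\ nu u = s.
  move=> s; case: (pselect (exponent_lattice W w (ev s))) => [/nu_surj[u Lu us]|].
    by exists u.
  by exists mnm0.
have nu'L s : exponent_lattice W w (ev s) -> exponent_lattice W' w' (ev (nu' s)).
  by move=> /hnu'[].
have nu'D s t : exponent_lattice W w (ev s) -> exponent_lattice W w (ev t) ->
    nu' (s :+ t) = nu' s :+ nu' t.
  move=> Ls Lt; have hL := index_lattice_exponent tc.
  have hL' := index_lattice_exponent tc'.
  have Lst : exponent_lattice W w (ev (s :+ t)) by rewrite evD; exact: (ilD hL).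
  have [Ls' es] := hnu' s Ls; have [Lt' et] := hnu' t Lt.
  have [Lst' est] := hnu' _ Lst; apply: nu_inj => //.
    by rewrite evD; exact: (ilD hL').
  by rewrite nuD // est es et.
have nuK u : exponent_lattice W' w' (ev u) -> nu' (nu u) = u.
  move=> Lu; have [Lu' E] := hnu' _ (nuL u Lu); exact: nu_inj.
have nu'K s : exponent_lattice W w (ev s) -> nu (nu' s) = s by move=> /hnu'[].
pose L := linear_extension w d' w' nu; pose L' := linear_extension w' d w nu'.
have LK : cancel L L' := linear_extensionK tc tc' nuL nuD nu'D nuK.
have L'K : cancel L' L := linear_extensionK tc' tc nu'L nu'D nuD nu'K.
have LD : forall u v, L (u + v) = L u + L v by exact: linear_extensionD.
have L'D : forall u v, L' (u + v) = L' u + L' v by exact: linear_extensionD.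
have torus0 (U : vectType R) (X : set U) : dual_monoid X [set 0] 0.
  by apply/torus_monoid; exact: dual_lattice0.
have torusD (U : vectType R) (X : set U) u v : dual_monoid X [set 0] u ->
    dual_monoid X [set 0] v -> dual_monoid X [set 0] (u + v).
  by move=> /torus_monoid hu /torus_monoid hv; apply/torus_monoid/dual_latticeD.
exists (pullback W' [set 0] L), (pullback W' sigma' L); split.
- apply: pullback_iso LD L'D LK L'K _ _ _ _ _ _ => //.
  + by move=> u v; exact: torusD.
  + by move=> u v; exact: torusD.
  + by move=> u /torus_monoid hu; apply/torus_monoid/(linear_extension_lattice tc tc' nuL nuD).
  + by move=> u /torus_monoid hu; apply/torus_monoid/(linear_extension_lattice tc' tc nu'L nu'D).
- move=> s t _ _; apply/funext => u; rewrite /torus_act /pullback.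
  by case: asboolP => // _; rewrite mul0r.
- apply: pullback_iso LD L'D LK L'K _ _ _ _ _ _ => //.
  + exact: (monoid0 tc).
  + exact: (monoid0 tc').
  + by move=> u v; exact: (monoidD tc).
  + by move=> u v; exact: (monoidD tc').
  + by move=> u; exact: (linear_extension_monoid tc tc' nuL nuD).
  + by move=> u; exact: (linear_extension_monoid tc' tc nu'L nu'D).
move=> t x _ _; apply/funext => u; rewrite /torus_act /pullback.
case: asboolP => [Su|_]; last by rewrite mulr0.
by rewrite asboolT //; apply/torus_monoid; case: Su.
Qed.

(** * Regular maps are holomorphic *)

Section RegularHolomorphic.
Variables (R : realType) (V : vectType R) (W sigma : set V).
Local Notation C := (Cplx R).

Lemma linear_analytic N (c : 'I_N -> C) (a : 'rV[C]_N) :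
  analytic_at (fun z : 'rV[C]_N => \sum_i c i * z ord0 i) a.
Proof.
pose k0 : {ffun 'I_N -> nat} := [ffun=> 0%N].
pose k1 i : {ffun 'I_N -> nat} := [ffun j => (j == i) : nat].
pose F (z : 'rV[C]_N) : C := \sum_i c i * z ord0 i.
(* Taylor coefficients at [a]: [F a] at the zero multi-index and [c i] at the [i]-th unit one, so
   that partial sums are constant once they contain [A0]. *)
exists (fun k => (k == k0)%:R * F a + \sum_i (k == k1 i)%:R * c i).
apply: (@filterS _ _ (nbhs_filter a) setT) => [z _|]; last exact: filterT.
apply: cvg_near_cst; first exact: (@filter_filter _ _ totally_filter).
pose A0 : {fset {ffun 'I_N -> nat}} := [fset k | k in k0 :: codom k1]%fset.
exists A0 => //= A hA.
rewrite /partial_sum -(big_seq_fsetE _ A predT (fun k => ((k == k0)%:R * F a +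
  \sum_i (k == k1 i)%:R * c i) * \prod_i (z ord0 i - a ord0 i) ^+ k i)) /=.
have inA k : k \in k0 :: codom k1 -> k \in A.
  by move=> hk; apply: (fsubsetP hA); rewrite in_fset.
have pick k (g : {ffun 'I_N -> nat} -> C) : k \in A ->
    \sum_(l <- A) (l == k)%:R * g l = g k.
  move=> kA; rewrite (bigD1_seq k) //= eqxx mul1r big1 ?addr0 // => l /negPf->.
  by rewrite mul0r.
pose m (k : {ffun 'I_N -> nat}) : C := \prod_i (z ord0 i - a ord0 i) ^+ k i.
transitivity (\sum_(k <- A) (k == k0)%:R * (F a * m k) +
    \sum_i \sum_(k <- A) (k == k1 i)%:R * (c i * m k)).
  rewrite exchange_big -big_split; apply: eq_bigr => k _ /=.
  rewrite mulrDl mulr_suml -mulrA; congr (_ + _).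
  by apply: eq_bigr => i _; rewrite mulrA.
rewrite (pick k0 (fun k => F a * m k)); last by apply: inA; rewrite mem_head.
rewrite /m big1 ?mulr1 => [|i _]; last by rewrite ffunE expr0.
rewrite /F -big_split; apply: eq_bigr => i _ /=.
rewrite (pick (k1 i) (fun k => c i * m k)); last first.
  by apply: inA; rewrite inE codom_f orbT.
rewrite /m (bigD1 i) //= ffunE eqxx expr1 big1 => [|j /negPf ji].
  by rewrite mulr1 mulrBr addrC subrK.
by rewrite ffunE ji expr0.
Qed.

Lemma regular_holomorphic (f : monomial_values V -> C) p :
  regular_function W sigma f -> holomorphic_at W sigma f p.
Proof.
move=> [N [c [m [hm hf]]]].
exists N, m, (fun z => \sum_i c i * z ord0 i); split=> //.
  exact: linear_analytic.
apply: (@filterS _ _ (nbhs_filter p) setT) => [x _ xT|]; last exact: filterT.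
 rewrite hf //; apply: eq_bigr => i _.
by rewrite mxE.
Qed.

Lemma monomial_regular u : dual_monoid W sigma u ->
  regular_function W sigma (fun x => x u).
Proof.
move=> Su; exists 1%N, (fun=> 1), (fun=> u); split=> // x _.
by rewrite big_ord1 mul1r.
Qed.

End RegularHolomorphic.

Lemma algebraic_holomorphic (R : realType) (V V' : vectType R)
    (W sigma : set V) (W' sigma' : set V') phi :
  algebraic_map W sigma W' sigma' phi ->
  holomorphic_map W sigma setT W' sigma' setT phi.
Proof.
move=> [phiT phiR] x [xT _]; split; first by split=> //; exact: phiT.
move=> u Su; apply: regular_holomorphic.
exact: (phiR _ (monomial_regular Su)).
Qed.

(** Regular maps are holomorphic everywhere, so only the base point is at stake. By equivariance its
    image is fixed by every [alpha (beta t)], that is by the whole torus, and such a point is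
    unique. *)
Lemma toric_germ_iso (R : realType) (V V' : vectType R)
    (W sigma : set V) (n d : nat) (w : n.-tuple V)
    (W' sigma' : set V') (n' d' : nat) (w' : n'.-tuple V') :
  toric_coordinates W sigma d w -> toric_coordinates W' sigma' d' w' ->
  toric_isomorphic W sigma W' sigma' ->
  analytic_germs_isomorphic W sigma (@fixed_point R V)
                            W' sigma' (@fixed_point R V').
Proof.
move=> tc tc' [alpha [phi [[alphaA [beta [betaA _ alphaK]]] _ [phiA [psi [psiA psiK phiK]]] equi]]].
have oT : toric_variety W sigma (@fixed_point R V).
  by rewrite (fixed_point_toric tc); exact: (toric_point_toric tc).
exists setT, setT, phi, psi; split; first by split; split=> //; exact: openT.
split.
- exact: algebraic_holomorphic.
- exact: algebraic_holomorphic.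
- by move=> x [/psiK].
- by move=> y [/phiK].
apply: (torus_fixed tc'); first exact: phiA.1.
move=> t tT; have bT : torus W (beta t) by exact: betaA.1.
rewrite -(alphaK t tT) -equi //; congr phi; apply/funext => u.
rewrite /torus_act /fixed_point; case: eqVneq => [->|_]; last by rewrite mulr0.
by rewrite mulr1; case: bT.
Qed.

Theorem corollary4p6 (R : realType) (V V' : vectType R)
    (W sigma : set V) (W' sigma' : set V')
    (hP : maximal_simplicial_pair W sigma)
    (hP' : maximal_simplicial_pair W' sigma')
    (o : monomial_values V) (o' : monomial_values V')
    (ho : closed_orbit W sigma [set o])
    (ho' : closed_orbit W' sigma' [set o']) :
  analytic_germs_isomorphic W sigma o W' sigma' o' <->
  toric_isomorphic W sigma W' sigma'.
Proof.
have [n [d [w tc]]] := exists_toric_coordinates hP.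
have [n' [d' [w' tc']]] := exists_toric_coordinates hP'.
rewrite (closed_orbit_fixed tc ho) (closed_orbit_fixed tc' ho').
split; last exact: (toric_germ_iso tc tc').
move=> [U [U' [phi [psi [[hU hU'] [hphi hpsi psiK phiK phio]]]]]].
have psio : psi (@fixed_point R V') = @fixed_point R V.
  rewrite -phio psiK //; split; last by case: hU.
  by rewrite (fixed_point_toric tc); exact: (toric_point_toric tc).
have [Phi [Q hQ]] := germ_expansion tc tc' hU hphi.
have [Psi [Q' hQ']] := germ_expansion tc' tc hU' hpsi.
have hPhi : formal_hom (exponent_lattice W' w') (exponent_lattice W w) Phi.
  by apply: (germ_formal_hom tc tc' hU hphi phio (Q := Q)) => u /hQ[].
have hPsi : formal_hom (exponent_lattice W w) (exponent_lattice W' w') Psi.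
  by apply: (germ_formal_hom tc' tc hU' hpsi psio (Q := Q')) => u /hQ'[].
have PhiPsi : formal_inverse (exponent_lattice W' w') Phi Psi.
  apply: (germ_formal_inverse tc tc' hU' hpsi psio phiK hPsi (Q := Q)).
    by move=> u /hQ[].
  by move=> a /hQ'[].
have PsiPhi : formal_inverse (exponent_lattice W w) Psi Phi.
  apply: (germ_formal_inverse tc' tc hU hphi phio psiK hPhi (Q := Q')).
    by move=> u /hQ'[].
  by move=> a /hQ[].
(* The weight lives on the exponents of the second variety, because [Phi] sends its monomials to
   series on the first. *)
have [lam [lamD lam_inj]] := exists_injective_weight R n'.
have [nu [nuL nuD nu_inj nu_surj]] := formal_iso_monoid_iso
  (index_lattice_exponent tc) (index_lattice_exponent tc')
  hPhi hPsi PhiPsi PsiPhi lamD lam_inj.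
exact: (monoid_iso_toric tc tc' nuL nuD nu_inj nu_surj).
Qed.
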